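(* Let $p$ be a prime number. Let $G$ be a finitely generated group and let $G=G_0\supseteq G_1\supseteq G_2\supseteq\cdots$ be a descending chain of normal subgroups of $G$ of $p$-power index. Then: (1) The sequence $\left(\frac{b_1(G_i;\mathbb{F}_p)}{[G:G_i]}\right)_i$ is monotone decreasing (i.e. non-increasing) and therefore converges. (2) Assume that $\bigcap_{i\in\mathbb{N}} G_i=\{1\}$. Then $$b_1^{(2)}(G)\le \lim_{i\to\infty}\frac{b_1(G_i;\mathbb{F}_p)}{[G:G_i]}.$$
   Context: For a finitely generated group $H$ and a field $k$, $b_1(H;k)=\dim_k H_1(H;k)$ is the first Betti number of $H$ with (trivial) coefficients in $k$; $\mathbb{F}_p$ is the field with $p$ elements. $b_1^{(2)}(G)$ denotes the first $L^2$-Betti number of $G$: $b_1^{(2)}(G)=\dim_{\mathcal{N}(G)} H_1\bigl(\mathcal{N}(G)\otimes_{\mathbb{Z}G} C_*(EG)\bigr)$, where $EG$ is the universal covering of a CW-model of the classifying space $BG$, $C_*(EG)$ is its cellular $\mathbb{Z}G$-chain complex, $\mathcal{N}(G)$ is the group von Neumann algebra, and $\dim_{\mathcal{N}(G)}$ is Lück's extended von Neumann dimension function for arbitrary (algebraic) $\mathcal{N}(G)$-modules. *)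

(* Defs.v *)
From HB Require Import structures.
From mathcomp Require Import all_boot all_order all_algebra generic_quotient ring_quotient.
From mathcomp Require Import all_classical all_reals all_analysis.
From mathcomp Require Import finmap complex ring.

Set Implicit Arguments.
Unset Strict Implicit.
Unset Printing Implicit Defensive.

Import Order.TTheory GRing.Theory Num.Theory.

Local Open Scope classical_set_scope.
Local Open Scope ring_scope.

Section Groups.
Variable G : groupType.

Definition subgroup_type (H : groupClosed G) : Type := {x : G | x \in H}.

HB.instance Definition _ (H : groupClosed G) := SubType.on (subgroup_type H).
HB.instance Definition _ (H : groupClosed G) := Choice.on (subgroup_type H).
HB.instance Definition _ (H : groupClosed G) :=
  SubChoice_isSubGroup.Build G (mem H) (subgroup_type H)
    (conj (@gpred1 _ H) (@gpredF _ H)).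

Definition finitely_generated : Prop :=
  exists s : seq G,
    forall H : groupClosed G, {subset s <= H} -> forall x, x \in H.

Definition normal_subgroup (H : groupClosed G) : Prop :=
  forall x y : G, x \in H -> (x ^ y)%g \in H.

Definition left_cosets (H : groupClosed G) : set (set G) :=
  [set [set y | (x^-1 * y)%g \in H] | x in [set: G]].

(* The index [G : H], with value 0 when it is infinite. *)
Definition subgroup_index (H : groupClosed G) : nat :=
  #|` fset_set (left_cosets H)|.

(* As p ^ k is positive for p prime, this forces the index to be finite. *)
Definition p_power_index (p : nat) (H : groupClosed G) : Prop :=
  exists k : nat, subgroup_index H = (p ^ k)%N.

End Groups.

Section QuotientModule.
Variables (A : pzRingType) (V : lmodType A) (S : submodClosed V).

Fact submod_zmod_closed : zmod_closed S.
Proof.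
by split=> [|u v uS vS]; rewrite ?rpred0// rpredD// -scaleN1r rpredZ.
Qed.

Definition submod_zmod : zmodClosed V :=
  HB.pack (GRing.SubmodClosed.sort S)
    (GRing.isZmodClosed.Build V (GRing.SubmodClosed.sort S) submod_zmod_closed).

Definition quot_lmod : Type := Quotient.quot submod_zmod.

HB.instance Definition _ := GRing.Zmodule.on quot_lmod.

Let pi (v : V) : quot_lmod := \pi_((Quotient.quot submod_zmod))%qT v.

Definition quot_scale (a : A) (u : quot_lmod) : quot_lmod :=
  pi (a *: (repr (u : (Quotient.quot submod_zmod)))).

Let quot_eq v w : (pi v = pi w) <-> (v - w \in S).
Proof.
split=> [/eqP|vw]; first by rewrite -[_ == _]/(_ == _ %[mod (Quotient.quot submod_zmod)])%qT -Quotient.idealrBE.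
by apply/eqP; rewrite -[_ == _]/(_ == _ %[mod (Quotient.quot submod_zmod)])%qT -Quotient.idealrBE.
Qed.

Let quot_scaleE a v : quot_scale a (pi v) = pi (a *: v).
Proof.
apply/quot_eq; rewrite -scalerBr; apply: rpredZ; apply/quot_eq.
by rewrite /pi reprK.
Qed.

Let piD v w : pi v + pi w = pi (v + w).
Proof. by rewrite /pi raddfD. Qed.

Let quotP (u : quot_lmod) : exists v, u = pi v.
Proof. by exists (repr (u : (Quotient.quot submod_zmod))); rewrite /pi reprK. Qed.

Let quot_scalerA a b u : quot_scale a (quot_scale b u) = quot_scale (a * b) u.
Proof. by have [v ->] := quotP u; rewrite !quot_scaleE scalerA. Qed.

Let quot_scale1r : left_id 1 quot_scale.
Proof. by move=> u; have [v ->] := quotP u; rewrite quot_scaleE scale1r. Qed.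

Let quot_scalerDr : right_distributive quot_scale +%R.
Proof.
move=> a u w; have [v ->] := quotP u; have [v' ->] := quotP w.
by rewrite !(piD, quot_scaleE) scalerDr.
Qed.

Let quot_scalerDl u : {morph quot_scale^~ u : a b / a + b}.
Proof.
by move=> a b; have [v ->] := quotP u; rewrite !(piD, quot_scaleE) scalerDl.
Qed.

HB.instance Definition _ := GRing.Zmodule_isLmodule.Build A quot_lmod
  quot_scalerA quot_scale1r quot_scalerDr quot_scalerDl.

End QuotientModule.

Section FreeModule.
Variables (A : pzRingType) (X : choiceType).

Definition finite_support : pred (X -> A^o) :=
  fun f => `[< finite_set [set x | f x != 0] >].

Fact finite_support_submod : submod_closed finite_support.
Proof.
split=> [|a f g /asboolP fF /asboolP gF]; apply/asboolP.
  by rewrite (_ : [set _ | _] = set0)// -subset0 => x /=; rewrite eqxx.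
apply: (@sub_finite_set _ _ ([set x | f x != 0] `|` [set x | g x != 0])).
  move=> x /=; apply: contraPP => /not_orP[/negP/negPn/eqP fx0 /negP/negPn/eqP gx0].
  by apply/negP/negPn/eqP; rewrite -[LHS]/(a *: f x + g x) fx0 gx0 scaler0 addr0.
by rewrite finite_setU.
Qed.
HB.instance Definition _ :=
  GRing.isSubmodClosed.Build A (X -> A^o) finite_support finite_support_submod.

Record free_module := FreeModule {
  coord_of :> X -> A^o;
  _ : finite_support coord_of }.

HB.instance Definition _ := [isSub for coord_of].
HB.instance Definition _ := [Choice of free_module by <:].
HB.instance Definition _ := [SubChoice_isSubLmodule of free_module by <:].

Fact basis_vect_subproof (x : X) :
  finite_support (fun y => if y == x then 1 else 0).
Proof.
apply/asboolP/(@sub_finite_set _ _ [set x]); last exact: finite_set1.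
by move=> y /=; have [->|_] := eqVneq y x; rewrite ?eqxx.
Qed.
Definition basis_vect (x : X) : free_module :=
  FreeModule (basis_vect_subproof x).

Definition linear_ext (V : lmodType A) (e : X -> V) (c : free_module) : V :=
  \sum_(x \in [set: X]) (c x : A) *: e x.

Lemma linear_ext_widen (V : lmodType A) (e : X -> V) (c : free_module) (B : set X) :
  finite_set B -> [set x | c x != 0] `<=` B ->
  linear_ext e c = \sum_(x \in B) (c x : A) *: e x.
Proof.
move=> finB cB; rewrite /linear_ext; apply/esym/fsbig_widen => // x [_ Bx] /=.
suff -> : c x = 0 by rewrite scale0r.
by apply/eqP/negPn/negP => cx; apply: Bx; exact: cB.
Qed.

Lemma linear_ext_is_linear (V : lmodType A) (e : X -> V) :
  linear (linear_ext e).
Proof.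
move=> a c d; have /asboolP cF := valP c; have /asboolP dF := valP d.
pose B := [set x | c x != 0] `|` [set x | d x != 0].
have finB : finite_set B by rewrite finite_setU.
rewrite (@linear_ext_widen _ _ c B)//; last by move=> x; left.
rewrite (@linear_ext_widen _ _ d B)//; last by move=> x; right.
rewrite (@linear_ext_widen _ _ _ B)//; last first.
  move=> x /=; apply: contraPP => /not_orP[/negP/negPn/eqP cx0 /negP/negPn/eqP dx0].
  by apply/negP/negPn/eqP; rewrite -[LHS]/(a *: c x + d x) cx0 dx0 scaler0 addr0.
rewrite !fsbig_finite//= scaler_sumr -big_split/=.
by apply: eq_bigr => x _; rewrite scalerA -scalerDl.
Qed.

HB.instance Definition _ (V : lmodType A) (e : X -> V) :=
  GRing.isLinear.Build A free_module V _ (linear_ext e)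
    (linear_ext_is_linear e).

End FreeModule.
Arguments basis_vect {A X} x.

(* Let rho be a multiplicative map G -> A, making A a right ZG-module.  The
   degree <= 2 part of A (x)_{ZG} C_*(EG) is written out for the standard
   simplicial model of BG, for which C_*(EG) is the bar complex: C_n(EG) is
   ZG-free on the symbols [g_1|...|g_n], with
     d [g|h] = g [h] - [gh] + [g]   and   d [g] = g [] - [],
   so that A (x)_{ZG} C_n(EG) is the free left A-module on G^n. *)
Section BarHomology.
Variables (A : pzRingType) (G : groupType) (rho : G -> A).

Definition bar_d1 : free_module A G -> A^o :=
  linear_ext (fun g => rho g - 1 : A^o).

Definition bar_d2 : free_module A (G * G)%type -> free_module A G :=
  linear_ext (fun gh => rho gh.1 *: basis_vect gh.2
    - basis_vect (gh.1 * gh.2)%g + basis_vect gh.1).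

Lemma bar_d2K : rho 1%g = 1 -> {morph rho : g h / (g * h)%g >-> g * h} ->
  forall c, bar_d1 (bar_d2 c) = 0.
Proof.
move=> rho1 rhoM c; rewrite /bar_d1 /bar_d2.
have d1b g : linear_ext (fun g => rho g - 1 : A^o) (basis_vect g) = rho g - 1.
  rewrite (@linear_ext_widen _ _ _ _ _ [set g])//; last first.
    by move=> x /=; have [->|_] := eqVneq x g; rewrite ?eqxx.
  by rewrite fsbig_set1 /= eqxx scale1r.
pose B := [set x | c x != 0].
rewrite [X in linear_ext _ X](@linear_ext_widen _ _ _ _ _ B)//; last exact/asboolP/(valP c).
rewrite fsbig_finite /=; last exact/asboolP/(valP c).
rewrite linear_sum big1// => -[g h] _; rewrite linearZ /= linearD linearB linearZ /=.
rewrite !d1b rhoM -[rho g *: _]/(rho g * (rho h - 1)) mulrBr mulr1 opprB.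
rewrite (addrC (_ - rho g)) (addrA _ _ (- rho g)) subrK addrA subrK subrr.
by rewrite scaler0.
Qed.

Definition is_cycle1 : pred (free_module A G) := fun c => bar_d1 c == 0.

Fact is_cycle1_submod : submod_closed is_cycle1.
Proof.
split=> [|a f g /eqP f0 /eqP g0]; apply/eqP; rewrite /bar_d1 ?linear0//.
by rewrite linearP /= -/(bar_d1 f) -/(bar_d1 g) f0 g0 scaler0 addr0.
Qed.
HB.instance Definition _ :=
  GRing.isSubmodClosed.Build A (free_module A G) is_cycle1 is_cycle1_submod.

Record cycle1 := Cycle1 {
  cycle1_val :> free_module A G;
  _ : is_cycle1 cycle1_val }.

HB.instance Definition _ := [isSub for cycle1_val].
HB.instance Definition _ := [Choice of cycle1 by <:].
HB.instance Definition _ := [SubChoice_isSubLmodule of cycle1 by <:].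

Definition is_boundary1 : pred cycle1 :=
  fun z => `[< exists c, bar_d2 c = val z >].

Fact is_boundary1_submod : submod_closed is_boundary1.
Proof.
split=> [|a f g /asboolP[c cf] /asboolP[d dg]]; apply/asboolP.
  by exists 0; rewrite /bar_d2 !linear0.
by exists (a *: c + d); rewrite /bar_d2 linearP/= -/(bar_d2 c) -/(bar_d2 d) cf dg.
Qed.
HB.instance Definition _ :=
  GRing.isSubmodClosed.Build A cycle1 is_boundary1 is_boundary1_submod.

Definition H1 : lmodType A :=
  quot_lmod (GRing.SubmodClosed.clone A cycle1 is_boundary1 _).

End BarHomology.

(* The dimension of a k-vector space, with value 0 when it is infinite. *)
Definition dimension (k : fieldType) (V : lmodType k) : nat :=
  xget 0%N [set n | exists f : {linear 'rV[k]_n -> V}, bijective f].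

Definition b1 (H : groupType) (k : fieldType) : nat :=
  dimension (H1 (fun _ : H => 1 : k)).


(* l^2(G), as the subspace of square-summable functions G -> C. *)
Section L2.
Variables (R : realType) (G : groupType).
Local Notation normc := ComplexField.Normc.normc.

Definition l2_sqnorm (f : G -> R[i]^o) : \bar R :=
  \esum_(x in [set: G]) (normc (f x) ^+ 2)%:E.

Definition square_summable : pred (G -> R[i]^o) :=
  fun f => `[< (l2_sqnorm f < +oo)%E >].

Lemma l2_sqnorm_ge0 f : (0 <= l2_sqnorm f)%E.
Proof. by apply: esum_ge0 => x _; rewrite lee_fin sqr_ge0. Qed.

Lemma l2_sqnorm0 : l2_sqnorm 0 = 0%E.
Proof.
apply: esum1 => x _; rewrite [X in normc X](_ : _ = 0)//.
by rewrite ComplexField.Normc.normc0 expr0n.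
Qed.

Lemma l2_sqnormD f g :
  (l2_sqnorm (f + g)%R <= 2%:E * (l2_sqnorm f + l2_sqnorm g))%E.
Proof.
have nng h x : (0 <= (normc (h x : R[i]^o) ^+ 2)%:E :> \bar R)%E.
  by rewrite lee_fin sqr_ge0.
have mul2e (y : \bar R) : (2%:E * y = y + y)%E.
  by rewrite -[2]/(1 + 1) EFinD ge0_muleDl ?lee_fin// mul1e.
rewrite mul2e -esumD//.
rewrite -esumD; try by move=> *; rewrite adde_ge0.
apply: le_esum => x _; rewrite -!EFinD lee_fin.
rewrite [X in normc X](_ : _ = f x + g x)//.
have nn (z : R[i]) : 0 <= normc z by case: z => u v; exact: sqrtr_ge0.
apply: (@le_trans _ _ ((normc (f x) + normc (g x)) ^+ 2)).
  by rewrite lerXn2r ?nnegrE ?addr_ge0// le_normcD.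
rewrite -subr_ge0.
set u := normc (f x); set v := normc (g x).
by rewrite (_ : _ - _ = (u - v) ^+ 2) ?sqr_ge0//; ring.
Qed.

Lemma l2_sqnormZ a f :
  (l2_sqnorm (a *: f)%R <= (normc a ^+ 2)%:E * l2_sqnorm f)%E.
Proof.
apply: ge_ereal_sup => _ [X [finX _] <-].
rewrite (eq_fsbigr (fun x => (normc a ^+ 2)%:E * (normc (f x) ^+ 2)%:E)%E); last first.
  move=> x _; rewrite -EFinM -exprMn -ComplexField.Normc.normcM//.
rewrite -ge0_mule_fsumr; last by move=> x; rewrite lee_fin sqr_ge0.
by rewrite lee_wpmul2l ?lee_fin ?sqr_ge0// esum_ge//; exists X.
Qed.

Lemma l2_sqnorm_reindex (s : G -> G) f : bijective s ->
  l2_sqnorm (f \o s) = l2_sqnorm f.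
Proof.
move=> [t st ts]; apply/esym/reindex_esum; split=> //.
- by move=> x y _ _; exact: (can_inj st).
- by move=> y _; exists (t y).
Qed.

Fact square_summable_submod : submod_closed square_summable.
Proof.
split=> [|a f g /asboolP fS /asboolP gS]; apply/asboolP.
  by rewrite l2_sqnorm0 ltry.
apply: le_lt_trans (l2_sqnormD _ _) _; rewrite lte_mul_pinfty//.
by rewrite lte_add_pinfty// (le_lt_trans (l2_sqnormZ _ _))// lte_mul_pinfty// lee_fin sqr_ge0.
Qed.
HB.instance Definition _ :=
  GRing.isSubmodClosed.Build R[i] (G -> R[i]^o) square_summable
    square_summable_submod.

Record l2 := L2 { l2_val :> G -> R[i]^o; _ : square_summable l2_val }.

HB.instance Definition _ := [isSub for l2_val].
HB.instance Definition _ := [Choice of l2 by <:].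
HB.instance Definition _ := [SubChoice_isSubLmodule of l2 by <:].

Fact l2_translate_subproof (s : G -> G) (sb : bijective s) (f : l2) :
  square_summable (f \o s).
Proof. by apply/asboolP; rewrite l2_sqnorm_reindex//; have /asboolP := valP f. Qed.

Fact bijective_mulgl (g : G) : bijective (fun x : G => (g^-1 * x)%g).
Proof.
by exists (fun x => (g * x)%g) => x; rewrite ?mulKg ?mulVKg.
Qed.

Fact bijective_mulgr (g : G) : bijective (fun x : G => (x * g)%g).
Proof.
by exists (fun x => (x * g^-1)%g) => x; rewrite ?mulgK ?mulgVK.
Qed.

(* The left translation by g, mapping the Dirac function at h to the one at
   g h. *)
Definition ltrans (g : G) (f : l2) : l2 :=
  L2 (l2_translate_subproof (bijective_mulgl g) f).

(* The right translation by g^-1, mapping the Dirac function at h to the one at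
   h g^-1. *)
Definition rtrans (g : G) (f : l2) : l2 :=
  L2 (l2_translate_subproof (bijective_mulgr g) f).

Fact dirac_subproof (g : G) :
  square_summable (fun x => if x == g then 1 else 0).
Proof.
apply/asboolP; rewrite /l2_sqnorm.
rewrite (_ : \esum_(x in _) _ = \esum_(x in [set g]) (1%:E : \bar R)).
  by rewrite esum_set1 ?ltry// lee_fin.
rewrite [RHS]esum_mkcond; apply: eq_esum => x _.
rewrite classical_sets.in_set1; case: eqP => _.
  by rewrite ComplexField.Normc.normc1 expr1n.
by rewrite ComplexField.Normc.normc0 expr0n.
Qed.
Definition l2_dirac (g : G) : l2 := L2 (dirac_subproof g).

End L2.

(* The group von Neumann algebra: the bounded operators on l^2(G) that commute
   with left translations. *)
Section GroupVonNeumannAlgebra.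
Variables (R : realType) (G : groupType).
Local Notation l2 := (l2 R G).

Definition bounded_op (T : l2 -> l2) : Prop :=
  exists M : R, forall f, (l2_sqnorm (T f) <= M%:E * l2_sqnorm f)%E.

Definition is_equivariant_op : pred (l2 -> l2) :=
  fun T => `[< [/\ linear T, bounded_op T &
                   forall g f, T (ltrans g f) = ltrans g (T f)] >].

Lemma bounded_op_ge0 T : bounded_op T ->
  exists2 M : R, 0 <= M & forall f, (l2_sqnorm (T f) <= M%:E * l2_sqnorm f)%E.
Proof.
move=> [M TM]; exists (Num.max 0 M); first by rewrite le_max lexx.
move=> f; apply: le_trans (TM f) _.
by rewrite lee_wpmul2r ?l2_sqnorm_ge0// lee_fin le_max lexx orbT.
Qed.

Fact ltransB g (f1 f2 : l2) : ltrans g (f1 - f2) = ltrans g f1 - ltrans g f2.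
Proof. exact/val_inj. Qed.

Fact is_equivariant_op_zmod : zmod_closed is_equivariant_op.
Proof.
split=> [|S T /asboolP[linS bS eS] /asboolP[linT bT eT]]; apply/asboolP; split.
- by move=> a f g; rewrite -[LHS]/(0 : l2) -[RHS]/(a *: 0 + 0 : l2) scaler0 addr0.
- by exists 0 => f; rewrite mul0e -[X in l2_sqnorm X]/(0 : G -> R[i]^o) l2_sqnorm0.
- by move=> g f; exact/val_inj.
- move=> a f g; rewrite -[LHS]/(S (a *: f + g) - T (a *: f + g)) linS linT.
  by rewrite -[RHS]/(a *: (S f - T f) + (S g - T g)) scalerBr opprD addrACA.
- have [M M0 SM] := bounded_op_ge0 bS; have [N N0 TN] := bounded_op_ge0 bT.
  exists (2 * (M + N)) => f; rewrite -[X in l2_sqnorm X]/(l2_val (S f) - l2_val (T f)).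
  apply: le_trans (l2_sqnormD _ _) _; rewrite EFinM -muleA lee_wpmul2l ?lee_fin//.
  rewrite EFinD ge0_muleDl ?lee_fin// leeD// -scaleN1r.
  apply: le_trans (l2_sqnormZ _ _) _; apply: le_trans (TN f).
  by rewrite /= oppr0 sqrrN expr1n expr0n addr0 sqrtr1 expr1n mul1e.
- move=> g f; rewrite -[RHS]/(ltrans g (S f - T f)) ltransB.
  by rewrite -[LHS]/(S (ltrans g f) - T (ltrans g f)) eS eT.
Qed.
HB.instance Definition _ :=
  GRing.isZmodClosed.Build (l2 -> l2) is_equivariant_op is_equivariant_op_zmod.

Record vN := VN { vN_op :> l2 -> l2; _ : is_equivariant_op vN_op }.

HB.instance Definition _ := [isSub for vN_op].
HB.instance Definition _ := [Choice of vN by <:].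
HB.instance Definition _ := [SubChoice_isSubZmodule of vN by <:].

Fact vN1_subproof : is_equivariant_op idfun.
Proof. by apply/asboolP; split=> //; exists 1 => f; rewrite mul1e. Qed.

Fact vNM_subproof (S T : vN) : is_equivariant_op (S \o T).
Proof.
have /asboolP[linS bS eS] := valP S; have /asboolP[linT [N TN] eT] := valP T.
apply/asboolP; split.
- by move=> a f g /=; rewrite linT linS.
- have [M M0 SM] := bounded_op_ge0 bS; exists (M * N) => f /=.
  by apply: le_trans (SM _) _; rewrite EFinM -muleA lee_wpmul2l ?lee_fin.
- by move=> g f /=; rewrite eT eS.
Qed.

Definition vN_one : vN := VN vN1_subproof.
Definition vN_mul (S T : vN) : vN := VN (vNM_subproof S T).

Fact vN_mulA : associative vN_mul. Proof. by move=> S T U; exact/val_inj. Qed.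
Fact vN_mul1r : left_id vN_one vN_mul. Proof. by move=> S; exact/val_inj. Qed.
Fact vN_mulr1 : right_id vN_one vN_mul. Proof. by move=> S; exact/val_inj. Qed.
Fact vN_mulDl : left_distributive vN_mul +%R.
Proof. by move=> S T U; exact/val_inj. Qed.
Fact vN_mulDr : right_distributive vN_mul +%R.
Proof.
move=> S T U; apply/val_inj/funext => f /=; have /asboolP[linS _ _] := valP S.
by have /= := linS 1 (T f) (U f); rewrite !scale1r.
Qed.
Fact vN_one_neq0 : vN_one != 0.
Proof.
apply/eqP => /(congr1 (fun T : vN => (T (l2_dirac R 1%g) : G -> R[i]^o) 1%g)) /=.
by rewrite eqxx => /eqP; rewrite oner_eq0.
Qed.

HB.instance Definition _ := GRing.Zmodule_isNzRing.Build vN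
  vN_mulA vN_mul1r vN_mulr1 vN_mulDl vN_mulDr vN_one_neq0.

(* The von Neumann trace <T(e), e>, where e is the Dirac function at 1. *)
Definition vN_trace (T : vN) : R[i] := T (l2_dirac R 1%g) 1%g.

Fact vN_of_group_subproof (g : G) : is_equivariant_op (rtrans g).
Proof.
apply/asboolP; split.
- by move=> a f h; exact/val_inj.
- by exists 1 => f; rewrite mul1e l2_sqnorm_reindex//; exact: bijective_mulgr.
- by move=> h f; apply/val_inj/funext => x /=; rewrite mulgA.
Qed.

(* The restriction to G of the ring map ZG -> N(G). *)
Definition vN_of_group (g : G) : vN := VN (vN_of_group_subproof g).

Lemma vN_of_group1 : vN_of_group 1%g = 1.
Proof. by apply/val_inj/funext => f; apply/val_inj/funext => x /=; rewrite mulg1. Qed.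

Lemma vN_of_groupM g h : vN_of_group (g * h)%g = vN_of_group g * vN_of_group h.
Proof. by apply/val_inj/funext => f; apply/val_inj/funext => x /=; rewrite mulgA. Qed.

End GroupVonNeumannAlgebra.

Section L2Betti.
Variables (R : realType) (G : groupType).
Local Notation N := (vN R G).

(* P is a finitely generated projective submodule of M with dim P = r: it is
   the image, under a linear map injective on N^n A, of the left module N^n A
   for an idempotent matrix A with trace r. *)
Definition fg_projective_dim (M : lmodType N) (P : set M) (r : R) : Prop :=
  exists (n : nat) (A : 'M[N]_n) (f : {linear 'rV[N]_n -> M}),
    [/\ A *m A = A,
        {in [set x *m A | x in [set: 'rV[N]_n]] &, injective f},
        P = f @` [set x *m A | x in [set: 'rV[N]_n]] &
        r = complex.Re (\sum_(i < n) vN_trace (A i i))].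

(* Lueck's dimension: the supremum of dim P over all finitely generated
   projective submodules P of M. *)
Definition lueck_dim (M : lmodType N) : \bar R :=
  ereal_sup [set r%:E | r in [set r | exists P, @fg_projective_dim M P r]].

Definition l2_b1 : \bar R := lueck_dim (H1 (@vN_of_group R G)).

End L2Betti.

Definition betti_ratio (R : realType) (p : nat) (G : groupType)
    (H : groupClosed G) : R :=
  (b1 (subgroup_type H) 'F_p)%:R / (subgroup_index H)%:R.

(* Main.v *)
From HB Require Import structures.
From mathcomp Require Import all_boot all_order all_algebra.
From mathcomp Require Import all_fingroup all_solvable all_field mxabelem.
From mathcomp Require Import generic_quotient ring_quotient.
From mathcomp Require Import sesquilinear spectral.
From mathcomp Require Import all_classical all_reals all_analysis.
From mathcomp Require Import finmap complex ring lra zify.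
Require Import Defs.
Set Implicit Arguments.
Unset Strict Implicit.
Unset Printing Implicit Defensive.
Import Order.TTheory GRing.Theory Num.Theory numFieldNormedType.Exports.
Local Open Scope classical_set_scope.
Local Open Scope ring_scope.

(** Throughout, [s_1 .. s_d] generate [G] as a monoid, and [n] is the index of the
    normal subgroup [K] under consideration.

    _Monotonicity._ A derivation [D] of [G] with values in the functions
    [G / K -> F_p] is given by a unique function [b : G -> F_p] with
    [b (k x) = b k + b x] for [k] in [K], through [D g x = b (x g) - b x]. Such a
    [b] consists of a homomorphism [K -> F_p] and its values at representatives
    of the nontrivial cosets, so the space of derivations has dimension
    [b_1(K; F_p) + n - 1] ([betti_formula]). In terms of the values of
    [D] on the generators, it is the space of solutions of the Fox equations of
    all relations between them, of which finitely many suffice. For [K] inside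
    [H], the [p]-group [H / K] acts on the solutions over [G / K] by left
    translations, with the solutions over [G / H] as invariants. A
    representation of a [p]-group over [F_p] has dimension at most the order of
    the group times the dimension of the invariants ([pgroup_dim_le]), because
    the translates of a nonzero vector do not all vanish under a projection onto
    the invariants. Hence the dimension of the space of solutions, divided by
    [n], is decreasing for every fixed set of relations
    ([fox_solution_monotone]). As [1 / n] decreases too, so does [b_1 / n].

    _Comparison with the L2-Betti number._ Fix a level [i] and finitely many
    relations that compute [b_1(G_i; F_p)]; let [B] be their Fox matrix over
    [Z G], let [c] be the column of the [s_j - 1], and let
    [Delta = B^* B + c c^*] be the Laplacian. Let [P] be an idempotent matrix over
    the group von Neumann algebra whose module embeds into the first homology.
    Lifting to cycles that are supported on the generators gives a projective
    module of rows in the kernel of [c] which meets the row space of [B]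
    trivially. From this follows
    [tr P <= tr (1 - Delta / K)^2k] for all [k], where [K] now bounds the norm of
    [Delta] ([trace_bound]). The von Neumann algebra enters through the
    projection onto the kernel of a matrix, the weak limit of a decreasing
    sequence of polynomials in the matrix and its adjoint
    ([kernel_projection]), the trace property, and the fact that
    [tr (K - M M^* )^j] and [tr (K - M^* M)^j] differ by a constant depending only
    on the size of [M].

    For fixed [k] the right hand side is an integral combination of traces of
    group elements. If [j] is large, it equals the trace of the same polynomial
    in the image [Delta_j] of [Delta] over [G / G_j], divided by the index. The
    matrix [Delta_j] is integral and positive semidefinite; the product of its
    nonzero eigenvalues is a positive integer, so few of them are small, and for
    large [k] the trace is close to the dimension of the kernel, uniformly in
    [j] ([spectral_estimate]). Reduction modulo [p] can only increase the kernel
    of [B], so this dimension is at most that of the space of solutions of the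
    Fox equations over [F_p] minus [n - 1]. Relative to the index, the latter
    decreases from the level [i] to the level [j], and at [i] it is
    [b_1(G_i; F_p)]. Letting [k] tend to infinity shows that [tr P] is at most
    the ratio at [i], for every [i] ([projective_dim_le]). *)

(** * The Hilbert space of square-summable functions *)

HB.lock Definition nsq (R : realType) (G : groupType) (f : l2 R G) : R :=
  fine (l2_sqnorm f).

Arguments nsq {R G} f.

(** The real part of the inner product of [l2], by polarisation. It determines
    the complex inner product, since the imaginary part is the real part of
    the product with ['i *: g], and it carries the real parts of traces, which
    are all that von Neumann dimensions need. *)
HB.lock Definition ip (R : realType) (G : groupType) (f g : l2 R G) : R :=
  (nsq (f + g) - nsq (f - g)) / 4.

Arguments ip {R G} f g.

Section L2Inner.
Variables (R : realType) (G : groupType).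
Local Notation normc := ComplexField.Normc.normc.
Local Notation l2 := (l2 R G).
Local Notation C := R[i].

Implicit Types f g h u v : l2.

Definition sqmod (z : C) : R := complex.Re z ^+ 2 + complex.Im z ^+ 2.

Lemma sqmod_ge0 z : 0 <= sqmod z.
Proof. by rewrite addr_ge0 ?sqr_ge0. Qed.

Lemma normc_sqmod z : normc z ^+ 2 = sqmod z.
Proof. by case: z => a b /=; rewrite sqr_sqrtr// addr_ge0 ?sqr_ge0. Qed.

Lemma l2_sqnormE (f : l2) : l2_sqnorm f = (nsq f)%:E.
Proof.
have /asboolP fS := valP f.
by rewrite nsq.unlock fineK// ge0_fin_numE// l2_sqnorm_ge0.
Qed.

Lemma nsq_ge0 f : 0 <= nsq f.
Proof. by rewrite -lee_fin -l2_sqnormE l2_sqnorm_ge0. Qed.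

Lemma l2_sqnorm_esum (f : l2) :
  l2_sqnorm f = (\esum_(x in [set: G]) (sqmod (f x))%:E)%E.
Proof. by apply: eq_esum => x _; rewrite normc_sqmod. Qed.

Lemma nsq_sum (s : seq l2) :
  (\sum_(f <- s) nsq f)%:E =
  (\esum_(x in [set: G]) (\sum_(f <- s) sqmod (f x))%:E)%E.
Proof.
elim: s => [|f s IH].
  by rewrite big_nil esum1// => x _; rewrite big_nil.
rewrite big_cons EFinD IH -l2_sqnormE l2_sqnorm_esum -esumD; last 2 first.
- by move=> x _; rewrite lee_fin sqmod_ge0.
- by move=> x _; rewrite lee_fin sumr_ge0// => g _; exact: sqmod_ge0.
by apply: eq_esum => x _; rewrite big_cons EFinD.
Qed.

(** The algebraic properties of the inner product all follow from pointwise
    identities in this way; as the terms are nonnegative, no question of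
    summability arises. *)
Lemma nsq_identity (s t : seq l2) :
  (forall x, \sum_(f <- s) sqmod (f x) = \sum_(f <- t) sqmod (f x)) ->
  \sum_(f <- s) nsq f = \sum_(f <- t) nsq f.
Proof.
by move=> st; apply: EFin_inj; rewrite !nsq_sum; apply: eq_esum => x _; rewrite st.
Qed.

Lemma l2D (f g : l2) x : (f + g) x = (f x : C) + (g x : C). Proof. by []. Qed.
Lemma l2N (f : l2) x : (- f) x = - (f x : C). Proof. by []. Qed.
Lemma l2Z (c : C) (f : l2) x : (c *: f) x = c * (f x : C). Proof. by []. Qed.

Lemma ipC f g : ip f g = ip g f.
Proof.
suff : \sum_(h <- [:: f + g; g - f]) nsq h = \sum_(h <- [:: g + f; f - g]) nsq h.
  by rewrite ip.unlock !big_cons big_nil !addr0 => ?; lra.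
apply: nsq_identity => x; rewrite !big_cons !big_nil !(l2D, l2N) /sqmod.
by case: (f x) (g x) => a b [c d] /=; ring.
Qed.

Lemma ipDl f g h : ip (f + g) h = ip f h + ip g h.
Proof.
suff : \sum_(u <- [:: f + g + h; f - h; g - h]) nsq u =
       \sum_(u <- [:: f + g - h; f + h; g + h]) nsq u.
  by rewrite ip.unlock !big_cons !big_nil !addr0 => ?; lra.
apply: nsq_identity => x; rewrite !big_cons !big_nil !(l2D, l2N) /sqmod.
by case: (f x) (g x) (h x) => a b [c d] [e k] /=; ring.
Qed.

Lemma ipDr f g h : ip f (g + h) = ip f g + ip f h.
Proof. by rewrite ipC ipDl !(ipC f). Qed.

Lemma ipZ (c : C) f g : ip (c *: f) g = ip f (Num.conj c *: g).
Proof.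
suff : \sum_(u <- [:: c *: f + g; f - Num.conj c *: g]) nsq u =
       \sum_(u <- [:: c *: f - g; f + Num.conj c *: g]) nsq u.
  by rewrite ip.unlock !big_cons !big_nil !addr0 => ?; lra.
apply: nsq_identity => x; rewrite !big_cons !big_nil !(l2D, l2N, l2Z) /sqmod.
by case: (f x) (g x) c => a b [c d] [e k] /=; ring.
Qed.

Lemma ipNl f g : ip (- f) g = - ip f g.
Proof.
by have := ipDl f (- f) g; rewrite subrr ip.unlock add0r sub0r => ?;
  have : \sum_(u <- [:: g]) nsq u = \sum_(u <- [:: - g]) nsq u;
  [apply: nsq_identity => x; rewrite !big_cons !big_nil l2N /sqmod;
   case: (g x) => a b /=; ring | rewrite !big_cons !big_nil => ?; lra].
Qed.

Lemma ipNr f g : ip f (- g) = - ip f g.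
Proof. by rewrite ipC ipNl ipC. Qed.

Lemma ipBl f g h : ip (f - g) h = ip f h - ip g h.
Proof. by rewrite ipDl ipNl. Qed.

Lemma ipBr f g h : ip f (g - h) = ip f g - ip f h.
Proof. by rewrite ipDr ipNr. Qed.

Lemma ip0l g : ip 0 g = 0.
Proof. by rewrite -(subrr (0 : l2)) ipBl subrr. Qed.

Lemma ip0r g : ip g 0 = 0.
Proof. by rewrite ipC ip0l. Qed.

Lemma nsqZ_le (c : R) (u : l2) : nsq (c%:C%C *: u) <= c ^+ 2 * nsq u.
Proof.
rewrite -lee_fin EFinM -!l2_sqnormE; apply: le_trans (l2_sqnormZ _ _) _.
by rewrite normc_sqmod /sqmod /= expr0n addr0.
Qed.

Lemma nsqZ (c : R) (u : l2) : nsq (c%:C%C *: u) = c ^+ 2 * nsq u.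
Proof.
have [->|c0] := eqVneq c 0.
  by rewrite scale0r nsq.unlock [X in l2_sqnorm X](_ : _ = 0)// l2_sqnorm0 expr0n mul0r.
apply/eqP; rewrite eq_le nsqZ_le/=.
have := nsqZ_le c^-1 (c%:C%C *: u); rewrite scalerA -rmorphM mulVf// scale1r => h.
rewrite -ler_pdivlMl ?exprn_even_gt0//; apply: le_trans h _.
by rewrite exprVn.
Qed.

(* For nonnegative [a], comparing [|a f + g|^2 + |b f - b g|^2] with
   [|a f - g|^2 + |b f + b g|^2] for [b = sqrt a] keeps all coefficients equal
   to one. *)
Lemma ipZl_ge0 (a : R) f g : 0 <= a -> ip (a%:C%C *: f) g = a * ip f g.
Proof.
move=> a0; pose b := Num.sqrt a; have bb : b * b = a by rewrite -expr2 sqr_sqrtr.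
pose h := b%:C%C *: f; pose k := b%:C%C *: g.
have E1 : \sum_(u <- [:: a%:C%C *: f + g; h - k]) nsq u =
       \sum_(u <- [:: a%:C%C *: f - g; h + k]) nsq u.
  apply: nsq_identity => x; rewrite !big_cons !big_nil !(l2D, l2N, l2Z) /sqmod -bb.
  by case: (f x) (g x) => p q [c d] /=; ring.
have ipbb : ip h k = a * ip f g.
  have S1 (u : l2) : nsq (b%:C%C *: u) = a * nsq u by rewrite nsqZ -bb expr2.
  by rewrite ip.unlock /h /k -scalerDr -scalerBr !S1; lra.
rewrite -ipbb; move: E1; rewrite ip.unlock !big_cons !big_nil !addr0 => ?; lra.
Qed.

Lemma ipZl (a : R) f g : ip (a%:C%C *: f) g = a * ip f g.
Proof.
have [a0|a0] := leP 0 a; first exact: ipZl_ge0.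
have -> : a%:C%C = - ((- a)%:C%C) by rewrite raddfN /= opprK.
by rewrite scaleNr ipNl ipZl_ge0 ?oppr_ge0 1?ltW//; ring.
Qed.

Lemma ipZr (a : R) f g : ip f (a%:C%C *: g) = a * ip f g.
Proof. by rewrite ipC ipZl ipC. Qed.

Lemma nsq0 : nsq (0 : l2) = 0.
Proof. by rewrite nsq.unlock [X in l2_sqnorm X](_ : _ = 0)// l2_sqnorm0. Qed.

Lemma ipff f : ip f f = nsq f.
Proof.
rewrite ip.unlock subrr nsq0 subr0.
suff: \sum_(u <- [:: f + f]) nsq u = \sum_(u <- [:: f; f; f; f]) nsq u.
  by rewrite !big_cons !big_nil => ?; lra.
apply: nsq_identity => x; rewrite !big_cons !big_nil !l2D /sqmod.
by case: (f x) => a b /=; ring.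
Qed.

Lemma sqmod_le_nsq (f : l2) x : sqmod (f x) <= nsq f.
Proof.
rewrite -lee_fin -l2_sqnormE l2_sqnorm_esum; apply: esum_ge.
by exists [set x]; rewrite // fsbig_set1.
Qed.

Lemma nsq_eq0 f : nsq f = 0 -> f = 0.
Proof.
move=> f0; apply/val_inj/funext => x; change ((f x : C) = 0).
have := sqmod_le_nsq f x; rewrite f0 => /(conj (sqmod_ge0 (f x)))/andP.
rewrite -eq_le /sqmod eq_sym paddr_eq0 ?sqr_ge0// !sqrf_eq0.
by case: (f x : C) => a b /= /andP[/eqP -> /eqP ->].
Qed.

Lemma ip_inj f g : (forall h, ip f h = ip g h) -> f = g.
Proof.
move=> fg; apply/eqP; rewrite -subr_eq0; apply/eqP/nsq_eq0.
by rewrite -ipff ipBl fg subrr.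
Qed.

Lemma ip_sum (I : Type) (s : seq I) (P : pred I) (F : I -> l2) g :
  ip (\sum_(i <- s | P i) F i) g = \sum_(i <- s | P i) ip (F i) g.
Proof. by apply: (big_morph (ip^~ g)); [move=> ? ?; exact: ipDl|exact: ip0l]. Qed.

Lemma ip_cauchy_schwarz f g : ip f g ^+ 2 <= nsq f * nsq g.
Proof.
(* The quadratic polynomial [t |-> |f + t g|^2] is nonnegative. *)
have key (t : R) : 0 <= nsq f + 2 * t * ip f g + t ^+ 2 * nsq g.
  have := nsq_ge0 (f + t%:C%C *: g).
  rewrite -ipff !(ipDl, ipDr) !(ipZl, ipZr) !ipff (ipC g f).
  by move=> h; apply: le_trans h _; rewrite le_eqVlt; apply/orP; left; apply/eqP; ring.
have [g0|gN0] := eqVneq (nsq g) 0.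
  by rewrite (nsq_eq0 g0) ip0r nsq0 mulr0 expr0n.
have gpos : 0 < nsq g by rewrite lt_def gN0 nsq_ge0.
have := key (- ip f g / nsq g).
have -> : nsq f + 2 * (- ip f g / nsq g) * ip f g + (- ip f g / nsq g) ^+ 2 * nsq g =
  (nsq f * nsq g - ip f g ^+ 2) / nsq g by field.
by rewrite pmulr_lge0 ?invr_gt0// subr_ge0.
Qed.

End L2Inner.

Section Riesz.
Variables (R : realType) (G : groupType).
Local Notation l2 := (l2 R G).
Local Notation C := R[i].
Local Notation "''d_' x" := (l2_dirac R x) (at level 2).
Implicit Types f g h u v : l2.

Lemma diracE (x y : G) : 'd_x y = if y == x then 1 else 0 :> C.
Proof. by []. Qed.

Lemma nsq_dirac (x : G) : nsq 'd_x = 1.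
Proof.
apply: EFin_inj; rewrite -l2_sqnormE l2_sqnorm_esum.
rewrite (_ : \esum_(x in _) _ = \esum_(y in [set x]) (1%:E : \bar R))%E.
  by rewrite esum_set1// lee_fin.
rewrite [RHS]esum_mkcond; apply: eq_esum => y _.
rewrite classical_sets.in_set1 diracE; case: eqP => _; rewrite /sqmod /=.
  by congr EFin; ring.
by congr EFin; ring.
Qed.

Lemma ip_i_self (u : l2) : ip u ('i%C *: u) = 0.
Proof.
have : ip ('i%C *: u) u = ip u (- ('i%C *: u)).
  rewrite ipZ -scaleNr; congr (ip u (_ *: u)); apply/eqP.
  by rewrite eq_complex /= oppr0 !eqxx.
rewrite ipNr ipC => ?; lra.
Qed.

Lemma scale_reim (c : C) (u : l2) :
  c *: u = (complex.Re c)%:C%C *: u + (complex.Im c)%:C%C *: ('i%C *: u).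
Proof.
rewrite scalerA -scalerDl; congr (_ *: _); case: c => a b /=; apply/eqP.
by rewrite eq_complex /=; apply/andP; split; apply/eqP; ring.
Qed.

Lemma ip_dirac1 (x : G) (v : l2) : ip 'd_x v = complex.Re (v x : C).
Proof.
pose v' := v - (v x : C) *: 'd_x.
have -> : v = v' + (v x : C) *: 'd_x by rewrite subrK.
rewrite ipDr (_ : ip 'd_x v' = 0); last first.
  suff: \sum_(u <- [:: 'd_x + v']) nsq u = \sum_(u <- [:: 'd_x - v']) nsq u.
    by rewrite ip.unlock !big_cons !big_nil => ?; lra.
  apply: nsq_identity => y; rewrite !big_cons !big_nil !(l2D, l2N) !l2Z diracE /sqmod.
  have [->|] := eqVneq y x; first by case: (v x) => a b /=; ring.
  by move=> _; case: (v x) (v y) => a b [c d] /=; ring.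
rewrite add0r l2D /v' l2D l2N !l2Z diracE eqxx mulr1 subrr add0r.
rewrite {1}scale_reim ipDr !ipZr ip_i_self ipff nsq_dirac.
ring.
Qed.

Lemma ip_dirac (c : C) (x : G) (v : l2) : ip (c *: 'd_x) v =
  complex.Re c * complex.Re (v x : C) + complex.Im c * complex.Im (v x : C).
Proof.
rewrite ipZ ip_dirac1 l2Z; case: c (v x) => a b [c d] /=; ring.
Qed.

Definition truncate (s : seq G) (v : G -> C) : l2 :=
  \sum_(x <- s) (v x) *: 'd_x.

Lemma ip_truncate s (v : G -> C) u : ip (truncate s v) u = \sum_(x <- s)
  (complex.Re (v x) * complex.Re (u x : C) + complex.Im (v x) * complex.Im (u x : C)).
Proof. by rewrite ip_sum; apply: eq_bigr => x _; rewrite ip_dirac. Qed.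

Lemma l2_sumE (I : Type) (s : seq I) (F : I -> l2) y :
  (\sum_(i <- s) F i) y = \sum_(i <- s) (F i y : C).
Proof.
by elim: s => [|i s IH]; rewrite ?big_nil// !big_cons l2D IH.
Qed.

Lemma truncateE s (v : G -> C) y : uniq s -> y \in s -> truncate s v y = v y.
Proof.
move=> us ys; rewrite l2_sumE (bigD1_seq y ys us) l2Z diracE eqxx mulr1.
rewrite big1; first exact: addr0.
move=> x xy.
by rewrite l2Z diracE eq_sym (negbTE xy) mulr0.
Qed.

Lemma nsq_truncate s (v : G -> C) : uniq s ->
  nsq (truncate s v) = \sum_(x <- s) sqmod (v x).
Proof.
move=> us; rewrite -ipff ip_truncate big_seq [RHS]big_seq.
by apply: eq_bigr => x xs; rewrite truncateE// /sqmod !expr2.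
Qed.

(** Finitely supported vectors are dense. *)
Lemma truncate_approx (v : l2) (e : R) : 0 < e ->
  exists2 s, uniq s & nsq (v - truncate s v) <= e.
Proof.
move=> e0.
have : ((nsq v - e)%:E < l2_sqnorm v)%E by rewrite l2_sqnormE lte_fin ltrBlDr ltrDl.
rewrite l2_sqnorm_esum => /ereal_sup_gt[_ [X [finX _] <-]] ltX.
exists (fset_set X); first exact: fset_uniq.
have -> : nsq (v - truncate (fset_set X) v) =
    nsq v - \sum_(x <- fset_set X) sqmod (v x : C).
  rewrite -ipff !(ipBl, ipBr) !ipff nsq_truncate ?fset_uniq// (ipC v) ip_truncate.
  rewrite -[X in _ - X - _](_ : \sum_(x <- fset_set X) sqmod (v x : C) = _); last first.
    by apply: eq_bigr => x _; rewrite /sqmod !expr2.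
  ring.
move: ltX; rewrite fsbig_finite//= sumEFin lte_fin => ?; lra.
Qed.

Section Functional.
Variables (phi : l2 -> R) (K : R).
Hypothesis phiD : forall u v, phi (u + v) = phi u + phi v.
Hypothesis phiZ : forall (a : R) u, phi (a%:C%C *: u) = a * phi u.
Hypothesis phi_bounded : forall v, phi v ^+ 2 <= K * nsq v.

Let w0 (x : G) : C := Complex (phi 'd_x) (phi ('i%C *: 'd_x)).

Let phi_sum (s : seq G) (F : G -> l2) : phi (\sum_(x <- s) F x) = \sum_(x <- s) phi (F x).
Proof.
apply: (big_morph phi phiD).
by have := phiZ 0 0; rewrite mul0r scaler0.
Qed.

Let phi_dirac (c : C) x :
  phi (c *: 'd_x) = complex.Re c * phi 'd_x + complex.Im c * phi ('i%C *: 'd_x).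
Proof. by rewrite scale_reim phiD !phiZ. Qed.

Let phi_truncate s (v : G -> C) : phi (truncate s v) =
  \sum_(x <- s) (complex.Re (w0 x) * complex.Re (v x) + complex.Im (w0 x) * complex.Im (v x)).
Proof.
by rewrite phi_sum; apply: eq_bigr => x _; rewrite phi_dirac; congr (_ + _); exact: mulrC.
Qed.

Let w0_bound s : uniq s -> \sum_(x <- s) sqmod (w0 x) <= K.
Proof.
move=> us; have := phi_bounded (truncate s w0).
rewrite nsq_truncate// phi_truncate.
rewrite (eq_bigr (fun x => sqmod (w0 x))); last by move=> x _; rewrite /sqmod !expr2.
set S := \sum_(x <- s) _.
have S0 : 0 <= S by apply: sumr_ge0 => x _; exact: sqmod_ge0.
have [S1|S1] := eqVneq S 0; last first.
  have Sp : 0 < S by rewrite lt_def S1.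
  by rewrite expr2 ler_pM2r.
rewrite S1 => _.
have := phi_bounded 'd_1%g; rewrite nsq_dirac mulr1; apply: le_trans; exact: sqr_ge0.
Qed.

Let w0_esum : (l2_sqnorm (w0 : G -> C^o) <= K%:E)%E.
Proof.
apply: ge_ereal_sup => _ [X [finX _] <-].
rewrite fsbig_finite// sumEFin lee_fin.
rewrite (eq_bigr (fun x => sqmod (w0 x))); last by move=> x _; rewrite normc_sqmod.
by apply: w0_bound; exact: fset_uniq.
Qed.

(** The candidate [w0] has the values of [phi] at the Dirac functions as
    coordinates. Testing [phi] on its own finite truncations bounds its norm,
    and both sides agree on finitely supported vectors, which are dense. *)
Lemma riesz : exists w, nsq w <= K /\ forall v, phi v = ip w v.
Proof.
have wS : square_summable (w0 : G -> C^o).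
  by apply/asboolP; apply: le_lt_trans w0_esum _; rewrite ltry.
exists (L2 wS); split; first by rewrite -lee_fin -l2_sqnormE.
have nw : nsq (L2 wS) <= K by rewrite -lee_fin -l2_sqnormE.
have K0 : 0 <= K by apply: le_trans nw; exact: nsq_ge0.
move=> v; apply/eqP; rewrite -subr_eq0 -[_ == 0]sqrf_eq0.
rewrite eq_le sqr_ge0 andbT.
apply/ler_addgt0Pl => e e0; rewrite addr0.
have e'0 : 0 < e / (4 * (K + 1)) by rewrite divr_gt0// mulr_gt0// ltr_wpDl.
have [s us apx] := truncate_approx v e'0.
set u := v - truncate s v in apx.
have -> : phi v - ip (L2 wS) v = phi u - ip (L2 wS) u.
  have {1 2}-> : v = u + truncate s v by rewrite subrK.
  rewrite phiD ipDr (ipC _ (truncate s v)) ip_truncate phi_truncate opprD addrACA.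
  rewrite -[RHS]addr0; congr (_ + _); rewrite -sumrB big1// => x _ /=.
  rewrite !(mulrC (complex.Re (v x : C))) !(mulrC (complex.Im (v x : C))).
  exact: subrr.
have h1 := phi_bounded u; have h2 := ip_cauchy_schwarz (L2 wS) u.
have h3 : nsq (L2 wS) * nsq u <= K * nsq u by rewrite ler_wpM2r ?nsq_ge0.
have h4 : K * nsq u <= e / 4.
  apply: (@le_trans _ _ ((K + 1) * (e / (4 * (K + 1))))); last first.
    by rewrite le_eqVlt; apply/orP; left; apply/eqP; field; rewrite lt0r_neq0// ltr_wpDl.
  apply: ler_pM => //; first exact: nsq_ge0.
  by rewrite lerDl.
move: h1 (le_trans h2 h3) h4; move: (phi u) (ip _ u) (K * nsq u) => a b c h1 h2' h4.
have := sqr_ge0 (a + b); move: h1 h2' h4; rewrite !expr2 => *; nra.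
Qed.

End Functional.
End Riesz.

(** * The group von Neumann algebra *)

Section VN.
Variables (R : realType) (G : groupType).
Local Notation l2 := (l2 R G).
Local Notation N := (vN R G).
Local Notation C := R[i].
Local Notation "''d_' x" := (l2_dirac R x) (at level 2).
Implicit Types (f g h u v : l2) (S T : N) (x : G).

Lemma nsq_ltrans x f : nsq (ltrans x f) = nsq f.
Proof.
apply: EFin_inj; rewrite -!l2_sqnormE.
exact: (l2_sqnorm_reindex f (bijective_mulgl x)).
Qed.

Lemma ip_ltrans x f g : ip (ltrans x f) (ltrans x g) = ip f g.
Proof.
have D : ltrans x (f + g) = ltrans x f + ltrans x g by exact/val_inj.
by rewrite ip.unlock -ltransB -D !nsq_ltrans.
Qed.

Lemma ltransK x f : ltrans x (ltrans x^-1%g f) = f.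
Proof. by apply/val_inj/funext => y /=; rewrite invgK mulVKg. Qed.

Lemma ltrans_dirac x : ltrans x 'd_1%g = 'd_x.
Proof.
apply/val_inj/funext => y /=; congr (if _ then _ else _).
by apply/eqP/eqP => [e|->]; [rewrite -(mulVKg x y) e mulg1|rewrite mulVg].
Qed.

Lemma nsq_rtrans x f : nsq (rtrans x f) = nsq f.
Proof.
apply: EFin_inj; rewrite -!l2_sqnormE.
exact: (l2_sqnorm_reindex f (bijective_mulgr x)).
Qed.

Lemma ip_rtrans x f g : ip (rtrans x f) g = ip f (rtrans x^-1%g g).
Proof.
have E : ip (rtrans x f) (rtrans x (rtrans x^-1%g g)) = ip f (rtrans x^-1%g g).
  set g' := rtrans _ g.
  have D : rtrans x (f + g') = rtrans x f + rtrans x g' by exact/val_inj.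
  have B : rtrans x (f - g') = rtrans x f - rtrans x g' by exact/val_inj.
  by rewrite ip.unlock -D -B !nsq_rtrans.
rewrite -E; congr (ip _ _).
by apply/val_inj/funext => y /=; rewrite mulgK.
Qed.

Lemma vNP T : [/\ linear T, bounded_op T & forall x f, T (ltrans x f) = ltrans x (T f)].
Proof. by have /asboolP := valP T. Qed.

Lemma vND T f g : T (f + g) = T f + T g.
Proof. by have [+ _ _] := vNP T => /(_ 1 f g); rewrite !scale1r. Qed.

Lemma vN0 T : T (0 : l2) = 0.
Proof. by apply: (addrI (T 0)); rewrite -vND !addr0. Qed.

Lemma vNZ T (c : C) f : T (c *: f) = c *: T f.
Proof. by have [+ _ _] := vNP T => /(_ c f 0); rewrite !addr0 vN0 addr0. Qed.

Lemma vN_ltrans T x f : T (ltrans x f) = ltrans x (T f).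
Proof. by have [_ _ +] := vNP T; apply. Qed.

Lemma vN_bounded T : exists2 M : R, 0 <= M & forall f, nsq (T f) <= M * nsq f.
Proof.
have [_ /bounded_op_ge0[M M0 TM] _] := vNP T; exists M => // f.
by rewrite -lee_fin EFinM -!l2_sqnormE.
Qed.

Lemma vN_ext S T : (forall f g, ip (S f) g = ip (T f) g) -> S = T.
Proof. by move=> ST; apply/val_inj/funext => f; apply: ip_inj => g; exact: ST. Qed.

(** Operators of the group von Neumann algebra are the bounded sesquilinear
    forms invariant under left translation; only the real part of such a form
    has to be given. *)
Lemma vN_of_form (b : l2 -> l2 -> R) (K : R) :
  (forall f f' g, b (f + f') g = b f g + b f' g) ->
  (forall f g g', b f (g + g') = b f g + b f g') ->
  (forall (c : C) f g, b (c *: f) g = b f (Num.conj c *: g)) ->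
  (forall (a : R) f g, b f (a%:C%C *: g) = a * b f g) ->
  (forall f g, b f g ^+ 2 <= K * nsq f * nsq g) ->
  (forall x f g, b (ltrans x f) (ltrans x g) = b f g) ->
  exists T : N, forall f g, ip (T f) g = b f g.
Proof.
move=> bDl bDr bZ bZr bK bL.
have /choice[T0 T0P] f : exists w, nsq w <= K * nsq f /\ forall g, b f g = ip w g.
  exact: (riesz (bDr f) (fun a => bZr a f) (bK f)).
have T0b f g : ip (T0 f) g = b f g by rewrite (T0P f).2.
have TS : is_equivariant_op T0.
  apply/asboolP; split.
  - move=> c f g; apply: ip_inj => h.
    by rewrite ipDl ipZ !T0b bDl bZ.
  - by exists K => f; rewrite !l2_sqnormE -EFinM lee_fin (T0P f).1.
  - move=> x f; apply: ip_inj => h.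
    by rewrite -{1 2}(ltransK x h) T0b bL ip_ltrans T0b.
by exists (VN TS).
Qed.

Lemma adj_subproof T : exists S : N, forall f g, ip (S f) g = ip f (T g).
Proof.
have [M M0 TM] := vN_bounded T.
apply: (@vN_of_form _ M).
- by move=> *; rewrite ipDl.
- by move=> *; rewrite vND ipDr.
- by move=> c f g; rewrite ipZ vNZ.
- by move=> *; rewrite vNZ ipZr.
- move=> f g; apply: le_trans (ip_cauchy_schwarz _ _) _.
  by rewrite -mulrA mulrCA ler_wpM2l ?nsq_ge0.
- by move=> x f g; rewrite vN_ltrans ip_ltrans.
Qed.

Definition adj T : N := projT1 (cid (adj_subproof T)).

Lemma adjP T f g : ip (adj T f) g = ip f (T g).
Proof. exact: (projT2 (cid (adj_subproof T))). Qed.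

Lemma adjP' T f g : ip f (adj T g) = ip (T f) g.
Proof. by rewrite ipC adjP ipC. Qed.

Lemma vN_add S T f : (S + T) f = S f + T f. Proof. by []. Qed.
Lemma vN_mulE S T f : (S * T) f = S (T f). Proof. by []. Qed.
Lemma vN_opp S f : (- S) f = - S f. Proof. by []. Qed.
Lemma vN_zero f : (0 : N) f = 0. Proof. by []. Qed.

Lemma vN_sum (I : Type) (s : seq I) (F : I -> N) f :
  (\sum_(i <- s) F i) f = \sum_(i <- s) F i f.
Proof. by elim: s => [|i s IH]; rewrite ?big_nil// !big_cons vN_add IH. Qed.

Lemma vN_map_sum T (I : Type) (s : seq I) (F : I -> l2) :
  T (\sum_(i <- s) F i) = \sum_(i <- s) T (F i).
Proof. by elim: s => [|i s IH]; rewrite ?big_nil ?vN0// !big_cons vND IH. Qed.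

Lemma adjK : involutive adj.
Proof. by move=> T; apply: vN_ext => f g; rewrite adjP adjP'. Qed.

Lemma adjD S T : adj (S + T) = adj S + adj T.
Proof. by apply: vN_ext => f g; rewrite !(adjP, vN_add, ipDl, ipDr). Qed.

Lemma adjN T : adj (- T) = - adj T.
Proof. by apply: vN_ext => f g; rewrite !(adjP, vN_opp, ipNl, ipNr). Qed.

Lemma adj0 : adj 0 = 0.
Proof. by apply: vN_ext => f g; rewrite adjP !vN_zero ip0l ip0r. Qed.

Lemma adj1 : adj 1 = 1.
Proof. by apply: vN_ext => f g; rewrite adjP. Qed.

Lemma adjM S T : adj (S * T) = adj T * adj S.
Proof. by apply: vN_ext => f g; rewrite !(adjP, vN_mulE). Qed.

Lemma adj_sum (I : Type) (s : seq I) (F : I -> N) :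
  adj (\sum_(i <- s) F i) = \sum_(i <- s) adj (F i).
Proof. exact: (big_morph adj adjD adj0). Qed.

Lemma adj_nat k : adj k%:R = k%:R.
Proof. by elim: k => [|k IH]; rewrite ?adj0// mulrS adjD adj1 IH. Qed.

Lemma adj_of_group x : adj (vN_of_group R x) = vN_of_group R x^-1%g.
Proof.
apply: vN_ext => f g; rewrite adjP; apply: esym.
by have := ip_rtrans x^-1%g f g; rewrite invgK.
Qed.

(** Von Neumann dimensions are real, so that only real parts of traces occur. *)
Definition rtr T : R := complex.Re (vN_trace T).

Lemma rtrE T : rtr T = ip (T 'd_1%g) 'd_1%g.
Proof. by rewrite ipC ip_dirac1. Qed.

Lemma rtrD S T : rtr (S + T) = rtr S + rtr T.
Proof. by rewrite !rtrE vN_add ipDl. Qed.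

Lemma rtrN T : rtr (- T) = - rtr T.
Proof. by rewrite !rtrE vN_opp ipNl. Qed.

Lemma rtr0 : rtr 0 = 0.
Proof. by rewrite rtrE vN_zero ip0l. Qed.

Lemma rtr1 : rtr 1 = 1.
Proof. by rewrite rtrE ipff nsq_dirac. Qed.

Lemma rtr_sum (I : Type) (s : seq I) (F : I -> N) :
  rtr (\sum_(i <- s) F i) = \sum_(i <- s) rtr (F i).
Proof. exact: (big_morph rtr rtrD rtr0). Qed.

(** The conjugation [J f x = (f x^-1)^*] of Tomita-Takesaki theory. It maps
    [T e] to [T^* e] for the Dirac function [e] at [1], whence the trace
    property. *)
Lemma modular_conj_subproof f : square_summable (fun x => Num.conj (f x^-1%g : C) : C^o).
Proof.
apply/asboolP; have /asboolP := valP f.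
rewrite -[l2_sqnorm (\val f)](@l2_sqnorm_reindex _ _ (fun x : G => x^-1%g)); last first.
  by exists (fun x => x^-1%g) => x; rewrite invgK.
congr (_ < _)%E; apply: eq_esum => x _; congr EFin.
by rewrite !normc_sqmod /sqmod /=; case: (f _) => a b /=; ring.
Qed.

Definition modular_conj f : l2 := L2 (modular_conj_subproof f).

Lemma nsq_modular_conj f : nsq (modular_conj f) = nsq f.
Proof.
apply: EFin_inj; rewrite -!l2_sqnormE.
rewrite -[l2_sqnorm (\val f)](@l2_sqnorm_reindex _ _ (fun x : G => x^-1%g)); last first.
  by exists (fun x => x^-1%g) => x; rewrite invgK.
apply: eq_esum => x _; congr EFin.
by rewrite !normc_sqmod /sqmod /=; case: (f _) => a b /=; ring.
Qed.

Lemma ip_modular_conj f g : ip (modular_conj f) (modular_conj g) = ip f g.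
Proof.
have D : modular_conj (f + g) = modular_conj f + modular_conj g.
  by apply/val_inj/funext => x; exact: (rmorphD Num.conj).
have B : modular_conj (f - g) = modular_conj f - modular_conj g.
  by apply/val_inj/funext => x; exact: (rmorphB Num.conj).
by rewrite ip.unlock -D -B !nsq_modular_conj.
Qed.

Lemma modular_conjK f : modular_conj (modular_conj f) = f.
Proof.
by apply/val_inj/funext => x; rewrite /= invgK; exact: conjCK.
Qed.

Lemma adj_dirac T : adj T 'd_1%g = modular_conj (T 'd_1%g).
Proof.
apply/val_inj/funext => x; change ((adj T 'd_1%g x : C) = Num.conj (T 'd_1%g x^-1%g : C)).
have Td : T 'd_x = ltrans x (T 'd_1%g) by rewrite -vN_ltrans ltrans_dirac.
have re : complex.Re (adj T 'd_1%g x : C) = complex.Re (T 'd_1%g x^-1%g : C).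
  by rewrite -ip_dirac1 adjP' Td ipC ip_dirac1 /= mulg1.
have im : complex.Im (adj T 'd_1%g x : C) = - complex.Im (T 'd_1%g x^-1%g : C).
  have := ip_dirac 'i%C x (adj T 'd_1%g).
  rewrite /= mul0r mul1r add0r => <-.
  rewrite adjP' vNZ Td ipC ip_dirac1 l2Z /= mulg1.
  by case: (T _ _) => a b /=; ring.
move: re im; case: (adj T _ _) (T _ _) => a b [c d] /= -> -> //.
Qed.

Lemma rtrC S T : rtr (S * T) = rtr (T * S).
Proof.
have E S' T' : rtr (S' * T') = ip (T' 'd_1%g) (modular_conj (S' 'd_1%g)).
  by rewrite rtrE vN_mulE -adjP' adj_dirac.
by rewrite !E -[RHS]ip_modular_conj modular_conjK ipC.
Qed.

End VN.

(** * Matrices over the group von Neumann algebra *)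

Section VNMatrix.
Variables (R : realType) (G : groupType).
Local Notation l2 := (l2 R G).
Local Notation N := (vN R G).
Local Notation C := R[i].
Local Notation e1 := (l2_dirac R (1%g : G)).

(** Matrices over the group von Neumann algebra as operators on column vectors
    with entries in [l2]. *)
Definition opm m n (A : 'M[N]_(m, n)) (v : 'I_n -> l2) : 'I_m -> l2 :=
  fun i => \sum_j A i j (v j).

Definition ipn n (u v : 'I_n -> l2) : R := \sum_i ip (u i) (v i).

Definition madj m n (A : 'M[N]_(m, n)) : 'M[N]_(n, m) := \matrix_(i, j) adj (A j i).

Lemma opm_mul m n p (A : 'M[N]_(m, n)) (B : 'M[N]_(n, p)) v :
  opm (A *m B) v = opm A (opm B v).
Proof.
apply/funext => i; rewrite /opm.
under [RHS]eq_bigr do rewrite vN_map_sum.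
rewrite exchange_big /=; apply: eq_bigr => k _.
by rewrite mxE vN_sum; apply: eq_bigr => j _; rewrite vN_mulE.
Qed.

Lemma opm_add m n (A B : 'M[N]_(m, n)) v :
  opm (A + B) v = opm A v + opm B v.
Proof.
apply/funext => i; rewrite /opm -[RHS]/(_ + _) -big_split /=.
by apply: eq_bigr => j _; rewrite mxE vN_add.
Qed.

Lemma opm_opp m n (A : 'M[N]_(m, n)) v : opm (- A) v = - opm A v.
Proof.
apply/funext => i; rewrite /opm -[RHS]/(- _) -sumrN /=.
by apply: eq_bigr => j _; rewrite mxE vN_opp.
Qed.

Lemma opm0 m n v : opm (0 : 'M[N]_(m, n)) v = 0.
Proof. by apply/funext => i; rewrite /opm big1// => j _; rewrite mxE vN_zero. Qed.

Lemma opm_map0 m n (A : 'M[N]_(m, n)) : opm A 0 = 0.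
Proof. by apply/funext => i; rewrite /opm big1// => j _; rewrite vN0. Qed.

Lemma opm1 n v : opm (1%:M : 'M[N]_n) v = v.
Proof.
apply/funext => i; rewrite /opm (bigD1 i)//= mxE eqxx big1 ?addr0// => j ji.
by rewrite mxE eq_sym (negbTE ji) vN_zero.
Qed.

Lemma opm_scalar n (k : nat) v : opm (k%:R%:M : 'M[N]_n) v = (k%:R : C) *: v.
Proof.
elim: k => [|k IH]; first by rewrite raddf0 opm0 scale0r.
by rewrite !mulrSr raddfD opm_add IH opm1 scalerDl scale1r.
Qed.

Lemma ipnC n (u v : 'I_n -> l2) : ipn u v = ipn v u.
Proof. by apply: eq_bigr => i _; rewrite ipC. Qed.

Lemma ipnDl n (u v w : 'I_n -> l2) : ipn (u + v) w = ipn u w + ipn v w.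
Proof. by rewrite -big_split; apply: eq_bigr => i _; exact: ipDl. Qed.

Lemma ipnNl n (u v : 'I_n -> l2) : ipn (- u) v = - ipn u v.
Proof. by rewrite -sumrN; apply: eq_bigr => i _; exact: ipNl. Qed.

Lemma ipnDr n (u v w : 'I_n -> l2) : ipn u (v + w) = ipn u v + ipn u w.
Proof. by rewrite ipnC ipnDl !(ipnC u). Qed.

Lemma ipnNr n (u v : 'I_n -> l2) : ipn u (- v) = - ipn u v.
Proof. by rewrite ipnC ipnNl ipnC. Qed.

Lemma ipnZl n (k : nat) (u v : 'I_n -> l2) : ipn ((k%:R : C) *: u) v = k%:R * ipn u v.
Proof.
rewrite /ipn mulr_sumr; apply: eq_bigr => i _.
by rewrite -ipZl; congr (ip (_ *: _) _); rewrite rmorph_nat.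
Qed.

Lemma ipnZr n (k : nat) (u v : 'I_n -> l2) : ipn u ((k%:R : C) *: v) = k%:R * ipn u v.
Proof. by rewrite ipnC ipnZl ipnC. Qed.

Lemma ipnn_ge0 n (u : 'I_n -> l2) : 0 <= ipn u u.
Proof. by apply: sumr_ge0 => i _; rewrite ipff nsq_ge0. Qed.

Lemma ipnn_eq0 n (u : 'I_n -> l2) : ipn u u <= 0 -> u = 0.
Proof.
move=> u0; apply/funext => i; apply/nsq_eq0/eqP.
rewrite eq_le nsq_ge0 andbT -ipff; apply: le_trans u0.
rewrite /ipn (bigD1 i)//= lerDl; apply: sumr_ge0 => j _.
by rewrite ipff nsq_ge0.
Qed.

Lemma ipn_inj n (u v : 'I_n -> l2) : (forall w, ipn u w = ipn v w) -> u = v.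
Proof.
move=> uv; apply/eqP; rewrite -subr_eq0; apply/eqP/ipnn_eq0.
by rewrite ipnDl ipnNl uv subrr.
Qed.

Lemma ipn_madj m n (A : 'M[N]_(m, n)) u v : ipn (opm A u) v = ipn u (opm (madj A) v).
Proof.
rewrite /ipn; under eq_bigr do rewrite ip_sum.
rewrite exchange_big; apply: eq_bigr => j _ /=.
rewrite [RHS]ipC ip_sum; apply: eq_bigr => i _.
by rewrite mxE adjP ipC.
Qed.

Definition single n (j : 'I_n) (f : l2) : 'I_n -> l2 :=
  fun i => if i == j then f else 0.

Lemma opm_single m n (A : 'M[N]_(m, n)) j f i : opm A (single j f) i = A i j f.
Proof.
rewrite /opm (bigD1 j)//= /single eqxx big1 ?addr0// => k kj.
by rewrite (negbTE kj) vN0.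
Qed.

Lemma ipn_single n (u : 'I_n -> l2) j f : ipn u (single j f) = ip (u j) f.
Proof.
rewrite /ipn (bigD1 j)//= /single eqxx big1 ?addr0// => k kj.
by rewrite (negbTE kj) ip0r.
Qed.

Lemma ipn_opm m n (A : 'M[N]_(m, n)) u v :
  ipn (opm A u) v = \sum_i \sum_j ip (A i j (u j)) (v i).
Proof. by apply: eq_bigr => i _; rewrite ip_sum. Qed.

Lemma opm_ext m n (A B : 'M[N]_(m, n)) :
  (forall u v, ipn (opm A u) v = ipn (opm B u) v) -> A = B.
Proof.
move=> AB; apply/matrixP => i j; apply: vN_ext => f g.
by have := AB (single j f) (single i g); rewrite !ipn_single !opm_single.
Qed.

Lemma madjK m n (A : 'M[N]_(m, n)) : madj (madj A) = A.
Proof. by apply/matrixP => i j; rewrite !mxE adjK. Qed.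

Lemma madjM m n p (A : 'M[N]_(m, n)) (B : 'M[N]_(n, p)) :
  madj (A *m B) = madj B *m madj A.
Proof.
apply/matrixP => i j; rewrite !mxE adj_sum; apply: eq_bigr => k _.
by rewrite !mxE adjM.
Qed.

Lemma madjD m n (A B : 'M[N]_(m, n)) : madj (A + B) = madj A + madj B.
Proof. by apply/matrixP => i j; rewrite !mxE adjD. Qed.

Lemma madjN m n (A : 'M[N]_(m, n)) : madj (- A) = - madj A.
Proof. by apply/matrixP => i j; rewrite !mxE adjN. Qed.

Lemma madj0 m n : madj (0 : 'M[N]_(m, n)) = 0.
Proof. by apply/matrixP => i j; rewrite !mxE adj0. Qed.

Lemma madj_scalar n k : madj (k%:R%:M : 'M[N]_n) = k%:R%:M.
Proof.
apply/matrixP => i j; rewrite !mxE eq_sym.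
by case: eqP => _; rewrite ?mulr1n ?mulr0n ?adj0 ?adj_nat.
Qed.

Lemma madjX n (A : 'M[N]_n) k : madj A = A -> madj (A ^+ k) = A ^+ k.
Proof.
move=> AA; elim: k => [|k IH]; first by have := madj_scalar n 1.
by rewrite exprS [LHS]madjM IH AA -[RHS]exprS exprSr.
Qed.

Definition mtr n (A : 'M[N]_n) : R := \sum_i rtr (A i i).

Lemma mtrD n (A B : 'M[N]_n) : mtr (A + B) = mtr A + mtr B.
Proof. by rewrite -big_split; apply: eq_bigr => i _; rewrite mxE rtrD. Qed.

Lemma mtrN n (A : 'M[N]_n) : mtr (- A) = - mtr A.
Proof. by rewrite -sumrN; apply: eq_bigr => i _; rewrite mxE rtrN. Qed.

Lemma mtrB n (A B : 'M[N]_n) : mtr (A - B) = mtr A - mtr B.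
Proof. by rewrite mtrD mtrN. Qed.

Lemma mtr1 n : mtr (1%:M : 'M[N]_n) = n%:R.
Proof.
rewrite /mtr (eq_bigr (fun=> 1)); first by rewrite sumr_const card_ord.
by move=> i _; rewrite mxE eqxx rtr1.
Qed.

Lemma mtrC m n (A : 'M[N]_(m, n)) (B : 'M[N]_(n, m)) : mtr (A *m B) = mtr (B *m A).
Proof.
rewrite /mtr; under eq_bigr do rewrite mxE rtr_sum.
rewrite exchange_big; apply: eq_bigr => j _ /=.
by rewrite mxE rtr_sum; apply: eq_bigr => i _; rewrite rtrC.
Qed.

Lemma mtr_block m n (A : 'M[N]_m) B D (E : 'M[N]_n) :
  mtr (block_mx A B D E) = mtr A + mtr E.
Proof.
by rewrite /mtr big_split_ord; congr (_ + _); apply: eq_bigr => i _;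
  rewrite (block_mxEul, block_mxEdr).
Qed.

Lemma mtr_ipn n (A : 'M[N]_n) :
  mtr A = \sum_i ipn (opm A (single i e1)) (single i e1).
Proof. by apply: eq_bigr => i _; rewrite ipn_single opm_single rtrE. Qed.

Lemma mtr_self_ge0 m n (A : 'M[N]_(m, n)) : 0 <= mtr (madj A *m A).
Proof.
by rewrite mtr_ipn; apply: sumr_ge0 => i _; rewrite opm_mul ipn_madj madjK ipnn_ge0.
Qed.

Lemma mul_madj_eq0 m n (A : 'M[N]_(m, n)) : A *m madj A = 0 -> A = 0.
Proof.
move=> AA; rewrite -[A]madjK (_ : madj A = 0) ?madj0//; apply: opm_ext => u v.
rewrite [X in ipn X _](_ : _ = 0) ?opm0//; apply: ipnn_eq0.
by rewrite ipn_madj madjK -opm_mul AA opm0 ipnC -[0]addr0 ipnDl -{2}oppr0 ipnNl subrr.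
Qed.

Lemma nsq_sum_le n (F : 'I_n -> l2) :
  nsq (\sum_i F i) <= n%:R * \sum_i nsq (F i).
Proof.
rewrite -ipff ip_sum.
apply: (@le_trans _ _ (\sum_i \sum_j (nsq (F i) + nsq (F j)) / 2)).
  apply: ler_sum => i _; rewrite ipC ip_sum; apply: ler_sum => j _.
  have := nsq_ge0 (F i - F j).
  by rewrite -!ipff !(ipBl, ipBr) (ipC (F i) (F j)) => ?; lra.
under eq_bigr => i _ do rewrite -mulr_suml big_split /= sumr_const card_ord.
rewrite -mulr_suml big_split /= sumr_const card_ord sumrMnl mulr_natl.
by rewrite -mulr2n -[X in X / 2]mulr_natr mulfK// pnatr_eq0.
Qed.

Lemma opm_bounded m n (A : 'M[N]_(m, n)) : exists K : nat,
  forall u, ipn (opm A u) (opm A u) <= K%:R * ipn u u.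
Proof.
pose M i j := s2val (cid2 (vN_bounded (A i j))).
have M0 i j : 0 <= M i j by rewrite /M; case: cid2.
have MP i j f : nsq (A i j f) <= M i j * nsq f by rewrite /M; case: cid2.
pose S := \sum_i \sum_j n%:R * M i j.
exists (Num.bound S) => u.
apply: (@le_trans _ _ (S * ipn u u)); last first.
  rewrite ler_wpM2r ?ipnn_ge0//; apply/ltW/archi_boundP.
  by apply: sumr_ge0 => i _; apply: sumr_ge0 => j _; rewrite mulr_ge0 ?ler0n.
rewrite /S mulr_suml; apply: ler_sum => i _; rewrite ipff.
apply: le_trans (nsq_sum_le _) _.
rewrite mulr_sumr mulr_suml; apply: ler_sum => j _.
rewrite -mulrA ler_wpM2l ?ler0n//; apply: le_trans (MP _ _ _) _.
rewrite ler_wpM2l// /ipn (bigD1 j)//= ipff lerDl.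
by apply: sumr_ge0 => k _; rewrite ipff nsq_ge0.
Qed.

Lemma ipn_cauchy_schwarz n (u v : 'I_n -> l2) : ipn u v ^+ 2 <= ipn u u * ipn v v.
Proof.
have key (t : R) : 0 <= ipn u u + 2 * t * ipn u v + t ^+ 2 * ipn v v.
  have := ipnn_ge0 (u + t%:C%C *: v).
  have Z w w' : ipn (t%:C%C *: w : 'I_n -> l2) w' = t * ipn w w'.
    by rewrite /ipn mulr_sumr; apply: eq_bigr => i _; rewrite ipZl.
  have Z' w w' : ipn w' (t%:C%C *: w : 'I_n -> l2) = t * ipn w' w by rewrite ipnC Z ipnC.
  rewrite !(ipnDl, ipnDr) !(Z, Z') (ipnC v u).
  by move=> h; apply: le_trans h _; rewrite le_eqVlt; apply/orP; left; apply/eqP; ring.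
have [g0|gN0] := eqVneq (ipn v v) 0.
  rewrite (@ipnn_eq0 _ v) ?g0// [X in X ^+ 2](_ : _ = 0) ?expr0n ?mulr_ge0 ?ipnn_ge0//.
  by rewrite /ipn big1// => i _; rewrite ip0r.
have gpos : 0 < ipn v v by rewrite lt_def gN0 ipnn_ge0.
have := key (- ipn u v / ipn v v).
have -> : ipn u u + 2 * (- ipn u v / ipn v v) * ipn u v +
    (- ipn u v / ipn v v) ^+ 2 * ipn v v =
  (ipn u u * ipn v v - ipn u v ^+ 2) / ipn v v by field.
by rewrite pmulr_lge0 ?invr_gt0// subr_ge0.
Qed.

End VNMatrix.

(** * Kernel projections and the trace inequality *)

Section KernelProjection.
Variables (R : realType) (G : groupType).
Local Notation l2 := (l2 R G).
Local Notation N := (vN R G).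
Local Notation C := R[i].
Local Notation e1 := (l2_dirac R (1%g : G)).
Variables (n d K : nat) (A : 'M[N]_(n, d)).
Hypothesis K_gt0 : (0 < K)%N.
Hypothesis A_bound : forall u, ipn (opm A u) (opm A u) <= K%:R * ipn u u.

Let D : 'M[N]_n := K%:R%:M - A *m madj A.
Let Kp k : 0 < (K%:R : R) ^+ k. Proof. by rewrite exprn_gt0// ltr0n. Qed.

Let DD : madj D = D.
Proof. by rewrite /D madjD madjN madjM madjK madj_scalar. Qed.

(* As [|A|^2 <= K], the operator [D / K = 1 - A A^* / K] is a contraction, and it
   preserves the norm of [u] only if [A^* u = 0]. *)
Let D_contract u : ipn (opm D u) (opm D u) <=
  K%:R ^+ 2 * ipn u u - K%:R * ipn (opm (madj A) u) (opm (madj A) u).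
Proof.
set v := opm (madj A) u.
have -> : opm D u = (K%:R : C) *: u - opm A v.
  by rewrite /D opm_add opm_opp opm_scalar opm_mul.
have uv : ipn (opm A v) u = ipn v v by rewrite ipn_madj.
rewrite !(ipnDl, ipnDr, ipnNl, ipnNr) !(ipnZl, ipnZr) (ipnC u (opm A v)) uv.
have := A_bound v; rewrite expr2 => ?; lra.
Qed.

(* The form [<D^2k u, v> / K^2k]. On the diagonal it decreases with [k], hence it
   converges everywhere by polarisation. *)
Let s k (u v : 'I_n -> l2) : R := ipn (opm (D ^+ k) u) (opm (D ^+ k) v) / K%:R ^+ (2 * k).

Let opDS k u : opm (D ^+ k.+1) u = opm D (opm (D ^+ k) u).
Proof. by rewrite exprS [D * _]/(D *m _) opm_mul. Qed.

Let s_decr u : nonincreasing_seq (fun k => s k u u).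
Proof.
apply/nonincreasing_seqP => k; rewrite /s !opDS.
rewrite ler_pdivrMr ?Kp//; apply: le_trans (D_contract _) _.
apply: (@le_trans _ _ (K%:R ^+ 2 * ipn (opm (D ^+ k) u) (opm (D ^+ k) u))).
  by rewrite gerBl mulr_ge0 ?ler0n// ipnn_ge0.
have -> : (2 * k.+1 = 2 + 2 * k)%N by rewrite mulnS.
rewrite exprD le_eqVlt; apply/orP; left; apply/eqP; field.
exact/lt0r_neq0/Kp.
Qed.

Let s_ge0 k u : 0 <= s k u u.
Proof. by rewrite divr_ge0 ?ipnn_ge0// ltW// Kp. Qed.

Let s_le k u : s k u u <= ipn u u.
Proof.
have := s_decr u (leq0n k); rewrite {2}/s expr0 muln0 expr0 divr1.
by rewrite -[1]/(1%:M) opm1.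
Qed.

Let opm_vecD m p (B : 'M[N]_(m, p)) u v : opm B (u + v) = opm B u + opm B v.
Proof.
apply/funext => i; rewrite /opm -[RHS]/(_ + _) -big_split /=.
by apply: eq_bigr => j _; rewrite vND.
Qed.

Let opm_vecN m p (B : 'M[N]_(m, p)) u : opm B (- u) = - opm B u.
Proof.
by apply: (addrI (opm B u)); rewrite -opm_vecD !subrr opm_map0.
Qed.

Let opm_vecZ m p (B : 'M[N]_(m, p)) (c : C) u : opm B (c *: u) = c *: opm B u.
Proof.
apply/funext => i; rewrite /opm -[RHS]/(_ *: _) scaler_sumr.
by apply: eq_bigr => j _; rewrite vNZ.
Qed.

Let opm_ltrans m p (B : 'M[N]_(m, p)) x u :
  opm B (fun i => ltrans x (u i)) = fun i => ltrans x (opm B u i).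
Proof.
apply/funext => i; rewrite /opm.
rewrite (big_morph (ltrans x) (id1 := 0) (op1 := +%R)).
- by apply: eq_bigr => j _; rewrite vN_ltrans.
- by move=> ? ?; exact/val_inj.
- exact/val_inj.
Qed.

Let sDl k u u' v : s k (u + u') v = s k u v + s k u' v.
Proof. by rewrite /s opm_vecD ipnDl mulrDl. Qed.

Let sC k u v : s k u v = s k v u.
Proof. by rewrite /s ipnC. Qed.

Let sDr k u v v' : s k u (v + v') = s k u v + s k u v'.
Proof. by rewrite sC sDl !(sC _ u). Qed.

Let sNl k u v : s k (- u) v = - s k u v.
Proof. by rewrite /s opm_vecN ipnNl mulNr. Qed.

Let sNr k u v : s k u (- v) = - s k u v.
Proof. by rewrite sC sNl sC. Qed.

Let s_cvg u v : cvgn (fun k => s k u v).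
Proof.
have -> : (fun k => s k u v) = (fun k => 4^-1 * (s k (u + v) (u + v) - s k (u - v) (u - v))).
  apply/funext => k; rewrite !(sDl, sDr, sNl, sNr) (sC k v u); by field.
apply: is_cvgMr; apply: is_cvgB; apply: nonincreasing_is_cvgn; try exact: s_decr;
  by exists 0 => _ [k _ <-]; exact: s_ge0.
Qed.

Let S u v : R := limn (fun k => s k u v).

Let S_cvg u v : (fun k => s k u v) @ \oo --> S u v.
Proof. exact: s_cvg. Qed.

Let S_eq u v (a : nat -> R) l : a @ \oo --> l -> (forall k, s k u v = a k) -> S u v = l.
Proof.
move=> al e; have ea : (fun k => s k u v) = a by exact/funext.
by rewrite /S ea; exact/cvg_lim.
Qed.

Let S_bound u v : S u v ^+ 2 <= ipn u u * ipn v v.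
Proof.
have h : (fun k => s k u v ^+ 2) @ \oo --> S u v ^+ 2.
  by rewrite expr2; under eq_fun do rewrite expr2; apply: cvgM; exact: S_cvg.
apply: (cvgr_to_le h); apply: nearW => k.
apply: (@le_trans _ _ (s k u u * s k v v)); last first.
  by apply: ler_pM; rewrite ?s_ge0 ?s_le.
rewrite /s expr_div_n mulrACA -invfM -expr2 ler_wpM2r ?ipn_cauchy_schwarz//.
Qed.

Let SDl u u' v : S (u + u') v = S u v + S u' v.
Proof.
apply: (@S_eq _ _ (fun k => s k u v + s k u' v)) => [|k]; last exact: sDl.
apply: cvgD; exact: S_cvg.
Qed.

Let SC u v : S u v = S v u.
Proof. by apply: (S_eq (@S_cvg v u)) => k; exact: sC. Qed.

Let SDr u v v' : S u (v + v') = S u v + S u v'.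
Proof. by rewrite SC SDl !(SC _ u). Qed.

Let ipnZ (c : C) (u v : 'I_n -> l2) : ipn (c *: u) v = ipn u (Num.conj c *: v).
Proof. by apply: eq_bigr => i _; exact: ipZ. Qed.

Let SZ (c : C) u v : S (c *: u) v = S u (Num.conj c *: v).
Proof.
apply: (S_eq (@S_cvg u (Num.conj c *: v))) => k.
by rewrite /s !opm_vecZ ipnZ.
Qed.

Let SZr (a : R) u v : S u (a%:C%C *: v) = a * S u v.
Proof.
apply: (S_eq (a := fun k => a * s k u v)); first by apply: cvgMr; exact: S_cvg.
move=> k; rewrite /s opm_vecZ ipnC mulrA; congr (_ / _).
by rewrite ipnC /ipn mulr_sumr; apply: eq_bigr => i _; rewrite ipZr.
Qed.

Let S_ltrans x u v : S (fun i => ltrans x (u i)) (fun i => ltrans x (v i)) = S u v.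
Proof.
apply: (S_eq (@S_cvg u v)) => k; rewrite /s !opm_ltrans; congr (_ / _).
by apply: eq_bigr => i _; rewrite ip_ltrans.
Qed.

Let singleD j f g : single j (f + g) = single j f + single j g :> ('I_n -> l2).
Proof.
apply/funext => i; rewrite -[RHS]/(single j f i + single j g i) /single.
by case: eqP; rewrite ?addr0.
Qed.

Let singleZ j (c : C) f : single j (c *: f) = c *: single j f :> ('I_n -> l2).
Proof.
apply/funext => i; rewrite -[RHS]/(c *: single j f i) /single.
by case: eqP; rewrite ?scaler0.
Qed.

Let single_ltrans j x f :
  single j (ltrans x f) = (fun i => ltrans x (single j f i)) :> ('I_n -> l2).
Proof.
apply/funext => i; rewrite /single; case: eqP => // _.
exact/val_inj.
Qed.

Let ipn_single2 j f : ipn (single j f : 'I_n -> l2) (single j f) = nsq f.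
Proof. by rewrite ipn_single /single eqxx ipff. Qed.

Let E_exists i j : exists T : N, forall f g, ip (T f) g = S (single j f) (single i g).
Proof.
apply: (@vN_of_form _ _ _ 1) => [f f' g|f g g'|c f g|a f g|f g|x f g].
- by rewrite singleD SDl.
- by rewrite singleD SDr.
- by rewrite !singleZ SZ.
- by rewrite singleZ SZr.
- by apply: le_trans (S_bound _ _) _; rewrite !ipn_single2 mul1r.
- by rewrite !single_ltrans S_ltrans.
Qed.

(* The weak limit of [(D / K)^2k]. *)
Let E : 'M[N]_n := \matrix_(i, j) projT1 (cid (E_exists i j)).

Let S_sum u (F : 'I_n -> 'I_n -> l2) : S u (\sum_i F i) = \sum_i S u (F i).
Proof.
apply: (big_morph (S u)); first by move=> *; exact: SDr.
by apply: (addrI (S u 0)); rewrite -SDr !addr0.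
Qed.

Let sum_single (u : 'I_n -> l2) : \sum_i single i (u i) = u.
Proof.
apply/funext => i; rewrite (big_morph (fun w : 'I_n -> l2 => w i) (id1 := 0) (op1 := +%R))//.
rewrite (bigD1 i)//= /single eqxx big1 ?addr0// => j ji.
by rewrite eq_sym (negbTE ji).
Qed.

Let E_ip u v : ipn (opm E u) v = S u v.
Proof.
rewrite ipn_opm -{2}[v]sum_single S_sum; apply: eq_bigr => i _.
rewrite -{2}[u]sum_single SC S_sum; apply: eq_bigr => j _.
by rewrite mxE SC; case: cid.
Qed.

Let E_self : madj E = E.
Proof. by apply: opm_ext => u v; rewrite ipn_madj madjK ipnC !E_ip SC. Qed.

Let Dk_self k u v : ipn (opm (D ^+ k) u) v = ipn u (opm (D ^+ k) v).
Proof. by rewrite ipn_madj madjX. Qed.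

Let opDSr k u : opm (D ^+ k.+1) u = opm (D ^+ k) (opm D u).
Proof. by rewrite exprSr [_ * D]/(_ *m D) opm_mul. Qed.

Let S_shift u v : S u (opm D (opm D v)) = K%:R ^+ 2 * S u v.
Proof.
apply: (S_eq (a := fun k => K%:R ^+ 2 * s k.+1 u v)).
  by apply: cvgMr; rewrite (cvg_shiftS (fun k => s k u v)); exact: S_cvg.
move=> k; rewrite /s -!opDSr [opm (D ^+ k.+2) v]opDS.
have Dself w w' : ipn w (opm D w') = ipn (opm D w) w' by rewrite [RHS]ipn_madj DD.
rewrite Dself -opDS (_ : 2 * k.+1 = 2 + 2 * k)%N ?mulnS// exprD.
have := Kp (2 * k); move: (_ ^+ (2 * k)) => t t0.
by field; rewrite !lt0r_neq0 ?ltr0n.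
Qed.

(* On the range of [E], the operator [(D / K)^2] is the identity, so that [D / K]
   preserves norms there. *)
Let E_fixed u : opm (madj A) (opm E u) = 0.
Proof.
set w := opm E u.
have DDw : opm D (opm D w) = ((K ^ 2)%N%:R : C) *: w.
  apply: ipn_inj => v; rewrite ipnZl natrX.
  have Dself w' : ipn (opm D w') v = ipn w' (opm D v) by rewrite [LHS]ipn_madj DD.
  rewrite ipn_madj DD ipn_madj DD !E_ip S_shift //.
have h1 := D_contract (opm D w); rewrite DDw ipnZl ipnZr natrX in h1.
have h2 := D_contract w.
have h3 := ipnn_ge0 (opm (madj A) (opm D w)).
apply: ipnn_eq0; set x := ipn (opm (madj A) w) _ in h2 *.
move: h1 h2 h3.
move: (ipn (opm (madj A) (opm D w)) _) (ipn (opm D w) _) (ipn w w) => b c a h1 h2 h3.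
have K0 : 0 < (K%:R : R) by rewrite ltr0n.
have h4 : K%:R ^+ 2 * (K%:R ^+ 2 * a) <= K%:R ^+ 2 * (K%:R ^+ 2 * a - K%:R * x).
  apply: (le_trans h1); apply: (@le_trans _ _ (K%:R ^+ 2 * c)).
    by rewrite gerBl mulr_ge0// ltW.
  by rewrite ler_pM2l ?exprn_gt0.
rewrite ler_pM2l ?exprn_gt0// in h4.
rewrite -(pmulr_rle0 _ K0); lra.
Qed.

Let E_ann : E *m A = 0.
Proof.
rewrite -[LHS]madjK madjM E_self -[RHS]madj0; congr madj.
by apply: opm_ext => u v; rewrite opm_mul E_fixed opm0.
Qed.

(* [Z A = 0] implies [Z (D / K)^2k = Z], which passes to the limit. *)
Let E_max q (Z : 'M[N]_(q, n)) : Z *m A = 0 -> Z *m E = Z.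
Proof.
move=> ZA; apply: opm_ext => u v.
rewrite opm_mul ipn_madj E_ip [RHS]ipn_madj.
set w := opm (madj Z) v.
have Dw k : opm (D ^+ k) w = ((K ^ k)%N%:R : C) *: w.
  elim: k => [|k IH]; first by rewrite -[D ^+ 0]/(1%:M) opm1 scale1r.
  rewrite opDS IH opm_vecZ {1}/D opm_add opm_opp opm_scalar -opm_mul.
  rewrite -mulmxA -madjM ZA madj0 mulmx0 opm0 subr0 scalerA expnSr natrM //.
apply: (S_eq (a := fun=> ipn u w)); first exact: cvg_cst.
move=> k; rewrite /s Dw ipnZr Dk_self Dw ipnZr natrX.
rewrite mulnC exprM expr2; have := Kp k; move: (_ ^+ k) => t t0.
by field; rewrite lt0r_neq0.
Qed.

Let mtr_s k : mtr (D ^+ (2 * k)) / K%:R ^+ (2 * k) =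
  \sum_i s k (single i e1) (single i e1).
Proof.
rewrite mtr_ipn mulr_suml; apply: eq_bigr => i _; congr (_ / _).
by rewrite mulnC muln2 -addnn exprD [D ^+ k * _]/(_ *m _) opm_mul Dk_self.
Qed.

Let mtr_E : mtr E = \sum_i S (single i e1) (single i e1).
Proof. by rewrite mtr_ipn; apply: eq_bigr => i _; rewrite E_ip. Qed.

(** The orthogonal projection [F] onto the kernel of [A^*], as a matrix over the
    group von Neumann algebra: [F A = 0], and [F] absorbs every [Z] that
    annihilates [A]. It is the limit of the decreasing sequence
    [(1 - A A^* / K)^2k], which makes its trace computable. Taking [Z = F] shows
    that [F] is idempotent. *)
Lemma kernel_projection : exists F : 'M[N]_n,
  [/\ madj F = F, F *m A = 0,
      forall q (Z : 'M[N]_(q, n)), Z *m A = 0 -> Z *m F = Z,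
      forall k, K%:R ^+ (2 * k) * mtr F <= mtr ((K%:R%:M - A *m madj A) ^+ (2 * k)) &
      (fun k => mtr ((K%:R%:M - A *m madj A) ^+ (2 * k)) / K%:R ^+ (2 * k)) @ \oo
        --> mtr F].
Proof.
exists E; split; [exact: E_self|exact: E_ann|exact: E_max| |].
- move=> k; rewrite -ler_pdivlMl ?Kp// mulrC mtr_s mtr_E.
  apply: ler_sum => i _; apply: nonincreasing_cvgn_ge; first exact: s_decr.
  exact: s_cvg.
- under eq_fun do rewrite mtr_s.
  by rewrite mtr_E; apply: (@cvg_big _ _ +%R) => [|i _]; [exact: add_continuous|exact: S_cvg].
Qed.

End KernelProjection.

Section TraceBound.
Variables (R : realType) (G : groupType).
Local Notation l2 := (l2 R G).
Local Notation N := (vN R G).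

Lemma kernel_projection_exists n d (A : 'M[N]_(n, d)) : exists K : nat, exists F : 'M[N]_n,
  [/\ (0 < K)%N, madj F = F, F *m A = 0,
      forall q (Z : 'M[N]_(q, n)), Z *m A = 0 -> Z *m F = Z &
      (fun k => mtr ((K%:R%:M - A *m madj A) ^+ (2 * k)) / K%:R ^+ (2 * k)) @ \oo
        --> mtr F].
Proof.
have [K AK] := opm_bounded A.
have AK' u : ipn (opm A u) (opm A u) <= K.+1%:R * ipn u u.
  by apply: le_trans (AK u) _; rewrite ler_wpM2r ?ipnn_ge0// ler_nat.
have [F [F1 F2 F3 _ F4]] := kernel_projection (ltn0Sn K) AK'.
by exists K.+1, F; split.
Qed.

(** The range projection [f] of [e] satisfies [f e = e] and [e f = f], so that
    [tr e = tr f], and [tr f >= 0] because [f = f^* f]. *)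
Lemma idempotent_trace_ge0 n (e : 'M[N]_n) : e *m e = e -> 0 <= mtr e.
Proof.
move=> ee; have [K [F [_ FF Fe Fmax _]]] := kernel_projection_exists e.
pose f := 1%:M - F.
have fe : f *m e = e by rewrite mulmxBl Fe mul1mx subr0.
have ef : e *m f = f.
  have : (1%:M - e) *m F = 1%:M - e.
    by apply: Fmax; rewrite mulmxBl ee mul1mx subrr.
  rewrite mulmxBl mul1mx => h.
  have -> : e *m f = e - e *m F by rewrite mulmxBr mulmx1.
  have -> : e *m F = F - (1%:M - e) by rewrite -h opprB addrC subrK.
  by rewrite opprB addrA (addrC e) subrK.
have ff : madj f *m f = f.
  have -> : madj f = f by rewrite /f madjD madjN FF (madj_scalar _ _ n 1).
  by rewrite {2}/f mulmxBr mulmx1 {2}/f mulmxBl mul1mx (Fmax _ F)// ?subrr ?subr0.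
by rewrite -fe mtrC ef -ff mtr_self_ge0.
Qed.

(** If [E D = E], then [D (1 - E)] is an idempotent of trace [tr D - tr E]. *)
Lemma subprojection_trace_le n (E D : 'M[N]_n) :
  E *m E = E -> D *m D = D -> E *m D = E -> mtr E <= mtr D.
Proof.
move=> EE DD ED; rewrite -subr_ge0.
have -> : mtr D - mtr E = mtr (D *m (1%:M - E)).
  by rewrite mulmxBr mulmx1 mtrB mtrC ED.
apply: idempotent_trace_ge0.
have h1 : D *m (D *m E) = D *m E by rewrite mulmxA DD.
have h2 : D *m E *m D = D *m E by rewrite -mulmxA ED.
have h3 : D *m E *m (D *m E) = D *m E by rewrite mulmxA h2 -mulmxA EE.
by rewrite mulmxBr mulmx1 mulmxBl !mulmxBr DD h1 h2 h3 subrr subr0.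
Qed.

Lemma scalar_nat0 n : (0%:R%:M : 'M[N]_n) = 0.
Proof. exact: raddf0. Qed.

Lemma scalar_natS n k : (k.+1%:R%:M : 'M[N]_n) = k%:R%:M + 1%:M.
Proof. by rewrite mulrSr raddfD. Qed.

(** As [tr (M M^* )^i = tr (M^* M)^i] for [i >= 1], the two powers have equal traces
    up to their constant terms. Divided by [K^j], for [j -> oo], this says that
    the closures of the images of [M] and [M^*] have equal dimensions, without
    polar decomposition. *)
Lemma trace_power_swap n d (M : 'M[N]_(n, d)) (K j : nat) :
  mtr ((K%:R%:M - M *m madj M) ^+ j) - n%:R * K%:R ^+ j =
  mtr ((K%:R%:M - madj M *m M) ^+ j) - d%:R * K%:R ^+ j.
Proof.
set U := _ - M *m madj M; set V := _ - madj M *m M.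
have scal p q (k : nat) (A : 'M[N]_(p, q)) : k%:R%:M *m A = A *m k%:R%:M.
  elim: k => [|k IH]; first by rewrite !scalar_nat0 mul0mx mulmx0.
  by rewrite !scalar_natS mulmxDl mulmxDr IH mul1mx mulmx1.
have mtrZ q (k : nat) (A : 'M[N]_q) : mtr (A *m k%:R%:M) = k%:R * mtr A.
  elim: k => [|k IH].
    by rewrite scalar_nat0 mulmx0 mul0r -(subrr (1%:M : 'M[N]_q)) mtrB subrr.
  by rewrite scalar_natS mulmxDr mulmx1 mtrD IH mulrSr mulrDl mul1r.
have UM : U *m M = M *m V.
  by rewrite /U /V mulmxBl mulmxBr scal mulmxA.
have UkM k : U ^+ k *m M = M *m V ^+ k.
  elim: k => [|k IH]; first by rewrite !expr0 mul1mx mulmx1.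
  by rewrite exprS -[U * _]/(U *m _) -mulmxA IH mulmxA UM exprS -mulmxA.
elim: j => [|j IH].
  by rewrite !expr0 !mulr1 !mtr1 !subrr.
have -> : mtr (U ^+ j.+1) = K%:R * mtr (U ^+ j) - mtr (V ^+ j *m (madj M *m M)).
  rewrite exprSr -[_ * U]/(_ *m U) {2}/U mulmxBr mtrB mtrZ mulmxA UkM.
  by rewrite mtrC mulmxA [in RHS]mtrC.
have -> : mtr (V ^+ j.+1) = K%:R * mtr (V ^+ j) - mtr (V ^+ j *m (madj M *m M)).
  by rewrite exprSr -[_ * V]/(_ *m V) {2}/V mulmxBr mtrB mtrZ.
rewrite !exprS; move: IH; move: (mtr (U ^+ j)) (mtr (V ^+ j)) => a b IH.
have -> : a = b - d%:R * K%:R ^+ j + n%:R * K%:R ^+ j by rewrite -IH subrK.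
ring.
Qed.

(** The rows of [X] span a projective module of dimension [tr P] in the kernel of
    the differential [c] that meets the row space of [B] trivially. The matrix
    [M] with the blocks [X], [B] and [c^*] has [n + m + 1] rows and [d]
    columns, so that its left kernel has dimension at least [n + m + 1 - d]. A
    row [(y, z, w)] of the kernel projection [E] has [y P = 0] and [(z, w)] in the
    left kernel of [B] over [c^*], so that
    [tr E <= n - tr P + tr EA] for the kernel projection [EA] of the latter.
    Finally [tr EA] is bounded by [tr (1 - A A^* / K)^2k], which is [m + 1 - d]
    plus the trace of the corresponding power of [1 - A^* A / K]. *)
Theorem trace_bound n m d (P : 'M[N]_n) (X : 'M[N]_(n, d)) (B : 'M[N]_(m, d))
    (c : 'M[N]_(d, 1)) (K : nat) :
  P *m P = P -> P *m X = X -> X *m c = 0 -> B *m c = 0 ->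
  (forall y z, (y : 'rV_n) *m X = (z : 'rV_m) *m B -> y *m P = 0) ->
  (0 < K)%N ->
  (forall u, ipn (opm (madj B *m B + c *m madj c) u) u <= K%:R * ipn u u) ->
  forall k, K%:R ^+ (2 * k) * mtr P <=
    mtr ((K%:R%:M - (madj B *m B + c *m madj c)) ^+ (2 * k)).
Proof.
move=> PP PX Xc Bc inj K0 DK k.
pose A : 'M[N]_(m + 1, d) := col_mx B (madj c).
have AA : madj A *m A = madj B *m B + c *m madj c.
  have -> : madj A = row_mx (madj B) c.
    apply/matrixP => i j; rewrite mxE; case: (split_ordP j) => j' ->.
      by rewrite col_mxEu row_mxEl mxE.
    by rewrite col_mxEd row_mxEr mxE adjK.
  by rewrite mul_row_col.
have A_bound u : ipn (opm A u) (opm A u) <= K%:R * ipn u u.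
  by rewrite ipn_madj -opm_mul ipnC AA.
have [EA [EA1 EA2 EA3 EA4 _]] := kernel_projection K0 A_bound.
have EAk := EA4 k.
have swapA := trace_power_swap A K (2 * k).
pose M : 'M[N]_(n + (m + 1), d) := col_mx X A.
have [L [E [L0 E1 E2 E3 E4]]] := kernel_projection_exists M.
have E_ge : (n + (m + 1))%:R - d%:R <= mtr E.
  apply: (cvgr_to_ge E4); apply: nearW => j.
  rewrite ler_pdivlMr ?exprn_gt0 ?ltr0n//.
  have := trace_power_swap M L (2 * j).
  have : 0 <= mtr ((L%:R%:M - madj M *m M) ^+ (2 * j)).
    have sa : madj (L%:R%:M - madj M *m M) = L%:R%:M - madj M *m M.
      by rewrite madjD madjN madjM madjK madj_scalar.
    rewrite mulnC muln2 -addnn exprD -{1}(madjX j sa); exact: mtr_self_ge0.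
  by rewrite mulrBl => ? ?; lra.
pose Y := lsubmx E; pose Z := rsubmx E.
have YZ : Y *m X + Z *m A = 0 by rewrite -mul_row_col hsubmxK.
(* Multiplying the relation [Y X + Z A = 0] by [c] kills [X c] and [B c]. *)
have Zc : Z *m col_mx 0 (madj c) *m c = 0.
  have : (Y *m X + Z *m A) *m c = 0 by rewrite YZ mul0mx.
  rewrite mulmxDl -mulmxA Xc mulmx0 add0r -!mulmxA !mul_col_mx Bc mul0mx //.
pose z2 := rsubmx Z; pose z1 := lsubmx Z.
have z2c : z2 *m madj c = 0.
  apply: mul_madj_eq0; rewrite madjM madjK mulmxA.
  move: Zc; rewrite -[Z]hsubmxK mul_row_col mulmx0 add0r -/z2 => ->.
  by rewrite mul0mx.
have ZA : Z *m A = z1 *m B.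
  by rewrite -[Z]hsubmxK mul_row_col -/z1 -/z2 z2c addr0.
have YP : Y *m P = 0.
  apply/row_matrixP => i; rewrite row_mul row0; apply: (inj _ (- row i z1)).
  rewrite mulNmx -!row_mul -ZA; move: YZ => /(congr1 (row i)).
  rewrite raddfD /= row0 => /eqP; rewrite addr_eq0 => /eqP //.
have ZA0 : Z *m A = 0.
  by move: YZ; rewrite -PX mulmxA YP mul0mx add0r.
pose D := block_mx (1%:M - P) 0 0 EA.
have ED : E *m D = E.
  rewrite -[E]hsubmxK -/Y -/Z mul_row_block !mulmx0 addr0 add0r.
  by rewrite mulmxBr mulmx1 YP subr0 EA3.
have DD : D *m D = D.
  rewrite mulmx_block !mulmx0 !mul0mx !addr0 !add0r EA3//.
  by rewrite mulmxBl mul1mx mulmxBr mulmx1 PP subrr subr0.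
have EE : E *m E = E by exact: E3.
have := subprojection_trace_le EE DD ED.
rewrite mtr_block mtrB mtr1 => h.
rewrite AA in swapA.
have h2 : mtr P <= mtr EA + d%:R - (m + 1)%:R.
  by move: E_ge h; rewrite natrD => ? ?; lra.
have Kp : 0 < (K%:R : R) ^+ (2 * k) by rewrite exprn_gt0// ltr0n.
have h3 : K%:R ^+ (2 * k) * mtr P <= K%:R ^+ (2 * k) * (mtr EA + d%:R - (m + 1)%:R).
  by rewrite ler_pM2l.
apply: (le_trans h3); rewrite mulrBr mulrDr.
move: swapA EAk; move: (mtr (_ ^+ _)) (mtr (_ ^+ _)) => a b; set t := _ ^+ (2 * k).
move: (t * mtr EA) => q ? ?; rewrite (mulrC t) (mulrC t); lra.
Qed.

End TraceBound.

(** * Matrices over the integral group ring and Fox calculus *)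

Section Words.
Variables (G : groupType) (d : nat) (s : 'I_d -> G).

Fixpoint wprod (w : seq 'I_d) : G := if w is t :: w' then (s t * wprod w')%g else 1%g.

Lemma wprod_cat w w' : wprod (w ++ w') = (wprod w * wprod w')%g.
Proof. by elim: w => [|t w IH] /=; rewrite ?mul1g// IH mulgA. Qed.

End Words.

(** Inverses are adjoined to the generators, so that words without inverse
    letters represent all elements. *)
Lemma word_generators (G : groupType) : finitely_generated G ->
  exists d (s : 'I_d -> G), forall x, exists w, wprod s w = x.
Proof.
move=> [l lG]; pose L := l ++ [seq (x^-1)%g | x <- l].
exists (size L), (fun i => nth 1%g L i).
set s := (fun i => _).
have LV x : x \in L -> (x^-1)%g \in L.
  rewrite !mem_cat => /orP[xl|/mapP[y yl ->]].
    by apply/orP; right; apply/mapP; exists x.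
  by rewrite invgK yl.
have sL x : x \in L -> exists t : 'I_(size L), s t = x.
  move=> xL; have xs : (index x L < size L)%N by rewrite index_mem.
  by exists (Ordinal xs); rewrite /s /= nth_index.
pose P : {pred G} := fun x => `[< exists w, wprod s w = x >].
have PV w : exists w', wprod s w' = ((wprod s w)^-1)%g.
  elim: w => [|t w [w' IH]]; first by exists [::]; rewrite /= invg1.
  have [t' st'] := sL _ (LV _ (mem_nth 1%g (ltn_ord t))).
  by exists (w' ++ [:: t']); rewrite wprod_cat IH /= mulg1 invgM st'.
have Pclosed : group_closed P.
  split; first by apply/asboolP; exists [::].
  move=> x y /asboolP[w wx] /asboolP[w2 w2y]; apply/asboolP.
  have [w' w'y] := PV w2.
  by exists (w ++ w'); rewrite wprod_cat wx w'y w2y.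
pose H : groupClosed G := HB.pack P (isInvClosed.Build G P (group_closedV Pclosed))
  (isMul1Closed.Build G P Pclosed.1) (isMulClosed.Build G P (group_closedM Pclosed)).
have Hl : {subset l <= H}.
  move=> x xl; have [|t st] := sL x; first by rewrite mem_cat xl.
  by apply/asboolP; exists [:: t]; rewrite /= mulg1.
by move=> x; have /asboolP := lG H Hl x.
Qed.

Section FormalSums.
Variable G : groupType.

(** An element of the integral group ring, presented as a list of terms. A fixed
    presentation is evaluated both in the group von Neumann algebra and in the
    permutation modules of the finite quotients, and the terms of the list tell
    which quotients compute its von Neumann trace. *)
Definition fsum := seq (int * G).

Definition fopp (l : fsum) : fsum := [seq (- a.1, a.2) | a <- l].
Definition fmul (l l' : fsum) : fsum :=
  flatten [seq [seq (a.1 * b.1, (a.2 * b.2)%g) | b <- l'] | a <- l].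
Definition fstar (l : fsum) : fsum := [seq (a.1, (a.2^-1)%g) | a <- l].
Definition fconst (k : int) : fsum := [:: (k, 1%g)].
Definition fnorm (l : fsum) : nat := \sum_(a <- l) `|a.1|%N.

Definition fmatrix m n := 'M[fsum]_(m, n).

(** A bound for the norms of the induced operators in all unitary
    representations at once. *)
Definition mnorm m n (L : fmatrix m n) : nat := (\sum_i \sum_j fnorm (L i j))%N.

Definition madd m n (L L' : fmatrix m n) : fmatrix m n := \matrix_(i, j) (L i j ++ L' i j).
Definition mopp m n (L : fmatrix m n) : fmatrix m n := \matrix_(i, j) fopp (L i j).
Definition mmul m n q (L : fmatrix m n) (L' : fmatrix n q) : fmatrix m q :=
  \matrix_(i, j) flatten [seq fmul (L i k) (L' k j) | k <- enum 'I_n].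
Definition mstar m n (L : fmatrix m n) : fmatrix n m := \matrix_(i, j) fstar (L j i).
Definition mconst n (k : int) : fmatrix n n :=
  \matrix_(i, j) if i == j then fconst k else [::].
Definition mpow n (L : fmatrix n n) k : fmatrix n n := iter k (mmul L) (mconst n 1).

Section Evaluation.
Variables (A : pzRingType) (rho : G -> A).
Hypothesis rho1 : rho 1%g = 1.
Hypothesis rhoM : {morph rho : g h / (g * h)%g >-> g * h}.

Definition ev (l : fsum) : A := \sum_(a <- l) rho a.2 *~ a.1.

Lemma ev_nil : ev [::] = 0. Proof. exact: big_nil. Qed.

Lemma ev_cat l l' : ev (l ++ l') = ev l + ev l'.
Proof. exact: big_cat. Qed.

Lemma ev_opp l : ev (fopp l) = - ev l.
Proof. by rewrite /ev big_map -sumrN; apply: eq_bigr => a _; rewrite mulrNz. Qed.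

Lemma ev_flatten ls : ev (flatten ls) = \sum_(l <- ls) ev l.
Proof. by elim: ls => [|l ls IH]; rewrite ?big_nil ?ev_nil// big_cons /= ev_cat IH. Qed.

Lemma ev_mul l l' : ev (fmul l l') = ev l * ev l'.
Proof.
rewrite /fmul ev_flatten big_map /ev mulr_suml; apply: eq_bigr => a _.
rewrite big_map mulr_sumr; apply: eq_bigr => b _ /=.
by rewrite rhoM mulrzAr mulrzAl -mulrzA mulrC.
Qed.

Lemma ev_const k : ev (fconst k) = k%:~R.
Proof. by rewrite /ev big_seq1 rho1. Qed.

Definition mev m n (L : fmatrix m n) : 'M[A]_(m, n) := map_mx ev L.

Lemma mev_add m n (L L' : fmatrix m n) : mev (madd L L') = mev L + mev L'.
Proof. by apply/matrixP => i j; rewrite !mxE ev_cat. Qed.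

Lemma mev_opp m n (L : fmatrix m n) : mev (mopp L) = - mev L.
Proof. by apply/matrixP => i j; rewrite !mxE ev_opp. Qed.

Lemma mev_mul m n q (L : fmatrix m n) (L' : fmatrix n q) :
  mev (mmul L L') = mev L *m mev L'.
Proof.
apply/matrixP => i j; rewrite !mxE ev_flatten big_map big_enum /=.
by apply: eq_bigr => k _; rewrite ev_mul !mxE.
Qed.

Lemma mev_const n k : mev (mconst n k) = (k%:~R)%:M.
Proof.
by apply/matrixP => i j; rewrite !mxE; case: eqP => _; rewrite ?ev_const ?ev_nil.
Qed.

Lemma mev_pow n (L : fmatrix n n) k : mev (mpow L k) = mev L ^+ k.
Proof.
elim: k => [|k IH]; first by rewrite mev_const.
by rewrite exprS /= mev_mul IH.
Qed.

End Evaluation.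

Variables (d : nat) (s : 'I_d -> G).

(** The Fox derivative of [w] with respect to the generator [i], from the rule
    [D (s w) = D s + s D w]. *)
Fixpoint fox (w : seq 'I_d) (i : 'I_d) : fsum :=
  if w is t :: w' then
    (if t == i then fconst 1 else [::]) ++ fmul [:: (1, s t)] (fox w' i)
  else [::].

Definition relation := (seq 'I_d * seq 'I_d)%type.

Definition fox_matrix (rel : seq relation) : fmatrix (size rel) d :=
  \matrix_(r, i) (fox (tnth (in_tuple rel) r).1 i ++ fopp (fox (tnth (in_tuple rel) r).2 i)).

(** The differential [d [g] = g [] - []] on the generators. *)
Definition generator_column : fmatrix d 1 := \matrix_(i, _) ((1, s i) :: fconst (-1)).

Definition valid (r : relation) : Prop := wprod s r.1 = wprod s r.2.

(** The combinatorial Laplacian in degree one of the [G]-cover of the 2-complex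
    with one vertex, the generators as edges and the relations as faces. *)
Definition laplacian (rel : seq relation) : fmatrix d d :=
  madd (mmul (mstar (fox_matrix rel)) (fox_matrix rel))
       (mmul generator_column (mstar generator_column)).

End FormalSums.

(** * Degree one homology of the bar complex *)

Section QuotientMap.
Variables (A : pzRingType) (V : lmodType A) (S : submodClosed V).

Definition qpi (v : V) : quot_lmod S := \pi_((Quotient.quot (submod_zmod S)))%qT v.

Lemma qpi_eq v w : (qpi v = qpi w) <-> (v - w \in S).
Proof.
have e : (qpi v == qpi w) = (v - w \in S).
  by rewrite -[_ == _]/(_ == _ %[mod (Quotient.quot (submod_zmod S))])%qT -Quotient.idealrBE.
by rewrite -e; split=> /eqP.
Qed.

Lemma qpiD v w : qpi (v + w) = qpi v + qpi w.
Proof. by rewrite /qpi raddfD. Qed.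

Lemma qpi_surj (u : quot_lmod S) : exists v, u = qpi v.
Proof. by exists (repr (u : (Quotient.quot (submod_zmod S)))); rewrite /qpi reprK. Qed.

Lemma qpiZ a v : qpi (a *: v) = a *: qpi v.
Proof.
apply/esym; rewrite -[LHS]/(qpi (a *: repr (qpi v : Quotient.quot (submod_zmod S)))).
apply/qpi_eq; rewrite -scalerBr; apply: rpredZ; apply/qpi_eq.
by rewrite /qpi reprK.
Qed.

Lemma qpi0 : qpi 0 = 0.
Proof. by rewrite -(scale0r (0 : V)) qpiZ scale0r. Qed.

Lemma qpi_eq0 v : (qpi v = 0) <-> (v \in S).
Proof. by rewrite -qpi0 qpi_eq subr0. Qed.

Lemma qpi_sum (I : Type) (r : seq I) (F : I -> V) :
  qpi (\sum_(i <- r) F i) = \sum_(i <- r) qpi (F i).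
Proof. exact: (big_morph qpi qpiD qpi0). Qed.

End QuotientMap.

Section LinearExt.
Variables (A : pzRingType) (X : choiceType).

Lemma linear_ext_basis (V : lmodType A) (e : X -> V) x :
  linear_ext e (basis_vect x) = e x.
Proof.
rewrite (@linear_ext_widen _ _ _ _ _ [set x])//; last first.
  by move=> y /=; have [->|_] := eqVneq y x; rewrite ?eqxx.
by rewrite fsbig_set1 /= eqxx scale1r.
Qed.

Lemma linear_ext_sum (V : lmodType A) (e : X -> V) (c : free_module A X) :
  linear_ext e c = \sum_(x <- fset_set [set x | c x != 0]) (c x : A) *: e x.
Proof.
have finc : finite_set [set x | c x != 0] by apply/asboolP/(valP c).
by rewrite (linear_ext_widen _ finc)// fsbig_finite.
Qed.

Lemma free_module_sumE (I : Type) (r : seq I) (F : I -> free_module A X) x :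
  (\sum_(i <- r) F i : free_module A X) x = \sum_(i <- r) (F i x : A).
Proof.
elim: r => [|i r IH]; first by rewrite !big_nil.
by rewrite !big_cons -IH.
Qed.

Lemma linear_ext_id (c : free_module A X) : linear_ext (fun x => basis_vect x) c = c.
Proof.
apply/val_inj/funext => x; rewrite linear_ext_sum.
set l := fset_set _.
change ((\sum_(i <- l) (c i : A) *: basis_vect i : free_module A X) x = c x).
have E i : ((c i : A) *: basis_vect i : free_module A X) x = (c i : A) * (if x == i then 1 else 0).
  by [].
rewrite free_module_sumE; under eq_bigr do rewrite E.
have finc : finite_set [set x | c x != 0] by apply/asboolP/(valP c).
have [cx|cx] := eqVneq (c x : A) 0.
  rewrite big1 ?cx// => i _; case: eqP => [<-|_]; first by rewrite cx mul0r.
  by rewrite mulr0.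
rewrite (bigD1_seq x)/=; last exact: fset_uniq.
  rewrite eqxx mulr1 big1 ?addr0// => i ix.
  by rewrite eq_sym (negbTE ix) mulr0.
by rewrite /l in_fset_set// mem_set.
Qed.

End LinearExt.

Definition boundaries1 (A : pzRingType) (G : groupType) (rho : G -> A) :
    submodClosed (cycle1 rho) :=
  GRing.SubmodClosed.clone A (cycle1 rho) (@is_boundary1 A G rho) _.

Definition class1 (A : pzRingType) (G : groupType) (rho : G -> A) :
  cycle1 rho -> H1 rho := @qpi A (cycle1 rho) (boundaries1 rho).

Section BarFox.
Variables (A : pzRingType) (G : groupType) (rho : G -> A).
Hypothesis rho1 : rho 1%g = 1.
Hypothesis rhoM : {morph rho : g h / (g * h)%g >-> g * h}.
Variables (d : nat) (s : 'I_d -> G).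

Definition boundary (c : free_module A G) := exists e, bar_d2 rho e = c.

Lemma boundary_basis g h :
  boundary (rho g *: basis_vect h - basis_vect (g * h)%g + basis_vect g).
Proof. by exists (basis_vect (g, h)); rewrite /bar_d2 linear_ext_basis. Qed.

Lemma boundary0 : boundary 0.
Proof. by exists 0; rewrite /bar_d2 linear0. Qed.

Lemma boundaryD c c' : boundary c -> boundary c' -> boundary (c + c').
Proof. by move=> [e <-] [e' <-]; exists (e + e'); rewrite /bar_d2 linearD. Qed.

Lemma boundaryZ a c : boundary c -> boundary (a *: c).
Proof. by move=> [e <-]; exists (a *: e); rewrite /bar_d2 linearZ. Qed.

Lemma boundaryN c : boundary c -> boundary (- c).
Proof. by rewrite -scaleN1r; exact: boundaryZ. Qed.

Lemma boundaryB c c' : boundary c -> boundary c' -> boundary (c - c').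
Proof. by move=> ? /boundaryN; exact: boundaryD. Qed.

Lemma boundary_sum (I : Type) (r : seq I) (F : I -> free_module A G) :
  (forall i, boundary (F i)) -> boundary (\sum_(i <- r) F i).
Proof.
move=> FB; elim: r => [|i r IH]; rewrite ?big_nil ?big_cons; first exact: boundary0.
exact: boundaryD.
Qed.

Lemma boundary_cycle c : boundary c -> bar_d1 rho c = 0.
Proof. by move=> [e <-]; exact: bar_d2K. Qed.

Definition generator_chain (x : 'rV[A]_d) : free_module A G :=
  \sum_i x 0 i *: basis_vect (s i).

Lemma generator_chain_linear : linear generator_chain.
Proof.
move=> a x y; rewrite /generator_chain scaler_sumr -big_split.
by apply: eq_bigr => i _; rewrite !mxE scalerDl scalerA.
Qed.

Lemma generator_chainD x y : generator_chain (x + y) = generator_chain x + generator_chain y.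
Proof. by rewrite -{1}(scale1r x) generator_chain_linear scale1r. Qed.

Lemma generator_chain0 : generator_chain 0 = 0.
Proof. by rewrite /generator_chain big1// => i _; rewrite mxE scale0r. Qed.

Lemma generator_chainZ a x : generator_chain (a *: x) = a *: generator_chain x.
Proof. by rewrite -{1}(addr0 (a *: x)) generator_chain_linear generator_chain0 addr0. Qed.

Lemma generator_chainB x y : generator_chain (x - y) = generator_chain x - generator_chain y.
Proof. by rewrite -(scaleN1r y) generator_chainD generator_chainZ scaleN1r. Qed.

Lemma generator_chain_sum (I : Type) (r : seq I) (F : I -> 'rV[A]_d) :
  generator_chain (\sum_(i <- r) F i) = \sum_(i <- r) generator_chain (F i).
Proof. exact: (big_morph generator_chain generator_chainD generator_chain0). Qed.

Lemma bar_d1_generator_chain x :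
  bar_d1 rho (generator_chain x) = (x *m mev rho (generator_column s)) 0 0.
Proof.
rewrite /bar_d1 /generator_chain linear_sum mxE; apply: eq_bigr => i _.
rewrite linearZ_LR /= linear_ext_basis !mxE.
by rewrite /ev !big_cons big_nil addr0 rho1.
Qed.

Definition fox_row (w : seq 'I_d) : 'rV[A]_d := \row_i ev rho (fox s w i).

(** Modulo boundaries [[g h] = g [h] + [g]]; iterate along the word. *)
Lemma fox_bar w : boundary (basis_vect (wprod s w) - generator_chain (fox_row w)).
Proof.
elim: w => [|t w IH] /=.
  rewrite (_ : fox_row [::] = 0) ?generator_chain0 ?subr0; last first.
    by apply/rowP => i; rewrite !mxE ev_nil.
  by have := boundary_basis 1%g 1%g; rewrite mulg1 rho1 scale1r subrr add0r.
have -> : fox_row (t :: w) = \row_i (i == t)%:R + rho (s t) *: fox_row w.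
  apply/rowP => i; rewrite !mxE /= ev_cat ev_mul// {2}/ev big_seq1/= mulr1z.
  rewrite eq_sym; congr (_ + _).
  by case: eqP => _; rewrite ?ev_nil// /ev big_seq1 rho1.
rewrite generator_chainD generator_chainZ.
have -> : generator_chain (\row_i (i == t)%:R) = basis_vect (s t).
  rewrite /generator_chain (bigD1 t)//= mxE eqxx scale1r big1 ?addr0// => i it.
  by rewrite mxE (negbTE it) scale0r.
have := boundaryB (boundaryZ (rho (s t)) IH) (boundary_basis (s t) (wprod s w)).
rewrite scalerBr.
set a := rho _ *: basis_vect _; set b := rho _ *: generator_chain _.
set c := basis_vect (_ * _)%g; set e := basis_vect _.
rewrite (_ : a - b - (a - c + e) = c - (e + b))//.
by rewrite opprD opprB addrA (addrC (a - b)) addrA subrK addrAC -addrA -opprD.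
Qed.

Hypothesis gens : forall x, exists w, wprod s w = x.

Definition word_of (g : G) := projT1 (cid (gens g)).
Lemma word_ofK g : wprod s (word_of g) = g. Proof. exact: (projT2 (cid (gens g))). Qed.

(** Every chain is homologous to one supported on the generators, with the Fox
    derivatives of chosen words as coefficients. *)
Definition fox_lift (c : free_module A G) : 'rV[A]_d :=
  linear_ext (fun g => fox_row (word_of g)) c.

Lemma fox_liftP c : boundary (c - generator_chain (fox_lift c)).
Proof.
rewrite -{1}(linear_ext_id c) /fox_lift !linear_ext_sum generator_chain_sum -sumrB.
apply: boundary_sum => g; rewrite generator_chainZ -scalerBr.
by apply: boundaryZ; have := fox_bar (word_of g); rewrite word_ofK.
Qed.

Variable rel : seq (relation d).
Hypothesis rel_valid : forall r, r \in rel -> valid s r.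

Lemma row_fox_matrix r : row r (mev rho (fox_matrix s rel)) =
  fox_row (tnth (in_tuple rel) r).1 - fox_row (tnth (in_tuple rel) r).2.
Proof. by apply/rowP => i; rewrite !mxE ev_cat ev_opp. Qed.

(** Both sides of a relation give words for the same element, so the difference
    of their Fox chains is a boundary. *)
Lemma boundary_relation (z : 'rV[A]_(size rel)) :
  boundary (generator_chain (z *m mev rho (fox_matrix s rel))).
Proof.
rewrite mulmx_sum_row generator_chain_sum; apply: boundary_sum => r.
rewrite generator_chainZ row_fox_matrix; apply: boundaryZ.
have := rel_valid (mem_tnth r (in_tuple rel)); rewrite /valid => e.
have := boundaryB (fox_bar (tnth (in_tuple rel) r).2) (fox_bar (tnth (in_tuple rel) r).1).
rewrite e opprB addrC addrA subrK.
by rewrite generator_chainB.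
Qed.

Lemma fox_matrix_cycle :
  mev rho (fox_matrix s rel) *m mev rho (generator_column s) = 0.
Proof.
apply/row_matrixP => r; rewrite row_mul row0.
apply/matrixP => i j; rewrite !ord1 -bar_d1_generator_chain mxE.
apply: boundary_cycle.
have := boundary_relation (delta_mx 0 r); by rewrite -rowE.
Qed.

End BarFox.

(** * The von Neumann dimension of the homology *)

Section L2Bound.
Variables (R : realType) (G : groupType).
Local Notation l2 := (l2 R G).
Local Notation N := (vN R G).
Local Notation rho := (@vN_of_group R G).
Let rho1 : rho 1%g = 1 := @vN_of_group1 R G.
Let rhoM : {morph rho : g h / (g * h)%g >-> g * h} := @vN_of_groupM R G.

Lemma adj_ev (l : fsum G) : adj (ev rho l) = ev rho (fstar l).
Proof.
have adjZ (k : int) (x : N) : adj (x *~ k) = adj x *~ k.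
  have P n : adj (x *+ n) = adj x *+ n.
    by elim: n => [|n IH]; rewrite ?mulr0n ?adj0// !mulrS adjD IH.
  by case: k => n; [exact: P | rewrite NegzE !mulrNz adjN; congr (- _); exact: P].
rewrite /ev adj_sum big_map; apply: eq_bigr => a _ /=.
by rewrite adjZ adj_of_group.
Qed.

Lemma madj_mev m n (L : fmatrix G m n) : madj (mev rho L) = mev rho (mstar L).
Proof. by apply/matrixP => i j; rewrite !mxE adj_ev. Qed.

Lemma rtr_int (x : N) (k : int) : rtr (x *~ k) = k%:~R * rtr x.
Proof.
have P n : rtr (x *+ n) = n%:R * rtr x.
  by elim: n => [|n IH]; rewrite ?mulr0n ?rtr0 ?mul0r// mulrS rtrD IH mulrS mulrDl mul1r.
by case: k => n; [exact: P | rewrite NegzE !mulrNz rtrN mulNr; congr (- _); exact: P].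
Qed.

Lemma rtr_group (x : G) : rtr (rho x) = (x == 1%g)%:R.
Proof.
rewrite /rtr /vN_trace /= mul1g.
by case: eqP.
Qed.

Lemma rtr_ev (l : fsum G) : rtr (ev rho l) = \sum_(a <- l | a.2 == 1%g) a.1%:~R.
Proof.
rewrite /ev rtr_sum [RHS]big_mkcond; apply: eq_bigr => a _.
by rewrite rtr_int rtr_group; case: eqP; rewrite ?mulr1 ?mulr0.
Qed.

Lemma ip_ev_le (l : fsum G) f h : ip (ev rho l f) h <= (fnorm l)%:R * ((nsq f + nsq h) / 2).
Proof.
have ipz (T : N) (k : int) : ip ((T *~ k) f) h = k%:~R * ip (T f) h.
  have P n : ip ((T *+ n) f) h = n%:R * ip (T f) h.
    elim: n => [|n IH]; first by rewrite mulr0n vN_zero ip0l mul0r.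
    by rewrite mulrS vN_add ipDl IH mulrS mulrDl mul1r.
  by case: k => n; [exact: P | rewrite NegzE !mulrNz vN_opp ipNl mulNr; congr (- _); exact: P].
rewrite /ev /fnorm vN_sum ip_sum natr_sum mulr_suml; apply: ler_sum => a _.
rewrite ipz.
have nr : nsq (rho a.2 f) = nsq f by exact: nsq_rtrans.
have b1 : `|ip (rho a.2 f) h| <= (nsq f + nsq h) / 2.
  have := nsq_ge0 (rho a.2 f - h); have := nsq_ge0 (rho a.2 f + h).
  rewrite -!ipff !(ipDl, ipDr, ipNl, ipNr) (ipC h) !ipff nr ler_norml => ? ?.
  by apply/andP; split; lra.
apply: le_trans (ler_norm _) _; rewrite normrM.
have -> : (`|a.1|%N)%:R = `|(a.1)%:~R : R|.
  by rewrite -intr_norm pmulrn -abszE.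
by rewrite ler_wpM2l.
Qed.

Lemma ipn_mev_le n (L : fmatrix G n n) u :
  ipn (opm (mev rho L) u) u <= (mnorm L)%:R * ipn u u.
Proof.
have le1 i : nsq (u i) <= ipn u u.
  rewrite /ipn (bigD1 i)//= ipff lerDl.
  by apply: sumr_ge0 => k _; rewrite ipff nsq_ge0.
rewrite ipn_opm /mnorm natr_sum mulr_suml; apply: ler_sum => i _.
rewrite natr_sum mulr_suml; apply: ler_sum => j _.
rewrite mxE; apply: le_trans (ip_ev_le _ _ _) _.
rewrite ler_wpM2l ?ler0n//.
by have := le1 i; have := le1 j => ? ?; lra.
Qed.

Lemma mtr_mev n (L : fmatrix G n n) :
  mtr (mev rho L) = \sum_i \sum_(a <- L i i | a.2 == 1%g) a.1%:~R.
Proof. by apply: eq_bigr => i _; rewrite mxE rtr_ev. Qed.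

Variables (d : nat) (s : 'I_d -> G).
Hypothesis gens : forall x, exists w, wprod s w = x.
Variable rel : seq (relation d).
Hypothesis rel_valid : forall r, r \in rel -> valid s r.

Let B := mev rho (fox_matrix s rel).
Let c := mev rho (generator_column s).

Lemma mev_laplacian : mev rho (laplacian s rel) = madj B *m B + c *m madj c.
Proof. by rewrite mev_add !mev_mul// !madj_mev. Qed.

(** The generators of a projective submodule lift to cycles, which may be taken
    to be supported on the generators of [G]. A combination of them in the row
    space of the Fox matrix is a boundary, hence vanishes in the homology, so
    that the bound for traces applies. *)
Lemma fg_projective_bound (P : set (H1 rho)) (r : R) (K k : nat) :
  fg_projective_dim P r -> (0 < K)%N -> (mnorm (laplacian s rel) <= K)%N ->
  K%:R ^+ (2 * k) * r <=
  mtr (mev rho (mpow (madd (mconst G d K) (mopp (laplacian s rel))) (2 * k))).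
Proof.
move=> [n [A [f [AA finj _ ->]]]] K0 LK.
have -> : complex.Re (\sum_(i < n) vN_trace (A i i)) = mtr A.
  by rewrite /mtr (big_morph (@complex.Re R) (id1 := 0) (op1 := +%R))//; case=> ? ? [].
have /choice[z zP] i : exists z : cycle1 rho, f (row i A) = class1 z.
  exact: (@qpi_surj _ _ (boundaries1 rho)).
pose X := \matrix_i fox_lift rho gens (val (z i)).
have zX i : boundary rho (val (z i) - generator_chain s (row i X)).
  by rewrite rowK; exact: fox_liftP.
have gcX (y : 'rV[N]_n) : boundary rho (\sum_i y 0 i *: val (z i) - generator_chain s (y *m X)).
  rewrite mulmx_sum_row generator_chain_sum -sumrB.
  apply: boundary_sum => i; rewrite generator_chainZ -scalerBr.
  exact: boundaryZ.
have key (y : 'rV[N]_n) : boundary rho (generator_chain s (y *m X)) -> y *m A = 0.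
  move=> yX; have yB := boundaryD (gcX y) yX; rewrite subrK in yB.
  have fy : f (y *m A) = 0.
    rewrite mulmx_sum_row linear_sum.
    transitivity (class1 (\sum_i y 0 i *: z i)).
      by rewrite /class1 qpi_sum; apply: eq_bigr => i _; rewrite linearZ_LR /= zP qpiZ.
    apply/qpi_eq0/asboolP.
    move: yB => [e eP]; exists e; rewrite eP.
    by rewrite (big_morph (fun w : cycle1 rho => val w) (id1 := 0) (op1 := +%R)).
  apply: finj.
  - by apply/mem_set; exists y.
  - by apply/mem_set; exists 0 => //; rewrite mul0mx.
  - by rewrite fy linear0.
have Xc : X *m c = 0.
  apply/row_matrixP => i; rewrite row_mul row0.
  apply/matrixP => a b; rewrite !ord1 -bar_d1_generator_chain// mxE.
  have := boundary_cycle rho1 rhoM (zX i); rewrite /bar_d1 linearB /=.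
  have /eqP := valP (z i); rewrite /bar_d1 => ->.
  by rewrite sub0r => /eqP; rewrite oppr_eq0 => /eqP.
have -> : mev rho (mpow (madd (mconst G d K) (mopp (laplacian s rel))) (2 * k)) =
   (K%:R%:M - (madj B *m B + c *m madj c)) ^+ (2 * k).
  by rewrite mev_pow// mev_add mev_opp mev_laplacian mev_const.
apply: (trace_bound (X := A *m X)) => //.
- by rewrite mulmxA AA.
- by rewrite -mulmxA Xc mulmx0.
- exact: fox_matrix_cycle.
- move=> y w yw.
  have : y *m A *m A = 0.
    by apply: key; rewrite -mulmxA yw; exact: boundary_relation.
  by rewrite -mulmxA AA.
- move=> u; rewrite -mev_laplacian; apply: le_trans (ipn_mev_le _ _) _.
  by rewrite ler_wpM2r ?ipnn_ge0// ler_nat.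
Qed.

End L2Bound.

(** * Finite quotients and permutation modules *)

Section Cosets.
Variables (G : groupType) (H : groupClosed G).

(** Cosets are numbered, so that functions on the quotient are row vectors. *)
Definition coset_map n (cl : G -> 'I_n) (rep : 'I_n -> G) : Prop :=
  (forall i, cl (rep i) = i) /\ (forall x y, cl x = cl y <-> (x^-1 * y)%g \in H).

Lemma coset_map_exists : (0 < subgroup_index H)%N ->
  exists (cl : G -> 'I_(subgroup_index H)) rep, coset_map cl rep.
Proof.
rewrite /subgroup_index; set F := fset_set _ => F0.
have finC : finite_set (left_cosets H).
  apply: contrapT => nfin; move: F0; rewrite /F /fset_set.
  by case: pselect => // ?; rewrite cardfs0.
pose co x := [set y | (x^-1 * y)%g \in H].
have coF x : co x \in F by rewrite in_fset_set// mem_set//; exists x.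
have cl_lt x : (index (co x) F < #|` F|)%N by rewrite index_mem coF.
pose cl x := Ordinal (cl_lt x).
have /choice[rep repP] (i : 'I_(#|` F|)) : exists x, co x = nth set0 F i.
  have := mem_nth set0 (ltn_ord i); rewrite [_ \in _]in_fset_set// => /set_mem[x _ <-].
  by exists x.
have coE x y : co x = co y <-> (x^-1 * y)%g \in H.
  split=> [e|xy].
    have : co y y by rewrite /co /= mulVg gpred1.
    by rewrite -e.
  apply/seteqP; split=> z; rewrite /co /= => h.
    have -> : (y^-1 * z)%g = ((x^-1 * y)^-1 * (x^-1 * z))%g by rewrite invgM invgK -mulgA mulVKg.
    by rewrite gpredM ?gpredV.
  have -> : (x^-1 * z)%g = ((x^-1 * y) * (y^-1 * z))%g by rewrite -mulgA mulVKg.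
  by rewrite gpredM.
exists cl, rep; split.
  by move=> i; apply/val_inj; rewrite /= repP index_uniq// fset_uniq.
move=> x y; rewrite -coE; split=> [/(congr1 val) /= e|e].
  by rewrite -(nth_index set0 (coF x)) -(nth_index set0 (coF y)) e.
by apply/val_inj; rewrite /= e.
Qed.

Hypothesis H_normal : normal_subgroup H.
Variables (n : nat) (cl : G -> 'I_n) (rep : 'I_n -> G).
Hypothesis clP : coset_map cl rep.

Lemma cl_rep i : cl (rep i) = i. Proof. exact: clP.1. Qed.
Lemma clE x y : cl x = cl y <-> (x^-1 * y)%g \in H. Proof. exact: clP.2. Qed.

(** Right translation on the cosets, well defined as the subgroup is normal. *)
Definition coset_act (i : 'I_n) (g : G) : 'I_n := cl (rep i * g)%g.
(** Left translations commute with [coset_act], hence permute the solutions of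
    the Fox equations. *)
Definition coset_lact (g : G) (i : 'I_n) : 'I_n := cl (g * rep i)%g.

Lemma cl_mull g x y : cl x = cl y -> cl (g * x)%g = cl (g * y)%g.
Proof. by move=> /clE h; apply/clE; rewrite invgM -mulgA mulKg. Qed.

Lemma cl_mulr g x y : cl x = cl y -> cl (x * g)%g = cl (y * g)%g.
Proof.
move=> /clE h; apply/clE.
have := H_normal g h; rewrite /conjg invgM.
by rewrite !mulgA.
Qed.

Lemma coset_act_cl x g : coset_act (cl x) g = cl (x * g)%g.
Proof. by apply: cl_mulr; rewrite cl_rep. Qed.

Lemma coset_lact_cl x g : coset_lact g (cl x) = cl (g * x)%g.
Proof. by apply: cl_mull; rewrite cl_rep. Qed.

Lemma coset_act1 i : coset_act i 1%g = i.
Proof. by rewrite /coset_act mulg1 cl_rep. Qed.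

Lemma coset_actM i g h : coset_act i (g * h)%g = coset_act (coset_act i g) h.
Proof. by rewrite [X in _ = coset_act X _]/coset_act coset_act_cl [LHS]/coset_act mulgA. Qed.

Lemma coset_act_fix i g : (coset_act i g == i) = (g \in H).
Proof.
apply/eqP/idP => [|gH]; rewrite /coset_act.
  rewrite -{2}(cl_rep i) => /esym/clE; by rewrite mulKg.
by rewrite -[RHS]cl_rep; apply/esym/clE; rewrite mulKg.
Qed.

Lemma coset_lactM g h i : coset_lact (g * h)%g i = coset_lact g (coset_lact h i).
Proof. by rewrite [X in _ = coset_lact _ X]/coset_lact coset_lact_cl [LHS]/coset_lact mulgA. Qed.

Lemma coset_lact1 i : coset_lact 1%g i = i.
Proof. by rewrite /coset_lact mul1g cl_rep. Qed.

Lemma coset_lact_act g i h : coset_lact g (coset_act i h) = coset_act (coset_lact g i) h.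
Proof. by rewrite /coset_act coset_lact_cl /coset_lact -/(coset_act _ _) coset_act_cl mulgA. Qed.

Lemma cl1_mem x : (cl x == cl 1%g) = (x \in H).
Proof.
by apply/eqP/idP => [/esym/clE|xH]; last apply/esym/clE; rewrite ?invg1 ?mul1g.
Qed.

End Cosets.

Section PermutationModule.
Variables (G : groupType) (n : nat) (act : 'I_n -> G -> 'I_n).
Hypothesis act1 : forall i, act i 1%g = i.
Hypothesis actM : forall i g h, act i (g * h)%g = act (act i g) h.

Section Ring.
Variable F : comNzRingType.

(** The action of a matrix over the integral group ring on tuples of functions
    on the [G]-set, through [(g f) i = f (act i g)]. *)
Definition ring_act m d (L : fmatrix G m d) (f : 'M[F]_(d, n)) : 'M[F]_(m, n) :=
  \matrix_(r, i) \sum_t \sum_(a <- L r t) f t (act i a.2) *~ a.1.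

Lemma ring_act_linear m d (L : fmatrix G m d) : linear (ring_act L).
Proof.
move=> c f g; apply/matrixP => r i; rewrite !mxE mulr_sumr -big_split.
apply: eq_bigr => t _; rewrite mulr_sumr -big_split; apply: eq_bigr => a _.
by rewrite !mxE mulrzDl mulrzAr.
Qed.
HB.instance Definition _ m d (L : fmatrix G m d) :=
  GRing.isLinear.Build F _ _ _ (ring_act L) (ring_act_linear L).

(** The operator [ring_act L] on row vectors, whence the reversal of products. *)
Definition rmx m d (L : fmatrix G m d) : 'M[F]_(d * n, m * n) := lin_mx (ring_act L).

Lemma mxvec_ext p q (M M' : 'M[F]_(p * n, q)) :
  (forall f : 'M[F]_(p, n), mxvec f *m M = mxvec f *m M') -> M = M'.
Proof.
move=> e; apply/row_matrixP => i; rewrite !rowE -[delta_mx 0 i]vec_mxK; exact: e.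
Qed.

Lemma ring_act_mul m d e (L : fmatrix G m d) (L' : fmatrix G d e) f :
  ring_act (mmul L L') f = ring_act L (ring_act L' f).
Proof.
apply/matrixP => r i; rewrite !mxE.
have flatten_sum (I : Type) (T : Type) (h : I -> seq T) (k : T -> F) (ls : seq I) :
    \sum_(a <- flatten [seq h x | x <- ls]) k a = \sum_(x <- ls) \sum_(a <- h x) k a.
  by elim: ls => [|x ls IH]; rewrite ?big_nil// big_cons /= big_cat IH.
under eq_bigr do rewrite mxE flatten_sum big_enum /=.
rewrite exchange_big /=; apply: eq_bigr => k _.
under eq_bigr do rewrite /fmul flatten_sum.
rewrite exchange_big /=; apply: eq_bigr => a _.
rewrite mxE mulrz_suml; apply: eq_bigr => t _.
rewrite big_map mulrz_suml; apply: eq_bigr => b _ /=.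
by rewrite actM -mulrzA mulrC.
Qed.

Lemma ring_act_add m d (L L' : fmatrix G m d) f :
  ring_act (madd L L') f = ring_act L f + ring_act L' f.
Proof.
apply/matrixP => r i; rewrite !mxE -big_split; apply: eq_bigr => t _.
by rewrite mxE big_cat.
Qed.

Lemma ring_act_opp m d (L : fmatrix G m d) f : ring_act (mopp L) f = - ring_act L f.
Proof.
apply/matrixP => r i; rewrite !mxE -sumrN; apply: eq_bigr => t _.
by rewrite mxE big_map -sumrN; apply: eq_bigr => a _; rewrite mulrNz.
Qed.

Lemma ring_act_const d k (f : 'M[F]_(d, n)) : ring_act (mconst G d k) f = k%:~R *: f.
Proof.
apply/matrixP => r i; rewrite !mxE (bigD1 r)//= mxE eqxx big_seq1 /= act1.
rewrite big1 ?addr0 ?mulrzl// => t tr.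
by rewrite mxE eq_sym (negbTE tr) big_nil.
Qed.

Lemma rmx_mul m d e (L : fmatrix G m d) (L' : fmatrix G d e) :
  rmx (mmul L L') = rmx L' *m rmx L.
Proof.
by apply: mxvec_ext => f; rewrite mulmxA !mul_vec_lin /= ring_act_mul.
Qed.

Lemma rmx_add m d (L L' : fmatrix G m d) : rmx (madd L L') = rmx L + rmx L'.
Proof.
by apply: mxvec_ext => f; rewrite mulmxDr !mul_vec_lin /= ring_act_add linearD.
Qed.

Lemma rmx_opp m d (L : fmatrix G m d) : rmx (mopp L) = - rmx L.
Proof.
by apply: mxvec_ext => f; rewrite mulmxN !mul_vec_lin /= ring_act_opp linearN.
Qed.

Lemma rmx_const d k : rmx (mconst G d k) = k%:~R%:M.
Proof.
by apply: mxvec_ext => f; rewrite mul_mx_scalar mul_vec_lin /= ring_act_const linearZ.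
Qed.

Lemma rmx_pow d (L : fmatrix G d d) k : rmx (mpow L k) = rmx L ^+ k.
Proof.
elim: k => [|k IH]; first by rewrite rmx_const.
by rewrite exprSr /= rmx_mul IH.
Qed.

Lemma rmxE m d (L : fmatrix G m d) t j r i :
  rmx L (mxvec_index t j) (mxvec_index r i) =
  \sum_(a <- L r t) (act i a.2 == j)%:R *~ a.1.
Proof.
rewrite /rmx /lin_mx mxE /= vec_mx_delta mxvecE mxE.
rewrite (bigD1 t)//= [X in _ + X]big1 ?addr0.
  by apply: eq_bigr => a _; rewrite mxE eqxx.
by move=> k kt; rewrite big1// => a _; rewrite mxE (negbTE kt) mul0rz.
Qed.

Lemma rmx_star m d (L : fmatrix G m d) : rmx (mstar L) = (rmx L)^T.
Proof.
apply/matrixP => p q; rewrite [RHS]mxE.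
case/mxvec_indexP: p => r i; case/mxvec_indexP: q => t j.
rewrite !rmxE mxE big_map; apply: eq_bigr => a _ /=; congr ((nat_of_bool _)%:R *~ _).
by apply/eqP/eqP => <-; rewrite -actM ?mulgV ?mulVg act1.
Qed.

Lemma mxtrace_rmx d (L : fmatrix G d d) :
  \tr (rmx L) = \sum_t \sum_i \sum_(a <- L t t) (act i a.2 == i)%:R *~ a.1.
Proof.
rewrite /mxtrace (reindex (uncurry (@mxvec_index d n))) /=; last exact: curry_mxvec_bij.
rewrite pair_bigA /=; apply: eq_bigr => -[t i] _; exact: rmxE.
Qed.

End Ring.

Lemma map_rmx (F F' : comNzRingType) (h : {rmorphism F -> F'}) m d (L : fmatrix G m d) :
  map_mx h (rmx F L) = rmx F' L.
Proof.
apply: map_lin_mx => f; apply/matrixP => r i; rewrite !mxE rmorph_sum.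
apply: eq_bigr => t _; rewrite rmorph_sum; apply: eq_bigr => a _.
by rewrite raddfMz mxE.
Qed.

Lemma rmx_col_norm m d (L : fmatrix G m d) q :
  \sum_p `|rmx int L p q| <= (mnorm L)%:Z.
Proof.
case/mxvec_indexP: q => r i.
rewrite (reindex (uncurry (@mxvec_index d n))) /=; last exact: curry_mxvec_bij.
rewrite (eq_bigr (fun p => `|rmx int L (mxvec_index p.1 p.2) (mxvec_index r i)|)); last first.
  by case.
rewrite -(pair_bigA _ (fun t j => `|rmx int L (mxvec_index t j) (mxvec_index r i)|)) /=.
rewrite /mnorm (bigD1 r)//= PoszD; apply: (@le_trans _ _ (\sum_j fnorm (L r j))%N%:Z); last first.
  by rewrite lerDl.
rewrite -[X in _ <= X]natz natr_sum; apply: ler_sum => t _.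
apply: (@le_trans _ _ (\sum_j \sum_(a <- L r t) `|a.1| * (act i a.2 == j)%:R)).
  apply: ler_sum => j _; rewrite rmxE; apply: le_trans (ler_norm_sum _ _ _) _.
  apply: ler_sum => a _; rewrite -mulrzl normrM intz.
  by case: (act _ _ == _); rewrite ?normr1 ?normr0.
rewrite exchange_big /= /fnorm natr_sum; apply: ler_sum => a _.
rewrite -mulr_sumr (bigD1 (act i a.2))//= eqxx big1 ?addr0 ?mulr1 ?natz ?abszE//.
by move=> j; rewrite eq_sym => /negbTE ->.
Qed.

End PermutationModule.

(** * Ranks of Fox matrices and Laplacians *)

Section Ranks.

Lemma mxrank_gram (F : realFieldType) m n (M : 'M[F]_(m, n)) :
  \rank (M *m M^T) = \rank M.
Proof.
apply/eqP; rewrite eqn_leq mxrankM_maxl /=.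
have kerM : (kermx (M *m M^T) <= kermx M)%MS.
  apply/row_subP => i; apply/sub_kermxP; set x := row i _.
  have : x *m M *m (x *m M)^T = 0.
    rewrite trmx_mul !mulmxA -(mulmxA x).
    have /sub_kermxP -> := row_sub i (kermx (M *m M^T)); by rewrite mul0mx.
  move: (x *m M) => y /matrixP/(_ 0 0); rewrite !mxE => y0.
  apply/rowP => j; rewrite mxE; apply/eqP; rewrite -sqrf_eq0.
  have /psumr_eq0P h : \sum_j y 0 j ^+ 2 = 0.
    by rewrite -[RHS]y0; apply: eq_bigr => k _; rewrite mxE expr2.
  by rewrite h// => k _; exact: sqr_ge0.
have := mxrankS kerM; rewrite !mxrank_ker => h.
by have := rank_leq_row M; have := rank_leq_row (M *m M^T); lia.
Qed.

(** The matrix is [W W^T] for the block matrix [W] of [b] and [c^T], and [W^T W]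
    is block diagonal because [c b = 0]. *)
Lemma mxrank_laplacian (F : realFieldType) m n q (b : 'M[F]_(n, m)) (c : 'M[F]_(q, n)) :
  c *m b = 0 -> \rank (b *m b^T + c^T *m c)%R = (\rank b + \rank c)%N.
Proof.
move=> cb; pose W := row_mx b c^T.
have WW : W *m W^T = b *m b^T + c^T *m c by rewrite tr_row_mx mul_row_col trmxK.
rewrite -WW mxrank_gram -mxrank_tr -mxrank_gram trmxK tr_row_mx mul_col_row trmxK cb.
rewrite -trmx_mul cb trmx0 rank_diag_block_mx mxrank_gram.
by rewrite -{2}[b]trmxK mxrank_gram mxrank_tr.
Qed.

(** A minor that does not vanish modulo [p] is a nonzero integer. *)
Lemma mxrank_modp (F : numFieldType) p m n (M : 'M[int]_(m, n)) : prime p ->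
  (\rank (map_mx intr M : 'M['F_p]_(m, n)) <= \rank (map_mx intr M : 'M[F]_(m, n)))%N.
Proof.
move=> pp; set Mp := map_mx intr M; set r := \rank Mp.
have [U UP] := row_fullP (col_base_full Mp).
have [V VP] := row_freeP (row_base_free Mp).
have UMV : U *m Mp *m V = 1%:M.
  have e : U *m (col_base Mp *m row_base Mp) *m V = 1%:M by rewrite mulmxA UP mul1mx VP.
  by rewrite mulmx_base in e.
(* [U] and [V] pick out an invertible matrix modulo [p]; any integral lift of them
   does so over the integers. *)
pose lift (x : 'F_p) : int := (x : nat)%:Z.
have liftK (x : 'F_p) : ((lift x)%:~R : 'F_p) = x.
  by rewrite /lift -pmulrn natr_Zp.
pose N := map_mx lift U *m M *m map_mx lift V.
have N1 : map_mx intr N = 1%:M :> 'M['F_p]_r.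
  rewrite !map_mxM -UMV; congr (_ *m _ *m _); apply/matrixP => i j; rewrite !mxE; exact: liftK.
have detN : \det N != 0.
  apply/eqP => N0; have := det_map_mx (intr : int -> 'F_p) N.
  by rewrite N1 N0 det1 => /eqP; rewrite rmorph0 oner_eq0.
have : \rank (map_mx intr N : 'M[F]_r) = r.
  apply: mxrank_unit; rewrite unitmxE det_map_mx unitfE intr_eq0 //.
move=> <-; rewrite !map_mxM; apply: leq_trans (mxrankM_maxl _ _) _.
exact: mxrankM_maxr.
Qed.

End Ranks.

Section FoxSolutions.
Variables (G : groupType) (n : nat) (act : 'I_n -> G -> 'I_n).
Hypothesis act1 : forall i, act i 1%g = i.
Hypothesis actM : forall i g h, act i (g * h)%g = act (act i g) h.
Variables (d : nat) (s : 'I_d -> G).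

Section Ring.
Variable F : comNzRingType.
Implicit Types f : 'M[F]_(d, n).

(** The value on a word of the derivation with the prescribed values on the
    generators. *)
Fixpoint fox_value f (w : seq 'I_d) (i : 'I_n) : F :=
  if w is t :: w' then f t i + fox_value f w' (act i (s t)) else 0.

Lemma fox_valueE f w i :
  fox_value f w i = \sum_t \sum_(a <- fox s w t) f t (act i a.2) *~ a.1.
Proof.
elim: w i => [|t w IH] i /=.
  by rewrite big1// => t _; rewrite big_nil.
under eq_bigr do rewrite big_cat /fmul /= cats0 big_map.
rewrite big_split /= IH; congr (_ + _); last first.
  apply: eq_bigr => k _; apply: eq_bigr => a _ /=.
  by rewrite actM mul1r.
rewrite (bigD1 t)//= eqxx big_seq1 act1 big1 ?addr0// => k kt.
by rewrite eq_sym (negbTE kt) big_nil.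
Qed.

Lemma ring_act_fox_matrix_eq0 rel f : ring_act act (fox_matrix s rel) f = 0 <->
  (forall r, r \in rel -> forall i, fox_value f r.1 i = fox_value f r.2 i).
Proof.
have E r i : ring_act act (fox_matrix s rel) f r i =
   fox_value f (tnth (in_tuple rel) r).1 i - fox_value f (tnth (in_tuple rel) r).2 i.
  rewrite mxE !fox_valueE -sumrB; apply: eq_bigr => t _.
  rewrite mxE big_cat /= big_map -sumrN; congr (_ + _).
  by apply: eq_bigr => a _; rewrite mulrNz.
split=> [f0 r /seq_tnthP[k ->] i|h].
  apply/eqP; rewrite -subr_eq0 -[tnth _ k]/(tnth (in_tuple rel) k) -E f0 mxE //.
apply/matrixP => r i; rewrite E h ?subrr ?mxE// mem_tnth //.
Qed.

Lemma fox_value_boundary (g : 'M[F]_(1, n)) w i :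
  fox_value (ring_act act (generator_column s) g) w i =
  g 0 (act i (wprod s w)) - g 0 i.
Proof.
elim: w i => [|t w IH] i /=; first by rewrite act1 subrr.
rewrite IH mxE big_ord1 mxE !big_cons big_nil /= act1 addr0 -actM.
by rewrite mulrNz mulr1z addrC addrA subrK.
Qed.

Lemma ring_act_fox_boundary rel (g : 'M[F]_(1, n)) :
  (forall r, r \in rel -> valid s r) ->
  ring_act act (fox_matrix s rel) (ring_act act (generator_column s) g) = 0.
Proof.
move=> relV; apply/ring_act_fox_matrix_eq0 => r /relV rV i.
by rewrite !fox_value_boundary rV.
Qed.

End Ring.

(** Functions that are invariant under the generators are constant. *)
Lemma rank_generator_column (F : fieldType) (i0 : 'I_n) :
  (forall i, exists w, act i0 (wprod s w) = i) ->
  (n - 1 <= \rank (rmx act F (generator_column s)))%N.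
Proof.
move=> trans.
have : (kermx (rmx act F (generator_column s)) <= mxvec (const_mx 1 : 'M[F]_(1, n)))%MS.
  apply/row_subP => k; set x := row k _; pose g := vec_mx x : 'M[F]_(1, n).
  have g0 : ring_act act (generator_column s) g = 0.
    apply: (can_inj mxvecK); rewrite -mul_vec_lin vec_mxK linear0.
    by apply/sub_kermxP; exact: row_sub.
  have gc i : g 0 i = g 0 i0.
    have [w <-] := trans i; apply/eqP; rewrite -subr_eq0 -fox_value_boundary g0.
    by apply/eqP; elim: w i0 {trans} => [|t w IH] j //=; rewrite mxE IH addr0.
  have -> : x = g 0 i0 *: mxvec (const_mx 1 : 'M[F]_(1, n)).
    rewrite -linearZ -[x]vec_mxK; congr mxvec; apply/matrixP => a i.
    by rewrite ord1 -/g gc !mxE mulr1.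
  exact: scalemx_sub.
move/mxrankS; rewrite mxrank_ker => h.
have := leq_trans h (rank_leq_row _).
by move: (\rank (rmx _ _ _)) => x; lia.
Qed.

(** The rank of the Fox matrix can only drop modulo [p], so that the solutions of
    the Fox equations over the prime field, up to the coboundaries, bound the
    kernel of the Laplacian in characteristic zero. *)
Lemma rank_laplacian_ge (R : realType) p rel (i0 : 'I_n) : prime p ->
  (forall r, r \in rel -> valid s r) ->
  (forall i, exists w, act i0 (wprod s w) = i) ->
  (\rank (rmx act 'F_p (fox_matrix s rel)) + (n - 1) <=
   \rank (map_mx intr (rmx act int (laplacian s rel)) : 'M[R]_(d * n)))%N.
Proof.
move=> pp relV trans.
rewrite map_rmx /laplacian rmx_add !rmx_mul// !rmx_star//.
rewrite mxrank_laplacian; last first.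
  rewrite -rmx_mul//; apply: mxvec_ext => f.
  by rewrite mul_vec_lin mulmx0 /= ring_act_mul// ring_act_fox_boundary// linear0.
apply: leq_add; last exact: (rank_generator_column _ trans).
by rewrite -(map_rmx _ intr) -[X in (_ <= \rank X)%N](map_rmx _ intr); exact: mxrank_modp.
Qed.

Lemma laplacian_gram rel :
  rmx act int (laplacian s rel) =
  let W := row_mx (rmx act int (fox_matrix s rel)) (rmx act int (generator_column s))^T in
  W *m W^T.
Proof.
rewrite /laplacian rmx_add !rmx_mul// !rmx_star//.
by rewrite /= tr_row_mx mul_row_col trmxK.
Qed.

End FoxSolutions.

(** * Invariants of p-groups *)

Section PGroupInvariants.
Local Open Scope group_scope.
Local Open Scope ring_scope.
Variables (p d n : nat).
Hypothesis p_prime : prime p.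
Local Notation V := 'M['F_p]_(d, n).

(** Both sides are exponents of the cardinal of the same finite set. *)
Lemma dim_lker_lin_mx m q (f : {linear V -> 'M['F_p]_(m, q)}) :
  \dim (lker (linfun f)) = (d * n - \rank (lin_mx f))%N.
Proof.
apply: (@expnI p); first exact: prime_gt1.
have cV (Z : {vspace V}) : #|Z| = (p ^ \dim Z)%N.
  by rewrite (@card_vspace 'F_p V) card_Fp.
have cR a b (M : 'M['F_p]_(a, b)) : #|rowg M| = (p ^ \rank M)%N.
  by rewrite card_rowg card_Fp.
rewrite -mxrank_ker -cV -cR.
rewrite -(fintype.card_image (can_inj (@mxvecK 'F_p d n))); apply: eq_card => x.
rewrite mem_rowg; apply/fintype.imageP/sub_kermxP => [[v vf ->]|xf].
  by move: vf; rewrite memv_ker lfunE /= => /eqP vf; rewrite mul_vec_lin vf linear0.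
exists (vec_mx x); last by rewrite vec_mxK.
rewrite memv_ker lfunE /=; apply/eqP/(can_inj mxvecK).
by rewrite -mul_vec_lin vec_mxK xf linear0.
Qed.

Variables (Gamma : {group 'S_n}) (U U0 : {vspace V}).
Hypothesis Gamma_p : p.-group Gamma.
Hypothesis U_stable : forall g v, g \in Gamma -> v \in U -> col_perm g v \in U.
Hypothesis fixed_U0 : forall v, v \in U ->
  (forall g, g \in Gamma -> col_perm g v = v) -> v \in U0.

Let pi (g : 'S_n) : 'End(V) := (projv U0 \o linfun (@col_perm 'F_p d n g))%VF.
(* The vectors of [U] whose translates by the elements of [l] project to zero. *)
Let W (l : seq 'S_n) : {vspace V} := foldr (fun g W => (W :&: lker (pi g))%VS) U l.

Let W_dim l : (\dim U <= \dim (W l) + size l * \dim U0)%N.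
Proof.
elim: l => [|g l IH] /=; first by rewrite addn0.
apply: leq_trans IH _; rewrite -(limg_ker_dim (pi g) (W l)) mulSn addnA.
rewrite leq_add2r leq_add2l; apply: dimvS; apply/subvP => _ /memv_imgP[v _ ->].
by rewrite lfunE /=; exact: memv_proj.
Qed.

Let W_mem l v : (v \in W l) =
  (v \in U) && all (fun g => projv U0 (col_perm g v) == 0) l.
Proof.
elim: l => [|g l IH] /=; first by rewrite andbT.
by rewrite memv_cap IH memv_ker lfunE /= lfunE /= andbCA andbC andbA.
Qed.

Let to_act (v : V) (g : 'S_n) : V := col_perm g^-1 v.
Let to_is_action : is_action finset.setT to_act.
Proof.
apply: is_total_action => [v|v a b]; rewrite /to_act; first by rewrite invg1 col_perm1.
by rewrite invMg col_permM.
Qed.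
Let to := Action to_is_action.

(** The vectors of [U] all of whose translates project to zero on [U0] form a
    stable subspace without nonzero fixed vectors, which is trivial for a
    [p]-group. Hence [v |-> (g |-> projv U0 (g v))] embeds [U] into [#|Gamma|]
    copies of [U0]. *)
Lemma pgroup_dim_le : (\dim U <= #|Gamma| * \dim U0)%N.
Proof.
have := W_dim (enum Gamma); rewrite -cardE.
suff -> : W (enum Gamma) = 0%VS by rewrite dimv0.
set Z := W _; pose S : {set V} := [set v in Z]%SET.
have Smem v : (v \in S) = (v \in U) && all (fun g => projv U0 (col_perm g v) == 0) (enum Gamma).
  by rewrite inE W_mem.
have S_act : [acts Gamma, on S | to].
  apply/fintype.subsetP => g gG; rewrite !inE /=; apply/fintype.subsetP => v.
  rewrite !inE /= -!/(_ \in Z) !W_mem => /andP[vU /allP h].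
  rewrite U_stable ?groupV//=; apply/allP => k; rewrite mem_enum => kG.
  by rewrite /to_act -col_permM h// mem_enum groupM// groupV.
have := pgroup_fix_mod Gamma_p S_act.
have -> : #|S| = (p ^ \dim Z)%N.
  transitivity #|Z|; first by apply: eq_card => v; rewrite inE.
  by rewrite (@card_vspace 'F_p V) card_Fp.
have -> : 'Fix_(S | to)(Gamma) = [set (0 : V)]%SET.
  apply/finset.setP => v; rewrite finset.in_setI finset.in_set1 [v \in S]inE.
  apply/andP/eqP => [[vZ /afixP fixv]|->].
    have vfix g : g \in Gamma -> col_perm g v = v.
      by move=> gG; have := fixv g^-1%g; rewrite groupV /= /to_act invgK; apply.
    move: vZ; rewrite W_mem => /andP[vU /allP/(_ 1%g)].
    rewrite mem_enum group1 => /(_ isT)/eqP; rewrite col_perm1 projv_id//.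
    exact: fixed_U0.
  split; first exact: mem0v.
  by apply/afixP => g _; rewrite /= /to_act linear0.
rewrite cards1; case: (posnP (\dim Z)) => [/eqP|dZ]; first by rewrite dimv_eq0 => /eqP.
by rewrite (modn_small (prime_gt1 p_prime)) -(prednK dZ) expnS modnMr.
Qed.

End PGroupInvariants.

Section Monotone.
Local Open Scope group_scope.
Local Open Scope ring_scope.
Variables (G : groupType) (H K : groupClosed G).
Hypothesis KH : {subset K <= H}.
Hypotheses (H_normal : normal_subgroup H) (K_normal : normal_subgroup K).
Variables (nH nK : nat) (clH : G -> 'I_nH) (repH : 'I_nH -> G)
  (clK : G -> 'I_nK) (repK : 'I_nK -> G).
Hypotheses (clHP : coset_map H clH repH) (clKP : coset_map K clK repK).
Variables (d : nat) (s : 'I_d -> G) (rel : seq (relation d)).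
Local Notation actH := (coset_act clH repH).
Local Notation actK := (coset_act clK repK).
Local Notation lact := (coset_lact clK repK).

Let lactK g : cancel (lact g) (lact g^-1%g).
Proof. by move=> i; rewrite -(coset_lactM clKP) mulVg (coset_lact1 clKP). Qed.

Let sigma (g : G) : 'S_nK := perm (can_inj (lactK g)).

Let sigmaE g i : sigma g i = lact g i. Proof. exact: permE. Qed.

Let sigmaM g h : (sigma g * sigma h)%g = sigma (h * g)%g.
Proof. by apply/permP => i; rewrite permM !sigmaE (coset_lactM clKP). Qed.

Let Gamma_set : {set 'S_nK} := [set x | `[< exists2 h, h \in H & x = sigma h >]]%SET.

Let Gamma_group_set : group_set Gamma_set.
Proof.
apply/group_setP; split.
  rewrite inE; apply/asboolP; exists 1%g; first exact: gpred1.
  by apply/permP => i; rewrite perm1 sigmaE (coset_lact1 clKP).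
move=> x y; rewrite !inE => /asboolP[h hH ->] /asboolP[k kH ->].
apply/asboolP; exists (k * h)%g; first exact: gpredM.
exact: sigmaM.
Qed.

Let Gamma : {group 'S_nK} := Group Gamma_group_set.

Let Gamma_mem h : h \in H -> sigma h \in Gamma.
Proof. by move=> hH; rewrite inE; apply/asboolP; exists h. Qed.

(* The projection of [G / K] onto [G / H]. *)
Let pr (i : 'I_nK) : 'I_nH := clH (repK i).

Let pr_cl x : pr (clK x) = clH x.
Proof.
apply/(clE clHP); apply: KH; apply/(clE clKP); exact: (cl_rep clKP).
Qed.

Let pr_act i g : pr (actK i g) = actH (pr i) g.
Proof. by rewrite /coset_act pr_cl -(coset_act_cl H_normal clHP). Qed.

Let fiber j := [set i | pr i == j]%SET.

Let pr_lact g i : pr (lact g i) = coset_lact clH repH g (pr i).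
Proof. by rewrite /coset_lact pr_cl -(coset_lact_cl clHP). Qed.

Let card_fiber j : #|fiber j| = #|fiber (clH 1%g)|.
Proof.
have clj : clH (repH j) = j by exact: (cl_rep clHP).
have <- : [set lact (repH j) i | i in fiber (clH 1%g)]%SET = fiber j.
  apply/finset.setP => i; rewrite inE; apply/imsetP/eqP => [[k + ->]|ij].
    by rewrite inE => /eqP pk; rewrite pr_lact pk (coset_lact_cl clHP) mulg1.
  exists (lact (repH j)^-1%g i).
    by rewrite inE pr_lact ij -{2}clj (coset_lact_cl clHP) mulVg.
  by rewrite -{1}[repH j]invgK lactK.
by rewrite card_imset//; exact: can_inj (lactK _).
Qed.

Let card_Gamma : #|Gamma| = #|fiber (clH 1%g)|.
Proof.
have <- : [set x (clK 1%g) | x : 'S_nK in Gamma]%SET = fiber (clH 1%g).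
  apply/finset.setP => i; rewrite [RHS]inE; apply/imsetP/eqP => [[x]|].
    rewrite inE => /asboolP[h hH ->] ->.
    rewrite sigmaE pr_lact pr_cl (coset_lact_cl clHP) mulg1.
    by apply/(clE clHP); rewrite mulg1 gpredV.
  move=> /esym/(clE clHP); rewrite invg1 mul1g => rH.
  exists (sigma (repK i)); first exact: Gamma_mem.
  by rewrite sigmaE (coset_lact_cl clKP) mulg1 (cl_rep clKP).
rewrite card_in_imset// => x y; rewrite !inE => /asboolP[h _ ->] /asboolP[k _ ->].
rewrite !sigmaE !(coset_lact_cl clKP) !mulg1 => hk.
apply/permP => i; rewrite !sigmaE /coset_lact.
exact: (cl_mulr K_normal clKP).
Qed.

Let index_mul : (#|Gamma| * nH = nK)%N.
Proof.
rewrite -[RHS]card_ord -[RHS]sum1_card (partition_big pr xpredT)//=.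
rewrite (eq_bigr (fun=> #|Gamma|)); first by rewrite sum_nat_const card_ord mulnC.
move=> j _; rewrite card_Gamma -(card_fiber j) -sum1_card.
by apply: eq_bigl => i; rewrite inE.
Qed.

Lemma coset_index_le : (nH <= nK)%N.
Proof.
have inj : injective (fun j => clK (repH j)).
  by move=> j j' /(congr1 pr); rewrite !pr_cl !(cl_rep clHP).
by have := leq_card _ inj; rewrite !card_ord.
Qed.

Variables (p a : nat).
Hypothesis p_prime : prime p.
Hypothesis nKp : nK = (p ^ a)%N.

Let solK := lker (linfun (ring_act actK (fox_matrix s rel) : 'M['F_p]_(d, nK) -> _)).
Let solH := lker (linfun (ring_act actH (fox_matrix s rel) : 'M['F_p]_(d, nH) -> _)).

Let solP (n : nat) (act : 'I_n -> G -> 'I_n) (act1 : forall i, act i 1%g = i)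
  (actM : forall i g h, act i (g * h)%g = act (act i g) h)
  (f : 'M['F_p]_(d, n)) :
  (f \in lker (linfun (ring_act act (fox_matrix s rel)))) <->
  (forall r, r \in rel -> forall i, fox_value act s f r.1 i = fox_value act s f r.2 i).
Proof.
rewrite memv_ker lfunE /=; rewrite -(ring_act_fox_matrix_eq0 act1 actM).
by split=> /eqP.
Qed.

Let act1K := coset_act1 clKP.
Let actMK := coset_actM K_normal clKP.
Let act1H := coset_act1 clHP.
Let actMH := coset_actM H_normal clHP.

Let solKP f := solP act1K actMK f.
Let solHP f := solP act1H actMH f.

Let fox_lact (f : 'M['F_p]_(d, nK)) h w i : fox_value actK s (col_perm (sigma h) f) w i =
  fox_value actK s f w (lact h i).
Proof.
elim: w i => [|t w IH] i //=.
by rewrite mxE sigmaE IH (coset_lact_act K_normal clKP).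
Qed.

Let pull (g : 'M['F_p]_(d, nH)) : 'M['F_p]_(d, nK) := colsub pr g.

Let fox_pull g w i : fox_value actK s (pull g) w i = fox_value actH s g w (pr i).
Proof. by elim: w i => [|t w IH] i //=; rewrite mxE IH pr_act. Qed.

Let pull_linear : linear pull.
Proof. by move=> c f g; apply/matrixP => i j; rewrite !mxE. Qed.
HB.instance Definition _ := GRing.isLinear.Build 'F_p _ _ _ pull pull_linear.

Let pr_rep j : pr (clK (repH j)) = j.
Proof. by rewrite pr_cl (cl_rep clHP). Qed.

Let dim_sol_le : (\dim solK <= #|Gamma| * \dim solH)%N.
Proof.
have Gamma_p : p.-group Gamma.
  have : p.-nat (#|Gamma| * nH)%N by rewrite index_mul nKp pnatX pnat_id.
  by rewrite pnatM => /andP[].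
apply: (@leq_trans (#|Gamma| * \dim (linfun pull @: solH)%VS)); last first.
  by rewrite leq_mul2l -(limg_ker_dim (linfun pull) solH) leq_addl orbT.
apply: (pgroup_dim_le p_prime Gamma_p).
- move=> x f; rewrite inE => /asboolP[h hH ->] /solKP fs; apply/solKP => r rr i.
  by rewrite !fox_lact fs.
- move=> f /solKP fs fixf; pose g : 'M['F_p]_(d, nH) := \matrix_(t, j) f t (clK (repH j)).
  have fE t i : f t i = g t (pr i).
    rewrite mxE; set k := clK _; pose h := (repK k * (repK i)^-1)%g.
    have hH : h \in H.
      have : ((repK i)^-1 * repK k)%g \in H by apply/(clE clHP); rewrite -/(pr k) pr_rep.
      by move=> /(H_normal (repK i)^-1%g); rewrite /conjg invgK mulgA mulVKg.
    have -> : k = lact h i by rewrite /coset_lact /h mulgVK (cl_rep clKP).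
    by rewrite -[in LHS](fixf _ (Gamma_mem hH)) mxE sigmaE.
  have fpull : f = pull g by apply/matrixP => t i; rewrite fE [RHS]mxE.
  apply/memv_imgP; exists g; last by rewrite lfunE.
  apply/solHP => r rr j; rewrite -(pr_rep j) -!fox_pull -fpull; exact: fs.
Qed.

(** The solutions over [G / H] are the invariants of [H / K], acting by left
    translations on the solutions over [G / K]; this is a [p]-group of order
    [nK / nH]. *)
Lemma fox_solution_monotone :
  (nH * (d * nK - \rank (rmx actK 'F_p (fox_matrix s rel))) <=
   nK * (d * nH - \rank (rmx actH 'F_p (fox_matrix s rel))))%N.
Proof.
have := dim_sol_le; rewrite /solK /solH !dim_lker_lin_mx//= => h.
by have := leq_mul (leqnn nH) h; rewrite [X in (_ <= X)%N -> _]mulnA (mulnC nH #|Gamma|) index_mul.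
Qed.

End Monotone.

(** * Betti numbers of finite index subgroups *)

Section FiniteDimension.
Variables (p : nat) (p_prime : prime p).

(** A complement of the space [U] of linear relations between the spanning vectors
    provides the coordinates. *)
Lemma spanned_coordinates (V : lmodType 'F_p) N (e : 'I_N -> V) :
  (forall v, exists x : 'rV['F_p]_N, v = \sum_j x 0 j *: e j) ->
  exists r (h : {linear 'rV['F_p]_r -> V}), bijective h.
Proof.
move=> espan; pose g (x : 'rV['F_p]_N) := \sum_j x 0 j *: e j.
have gL : linear g.
  move=> a x y; rewrite /g scaler_sumr -big_split; apply: eq_bigr => j _.
  by rewrite !mxE scalerDl scalerA.
pose gl : {linear 'rV['F_p]_N -> V} := HB.pack g (GRing.isLinear.Build _ _ _ _ g gL).
pose l := [seq x <- enum 'rV['F_p]_N | gl x == 0].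
pose U : {vspace 'rV['F_p]_N} := <<in_tuple l>>%VS.
have UP x : (x \in U) = (gl x == 0).
  apply/idP/idP => [|gx]; last by apply: memv_span; rewrite mem_filter gx mem_enum.
  move=> xU; rewrite (coord_span xU) linear_sum big1// => i _; rewrite linearZ_LR.
  have : (in_tuple l)`_i \in l by apply: mem_nth; exact: ltn_ord.
  by rewrite mem_filter => /andP[/eqP gi _]; rewrite [gl _]gi; exact: scaler0.
pose W := (U^C)%VS; pose r := \dim W.
pose h0 (y : 'rV['F_p]_r) : V := gl (\sum_i y 0 i *: (vbasis W)`_i).
have h0L : linear h0.
  move=> a x y; rewrite /h0 -linearP; congr (gl _).
  rewrite scaler_sumr -big_split; apply: eq_bigr => j _.
  by rewrite !mxE scalerDl scalerA.
pose h : {linear 'rV['F_p]_r -> V} := HB.pack h0 (GRing.isLinear.Build _ _ _ _ h0 h0L).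
exists r, h; change (bijective h0).
have freeW : free (vbasis W) := basis_free (vbasisP W).
have sumW (y : 'rV['F_p]_r) : \sum_i y 0 i *: (vbasis W)`_i \in W.
  by apply: rpred_sum => i _; rewrite rpredZ// vbasis_mem// mem_nth// size_tuple.
have coordP v : exists y, h0 y = v.
  have [x ->] := espan v; rewrite -/(g x).
  have : x \in (U + W)%VS by rewrite addv_complf memvf.
  move=> /memv_addP[u uU [w wW xuw]].
  exists (\row_i coord (vbasis W) i w).
  have -> : g x = gl w.
    by rewrite -[g x]/(gl x) xuw linearD; move: uU; rewrite UP => /eqP ->; rewrite add0r.
  rewrite /h0 {2}(coord_vbasis wW); congr (gl _).
  by apply: eq_bigr => i _; rewrite mxE.
have inj : injective h0.
  move=> x y xy; apply/eqP; rewrite -subr_eq0.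
  have : h0 (x - y) = 0 by rewrite -[x - y]addr0 -scaleN1r addr0 addrC h0L scaleN1r xy addNr.
  set z := x - y => hz.
  have zU : \sum_i z 0 i *: (vbasis W)`_i \in U by rewrite UP; apply/eqP.
  have : \sum_i z 0 i *: (vbasis W)`_i \in (U :&: W)%VS by rewrite memv_cap zU sumW.
  rewrite capv_compl memv0 => /eqP z0.
  apply/eqP/rowP => i; rewrite [RHS]mxE.
  exact: (freeP freeW (fun i => z 0 i) z0 i).
have /choice[k kP] := coordP.
by exists k => x; [apply: inj; rewrite kP|rewrite kP].
Qed.

Lemma dimension_unique (V : lmodType 'F_p) r (h : {linear 'rV['F_p]_r -> V}) :
  bijective h -> dimension V = r.
Proof.
move=> [k hk kh]; rewrite /dimension.
have ex : [set n | exists f : {linear 'rV['F_p]_n -> V}, bijective f] r.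
  by exists h; exists k.
case: xgetP => [m _ [f [f' ff' f'f]]|/(_ r)//].
apply: (@expnI p); first exact: prime_gt1.
have : (#|{: 'rV['F_p]_m}| = #|{: 'rV['F_p]_r}|)%N.
  apply: (@bij_eq_card _ _ (k \o f)); exists (f' \o h) => x /=.
    by rewrite kh ff'.
  by rewrite f'f hk.
by rewrite !card_mx !mul1n card_Fp.
Qed.

End FiniteDimension.

Section BettiFormula.
Variables (p : nat) (p_prime : prime p).
Local Notation F := 'F_p.
Variables (G : groupType) (K : groupClosed G) (K_normal : normal_subgroup K).
Variables (n : nat) (cl : G -> 'I_n) (rep : 'I_n -> G) (clP : coset_map K cl rep).
Variables (d : nat) (s : 'I_d -> G).
Hypothesis gens : forall x, exists w, wprod s w = x.
Local Notation T := (subgroup_type K).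
Local Notation act := (coset_act cl rep).
Local Notation tau := (fun _ : T => 1 : F).

Let cyc (c : free_module F T) : is_cycle1 tau c.
Proof.
apply/eqP; rewrite /bar_d1 linear_ext_sum big1// => x _.
by rewrite subrr scaler0.
Qed.

Let cls (c : free_module F T) : H1 tau := class1 (Cycle1 (cyc c)).

Let clsE (z : cycle1 tau) : class1 z = cls (val z).
Proof. by rewrite /cls; congr class1; exact/val_inj. Qed.

Let clsD c c' : cls (c + c') = cls c + cls c'.
Proof. by rewrite /cls -qpiD; congr class1; exact/val_inj. Qed.

Let clsZ a c : cls (a *: c) = a *: cls c.
Proof. by rewrite /cls -qpiZ; congr class1; exact/val_inj. Qed.

Let cls_eq c c' : cls c = cls c' <-> boundary tau (c - c').
Proof.
rewrite /cls /class1 qpi_eq; split=> [/asboolP[e eP]|[e eP]].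
  by exists e.
by apply/asboolP; exists e.
Qed.

Let kcls (k : T) : H1 tau := cls (basis_vect k).

Let kclsM k k' : kcls (k * k')%g = kcls k + kcls k'.
Proof.
rewrite /kcls -clsD; apply/esym/cls_eq.
have := boundary_basis tau k k'; rewrite scale1r.
by rewrite addrAC (addrC (basis_vect k')).
Qed.

Let kcls1 : kcls 1%g = 0.
Proof. by apply: (addrI (kcls 1%g)); rewrite -kclsM mulg1 addr0. Qed.

Let cls_sum c : cls c = \sum_(x <- fset_set [set x | c x != 0]) (c x : F) *: kcls x.
Proof.
rewrite -{1}(linear_ext_id c) linear_ext_sum.
rewrite (big_morph cls clsD (id1 := 0)); first by apply: eq_bigr => x _; rewrite clsZ.
by apply: (addrI (cls 0)); rewrite -clsD !addr0.
Qed.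

Let kpart_subproof (x : G) : (x * (rep (cl x))^-1)%g \in K.
Proof.
have : ((rep (cl x))^-1 * x)%g \in K by apply/(clE clP); exact: (cl_rep clP).
move=> /(K_normal (rep (cl x))^-1%g).
by rewrite /conjg invgK mulgA mulVKg.
Qed.

(* The [K]-component of [x] with respect to the transversal [rep]. *)
Let kpart (x : G) : T := exist _ (x * (rep (cl x))^-1)%g (kpart_subproof x).

Let kpart_mul x t : kpart (x * s t)%g = (kpart x * kpart (rep (cl x) * s t))%g.
Proof.
apply/val_inj; rewrite /= -(coset_act_cl K_normal clP) -/(coset_act _ _ _ _).
by rewrite -!mulgA mulKg.
Qed.

Let kpart_rep i : kpart (rep i) = 1%g.
Proof. by apply/val_inj; rewrite /= (cl_rep clP) mulgV. Qed.

(* The classes of the Schreier generators of [K]. *)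
Let schreier (t : 'I_d) (i : 'I_n) : H1 tau := kcls (kpart (rep i * s t)%g).

Let cl_k (k : T) : cl (val k) = cl 1%g.
Proof. by apply/eqP; rewrite (cl1_mem clP); exact: valP. Qed.

Let kpart_k (k : T) : kpart (val k) = (k * kpart 1%g)%g.
Proof. by apply/val_inj; rewrite /= cl_k mul1g. Qed.

Let kcls_word w : exists x : 'M[F]_(d, n),
  kcls (kpart (wprod s w)) - kcls (kpart 1%g) = \sum_t \sum_i x t i *: schreier t i.
Proof.
elim/last_ind: w => [|w t [x IH]].
  exists 0; rewrite subrr big1// => t _; rewrite big1// => i _.
  by rewrite mxE scale0r.
exists (x + delta_mx t (cl (wprod s w))).
rewrite -cats1 wprod_cat /= mulg1 kpart_mul kclsM addrAC IH.
have -> : kcls (kpart (rep (cl (wprod s w)) * s t)%g) =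
    \sum_t' \sum_i (delta_mx t (cl (wprod s w)) : 'M[F]_(d, n)) t' i *: schreier t' i.
  rewrite (bigD1 t)//= (bigD1 (cl (wprod s w)))//= mxE !eqxx scale1r.
  rewrite big1 ?addr0; last by move=> i ic; rewrite mxE (negbTE ic) andbF scale0r.
  rewrite big1 ?addr0// => t' tt; rewrite big1// => i _.
  by rewrite mxE (negbTE tt) scale0r.
rewrite -big_split; apply: eq_bigr => t' _; rewrite -big_split; apply: eq_bigr => i _.
by rewrite [in RHS]mxE scalerDl.
Qed.

Let schreier_span v : exists x : 'rV[F]_(d * n), v =
  \sum_j x 0 j *: (let: (t, i) := enum_val (cast_ord (esym (mxvec_cast d n)) j) in schreier t i).
Proof.
pose e j := let: (t, i) := enum_val (cast_ord (esym (mxvec_cast d n)) j) in schreier t i.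
have eE t i : e (mxvec_index t i) = schreier t i.
  by rewrite /e /mxvec_index cast_ordK enum_rankK.
pose P (u : H1 tau) := exists x : 'rV[F]_(d * n), u = \sum_j x 0 j *: e j.
have P0 : P 0 by exists 0; rewrite big1// => j _; rewrite mxE scale0r.
have PD u u' : P u -> P u' -> P (u + u').
  move=> [x ->] [x' ->]; exists (x + x'); rewrite -big_split.
  by apply: eq_bigr => j _; rewrite mxE scalerDl.
have PZ a u : P u -> P (a *: u).
  move=> [x ->]; exists (a *: x); rewrite scaler_sumr.
  by apply: eq_bigr => j _; rewrite mxE scalerA.
have Pk k : P (kcls k).
  have [w wk] := gens (val k); have [x xP] := kcls_word w.
  move: xP; rewrite wk kpart_k kclsM addrK => ->.
  exists (mxvec x).
  rewrite (reindex (uncurry (@mxvec_index d n))) /=; last exact: curry_mxvec_bij.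
  rewrite pair_bigA /=; apply: eq_bigr => -[t i] _ /=.
  by rewrite mxvecE eE.
have [z ->] := @qpi_surj _ _ (boundaries1 tau) v.
rewrite -[qpi _ _]/(class1 z) clsE cls_sum.
elim: (fset_set _ : seq _) => [|k l IH]; rewrite ?big_nil ?big_cons//.
by apply: PD => //; exact: PZ.
Qed.

Lemma betti_coordinates : exists (h : {linear 'rV[F]_(b1 T F) -> H1 tau}), bijective h.
Proof.
have [r [h hb]] := spanned_coordinates schreier_span.
by rewrite /b1 (dimension_unique p_prime hb); exists h.
Qed.


Section Derivations.
Variables (r : nat) (h : {linear 'rV[F]_r -> H1 tau}) (hinv : H1 tau -> 'rV[F]_r).
Hypotheses (hK : cancel h hinv) (hinvK : cancel hinv h).
Hypothesis n_gt0 : (0 < n)%N.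

Let hinvD u v : hinv (u + v) = hinv u + hinv v.
Proof. by apply: (can_inj hK); rewrite linearD !hinvK. Qed.

Let hinv0 : hinv 0 = 0.
Proof. by apply: (can_inj hK); rewrite linear0 hinvK. Qed.

Let hinvZ a v : hinv (a *: v) = a *: hinv v.
Proof. by apply: (can_inj hK); rewrite linearZ !hinvK. Qed.

Let mxD (A B : 'M[F]_1) : (A + B) 0 0 = A 0 0 + B 0 0. Proof. by rewrite mxE. Qed.
Let mx00 : (0 : 'M[F]_1) 0 0 = 0. Proof. by rewrite mxE. Qed.

(* A function [b] on [G] with [b (k x) = chi k + b x] for [k] in [K], given by the
   homomorphism [chi] on [K] and by its values on the transversal. *)
Let potential (x : 'rV[F]_(r + n)) (g : G) : F :=
  (lsubmx x *m (hinv (kcls (kpart g)))^T) 0 0 + rsubmx x 0 (cl g).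

(* The derivation with values in the functions on [G / K] whose value at [g] is the
   function [x |-> b (x g) - b x]. *)
Let derivation (x : 'rV[F]_(r + n)) : 'M[F]_(d, n) :=
  \matrix_(t, i) (potential x (rep i * s t)%g - potential x (rep i)).

Let derivation_linear : linear derivation.
Proof.
move=> a x y; apply/matrixP => t i; rewrite !mxE.
rewrite /potential !linearP /= !mulmxDl -!scalemxAl !mxE; ring.
Qed.
HB.instance Definition _ :=
  GRing.isLinear.Build F 'rV[F]_(r + n) 'M[F]_(d, n) _ derivation derivation_linear.

Let potential_mul x g t :
  potential x (g * s t)%g - potential x g =
  potential x (rep (cl g) * s t)%g - potential x (rep (cl g)).
Proof.
rewrite /potential kpart_mul kclsM hinvD kpart_rep kcls1 hinv0 !linearD /=.
rewrite trmx0 mulmx0 (cl_rep clP) -(coset_act_cl K_normal clP) -/(act (cl g) (s t)).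
rewrite mxD mx00; ring.
Qed.

Let fox_derivation x w g : fox_value act s (derivation x) w (cl g) =
  potential x (g * wprod s w)%g - potential x g.
Proof.
elim: w g => [|t w IH] g /=; first by rewrite mulg1 subrr.
by rewrite (coset_act_cl K_normal clP) IH mxE -potential_mul mulgA addrC subrKA.
Qed.

Let derivation_solves x w w' i : wprod s w = wprod s w' ->
  fox_value act s (derivation x) w i = fox_value act s (derivation x) w' i.
Proof. by move=> ww; rewrite -(cl_rep clP i) !fox_derivation ww. Qed.

(* The function [b] is recovered from a derivation [D] as [b g = D g 1]. *)
Let derivation_surj (f : 'M[F]_(d, n)) :
  (forall w w', wprod s w = wprod s w' ->
     forall i, fox_value act s f w i = fox_value act s f w' i) ->
  exists x, derivation x = f.
Proof.
move=> fP; pose D g i := fox_value act s f (word_of gens g) i.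
have DE w i : D (wprod s w) i = fox_value act s f w i.
  by apply: fP; rewrite word_ofK.
have cat_value w w' i : fox_value act s f (w ++ w') i =
    fox_value act s f w i + fox_value act s f w' (act i (wprod s w)).
  elim: w i => [|t w IH] i /=; first by rewrite add0r (coset_act1 clP).
  by rewrite IH addrA (coset_actM K_normal clP).
have DM g g' i : D (g * g')%g i = D g i + D g' (act i g).
  by rewrite -{1}(word_ofK gens g) -{1}(word_ofK gens g') -wprod_cat DE cat_value word_ofK.
pose b g := D g (cl 1%g).
have bM (k : T) g : b (val k * g)%g = b (val k) + b g.
  by rewrite /b DM (coset_act_cl K_normal clP) mul1g cl_k.
pose L (c : free_module F T) : F := linear_ext (fun k : T => b (val k) : F^o) c.
have LD c c' : L (c + c') = L c + L c' by rewrite /L linearD.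
have LZ a c : L (a *: c) = a * L c by rewrite /L linearZ.
have Lb k : L (basis_vect k) = b (val k) by rewrite /L linear_ext_basis.
have L0 : L 0 = 0 by rewrite -(scale0r (0 : free_module F T)) LZ mul0r.
have LN c : L (- c) = - L c by rewrite -scaleN1r LZ mulN1r.
have LB c : boundary tau c -> L c = 0.
  move=> [e <-]; rewrite /bar_d2 linear_ext_sum (big_morph L LD L0) big1// => -[g g'] _.
  have gg : b (val (g * g')%g) = b (val g) + b (val g') by exact: bM.
  rewrite LZ !LD LN LZ !Lb mul1r gg /= opprD (addrC (- b (val g))) addrA subrr.
  by rewrite sub0r addNr mulr0.
have Lcls c c' : cls c = cls c' -> L c = L c'.
  by move=> /cls_eq/LB; rewrite LD LN => /eqP; rewrite subr_eq0 => /eqP.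
have /choice[z zP] (j : 'I_r) : exists z, h (delta_mx 0 j) = cls z.
  have [z zh] := @qpi_surj _ _ (boundaries1 tau) (h (delta_mx 0 j)).
  by exists (val z); rewrite -clsE zh.
pose alpha : 'rV[F]_r := \row_j L (z j).
have alphaP (k : T) : (alpha *m (hinv (kcls k))^T) 0 0 = b (val k).
  set y := hinv (kcls k).
  have yk : cls (\sum_j y 0 j *: z j) = cls (basis_vect k).
    rewrite (big_morph cls clsD (id1 := 0)); last first.
      by apply: (addrI (cls 0)); rewrite -clsD !addr0.
    rewrite -[RHS](hinvK (kcls k)) -/y [in RHS](row_sum_delta y) linear_sum.
    by apply: eq_bigr => j _; rewrite clsZ -zP linearZ.
  have := Lcls _ _ yk; rewrite Lb => <-.
  rewrite (big_morph L LD L0) mxE; apply: eq_bigr => j _.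
  by rewrite LZ !mxE mulrC.
exists (row_mx alpha (\row_i b (rep i))); apply/matrixP => t i; rewrite mxE /potential.
rewrite row_mxKl row_mxKr !alphaP !mxE kpart_rep.
have b1 : b 1%g = 0.
  by apply: (addrI (b 1%g)); have := bM 1%g 1%g; rewrite mulg1 addr0 => <-.
rewrite (cl_rep clP) [b (val (1%g : T))]b1 add0r -bM /= mulgVK.
rewrite /b DM (coset_act_cl K_normal clP) mul1g (cl_rep clP) addrC addKr.
by have := DE [:: t] i; rewrite /= mulg1 addr0.
Qed.

(* Only the constant functions [b] give the zero derivation. *)
Let derivation_ker x : derivation x = 0 ->
  x = row_mx 0 (const_mx (rsubmx x 0 (cl 1%g))).
Proof.
move=> x0.
have bc g : potential x g = potential x 1%g.
  have [w <-] := gens g; have := fox_derivation x w 1%g.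
  rewrite x0 mul1g => e; apply/eqP; rewrite -subr_eq0 -e; apply/eqP.
  by elim: w (cl 1%g) {e} => [|t w IH] i //=; rewrite mxE IH addr0.
have brep i : rsubmx x 0 i = potential x 1%g.
  rewrite -(bc (rep i)) /potential kpart_rep kcls1 hinv0 trmx0 mulmx0 mx00 add0r.
  by rewrite (cl_rep clP).
have ak k : (lsubmx x *m (hinv (kcls k))^T) 0 0 = 0.
  have e : potential x (val k) = potential x 1%g by exact: bc.
  have e1 : potential x (rep (cl 1%g)) = potential x 1%g by exact: bc.
  move: e; rewrite {1}/potential kpart_k kclsM hinvD linearD /= mulmxDr mxD cl_k.
  by rewrite -addrA -/(potential x 1%g) => /eqP; rewrite -subr_eq0 addrK => /eqP.
have al0 : lsubmx x = 0.
  apply/rowP => j; rewrite [RHS]mxE.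
  have [z zh] := @qpi_surj _ _ (boundaries1 tau) (h (delta_mx 0 j)).
  have hz : h (delta_mx 0 j) = cls (val z) by rewrite -clsE zh.
  have -> : lsubmx x 0 j = (lsubmx x *m (hinv (h (delta_mx 0 j)))^T) 0 0.
    by rewrite hK trmx_delta -colE [RHS]mxE.
  rewrite hz cls_sum.
  elim: (fset_set _ : seq _) => [|k l IH].
    by rewrite big_nil hinv0 trmx0 mulmx0 mx00.
  rewrite big_cons hinvD hinvZ linearD linearZ /= mulmxDr -scalemxAr mxD IH addr0.
  by rewrite mxE ak mulr0.
rewrite -{1}[x]hsubmxK al0; congr row_mx; apply/rowP => i.
by rewrite [RHS]mxE !brep.
Qed.

Let der_lin := linfun derivation.

Lemma dim_derivations : (\dim (limg der_lin) = r + n - 1)%N.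
Proof.
have : (\dim (lker der_lin) + \dim (limg der_lin) = r + n)%N.
  have := limg_ker_dim der_lin fullv; rewrite capfv dimvf => ->.
  by rewrite /dim /= mul1n.
suff ->: \dim (lker der_lin) = 1%N by move: (\dim (limg _)) => y; lia.
pose c : 'rV[F]_(r + n) := row_mx 0 (const_mx 1).
have -> : lker der_lin = <[c]>%VS.
  apply/vspaceP => x; rewrite memv_ker lfunE /=; apply/eqP/vlineP => [/derivation_ker e|[a ->]].
    exists (rsubmx x 0 (cl 1%g)); rewrite {1}e /c scale_row_mx scaler0; congr row_mx.
    by apply/rowP => i; rewrite !mxE mulr1.
  apply/matrixP => t i; rewrite !mxE /potential.
  rewrite /c scale_row_mx scaler0 row_mxKl row_mxKr !mul0mx !mx00 !mxE; ring.
rewrite dim_vline; case: eqP => // /(congr1 (fun y => rsubmx y 0 (cl 1%g))).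
by rewrite /c row_mxKr linear0 !mxE => /eqP; rewrite oner_eq0.
Qed.

(** When [R0] forces all relations, its solutions are the derivations, which the
    potentials parametrise up to constants. *)
Lemma derivations_solutions (R0 : seq (relation d)) :
  (forall w, w \in R0 -> valid s w) ->
  (forall f : 'M[F]_(d, n),
    (forall w, w \in R0 -> forall i, fox_value act s f w.1 i = fox_value act s f w.2 i) ->
    forall w, valid s w -> forall i, fox_value act s f w.1 i = fox_value act s f w.2 i) ->
  (d * n - \rank (rmx act F (fox_matrix s R0)) = r + n - 1)%N.
Proof.
move=> R0v R0P; rewrite -dim_derivations -dim_lker_lin_mx//=; congr (\dim _).
apply/vspaceP => f; rewrite memv_ker lfunE /=.
apply/eqP/memv_imgP => [/(ring_act_fox_matrix_eq0 (coset_act1 clP) (coset_actM K_normal clP)) fs|].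
  have [|x <-] := @derivation_surj f.
    by move=> w w' ww i; exact: (R0P f fs (w, w') ww i).
  by exists x; rewrite ?memvf// lfunE.
move=> [x _ ->]; rewrite lfunE /=.
apply/(ring_act_fox_matrix_eq0 (coset_act1 clP) (coset_actM K_normal clP)) => w wR i.
by apply: derivation_solves; exact: R0v.
Qed.

End Derivations.

(** The solutions of the Fox equations for all relations are the derivations of
    [G] with values in the functions on [G / K], that is, Shapiro's lemma turns
    them into homomorphisms on [K] and coboundaries. Finitely many relations
    suffice, because only finitely many tuples of functions have to be
    excluded. *)
Lemma betti_formula : (0 < n)%N -> exists R0 : seq (relation d),
  (forall w, w \in R0 -> valid s w) /\
  forall rel, {subset R0 <= rel} -> (forall w, w \in rel -> valid s w) ->
    (d * n - \rank (rmx act F (fox_matrix s rel)) = b1 T F + n - 1)%N.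
Proof.
move=> n0.
have /choice[bad badP] (f : 'M[F]_(d, n)) : exists w, valid s w /\
  ((exists w', valid s w' /\ exists i, fox_value act s f w'.1 i <> fox_value act s f w'.2 i) ->
   exists i, fox_value act s f w.1 i <> fox_value act s f w.2 i).
  have [[w' [wv wi]]|no] := pselect (exists w', valid s w' /\
      exists i, fox_value act s f w'.1 i <> fox_value act s f w'.2 i).
    by exists w'.
  by exists ([::], [::]).
exists [seq bad f | f <- enum 'M[F]_(d, n)]; split.
  by move=> _ /mapP[f _ ->]; exact: (badP f).1.
move=> rel sub relv; have [h [hinv hK hinvK]] := betti_coordinates.
apply: (derivations_solutions hK hinvK n0 relv) => f fs w wv i.
apply: contrapT => wi; have [|j] := (badP f).2; first by exists w; split => //; exists i.
by apply; apply: fs; apply: sub; apply/mapP; exists f; rewrite ?mem_enum.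
Qed.

End BettiFormula.

(** * Eigenvalues of integral positive semidefinite matrices *)

Section SpectralEstimate.
Import ComplexField.
Local Open Scope sesquilinear_scope.
Variable R : realType.
Local Notation C := R[i].

Lemma char_poly_conj (F : fieldType) n (P A : 'M[F]_n) : P \in unitmx ->
  char_poly (invmx P *m A *m P) = char_poly A.
Proof.
move=> Pu; rewrite /char_poly /char_poly_mx.
have PP : map_mx polyC (invmx P) *m map_mx polyC P = 1%:M.
  by rewrite -map_mxM mulVmx// map_mx1.
have -> : 'X%:M - map_mx polyC (invmx P *m A *m P) =
   map_mx polyC (invmx P) *m ('X%:M - map_mx polyC A) *m map_mx polyC P.
  rewrite mulmxBr mulmxBl !map_mxM; congr (_ - _).
  by rewrite scalar_mxC -mulmxA PP mulmx1.
rewrite !det_mulmx mulrAC -det_mulmx PP det1 mul1r //.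
Qed.

Lemma mxrank_diag_le (F : fieldType) n (v : 'rV[F]_n) :
  (\rank (diag_mx v) <= #|[pred j : 'I_n | (v 0 j != 0)%R]|)%N.
Proof.
have -> : diag_mx v = \sum_(j | v 0 j != 0) v 0 j *: delta_mx j j.
  apply/matrixP => i k; rewrite summxE !mxE.
  have [<-|ik] := eqVneq i k.
    rewrite mulr1n; have [vi|vi] := eqVneq (v 0 i) 0.
      rewrite vi big1// => j vj; rewrite !mxE.
      have [ij|] := eqVneq i j; last by rewrite mulr0.
      by rewrite -ij vi eqxx in vj.
    rewrite (bigD1 i)//= !mxE !eqxx mulr1 big1 ?addr0// => j /andP[_ ji].
    by rewrite !mxE eq_sym (negbTE ji) mulr0.
  rewrite mulr0n big1// => j _; rewrite !mxE.
  have [<-|] := eqVneq i j; last by rewrite mulr0.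
  by rewrite eq_sym (negbTE ik) mulr0.
rewrite -sum1_card; under [X in (_ <= X)%N]eq_bigl do rewrite inE.
apply: (big_ind2 (fun (A : 'M[F]_n) k => (\rank A <= k)%N)).
- by rewrite mxrank0.
- by move=> A a B b hA hB; apply: leq_trans (mxrank_add _ _) _; exact: leq_add.
- move=> j _; apply: leq_trans (mxrank_scale _ _) _.
  by rewrite mxrank_delta.
Qed.

Section Eigenvalues.
Variables (a b : nat) (W : 'M[int]_(b, a)) (K : nat).
Let D := W *m W^T.
Hypothesis K_gt1 : (1 < K)%N.
Hypothesis D_norm : forall q, \sum_p `|D p q| <= K%:Z.

Let Dc : 'M[C]_b := map_mx intr D.
Let Wc : 'M[C]_(b, a) := map_mx intr W.

Let Dc_normal : Dc \is normalmx.
Proof.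
apply/hermitian_normalmx/realsym_hermsym.
  apply/is_hermitianmxP; rewrite expr0 scale1r map_mx_id//.
  by rewrite /Dc map_trmx /D trmx_mul trmxK.
by apply/mxOverP => i j; rewrite mxE; exact: realz.
Qed.

Let P := spectralmx Dc.
Let sp := spectral_diag Dc.
Let DcE : Dc = invmx P *m diag_mx sp *m P.
Proof. exact/orthomx_spectralP. Qed.
Let Pu : P \in unitmx. Proof. exact: spectral_unit. Qed.

Let eigen j : row j P *m Dc = sp 0 j *: row j P.
Proof.
rewrite {1}DcE !mulmxA -row_mul mulmxV// row1 -rowE row_diag_mx.
by rewrite -scalemxAl -rowE.
Qed.

Let row_norm j : row j P *m (row j P)^t* = 1%:M.
Proof.
have /unitarymxP PP := spectral_unitarymx Dc.
apply/matrixP => i k; rewrite !ord1.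
have := congr1 (fun M : 'M[C]_b => M j j) PP; rewrite !mxE eqxx mulr1n => <-.
by apply: eq_bigr => l _; rewrite !mxE.
Qed.

Let norm_row_ge0 c (v : 'rV[C]_c) : 0 <= (v *m v^t*) 0 0.
Proof.
rewrite mxE; apply: sumr_ge0 => k _; rewrite !mxE.
exact: mul_conjC_ge0.
Qed.

Let sp_ge0 j : 0 <= sp 0 j.
Proof.
have := norm_row_ge0 (row j P *m Wc).
have -> : (row j P *m Wc)^t* = Wc^T *m (row j P)^t*.
  rewrite trmx_mul map_mxM; congr (_ *m _).
  by apply/matrixP => x y; rewrite !mxE; exact: rmorph_int.
rewrite mulmxA -[_ *m Wc *m _]mulmxA.
have -> : Wc *m Wc^T = Dc by rewrite /Dc /D map_mxM map_trmx.
by rewrite eigen -scalemxAl row_norm !mxE eqxx mulr1.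
Qed.

Let lam j : R := complex.Re (sp 0 j).

Let lamE j : sp 0 j = (lam j)%:C%C.
Proof.
have := sp_ge0 j; rewrite /lam; case: (sp 0 j) => x y.
by rewrite lecE /= => /andP[/eqP -> _].
Qed.

Let lam_ge0 j : 0 <= lam j.
Proof. by have := sp_ge0 j; rewrite lamE -[0]/(0%:C%C) lecR. Qed.

(* Evaluate the eigenvalue equation at an entry [q] of maximal modulus. *)
Let lam_le j : lam j <= K%:R.
Proof.
pose v := row j P.
have [q qmax] : exists q, forall p, `|v 0 p| <= `|v 0 q|.
  have b0 : (0 < b)%N by apply: leq_ltn_trans (ltn_ord j).
  pose i0 : 'I_b := Ordinal b0.
  pose nv p : R := ComplexField.Normc.normc (v 0 p).
  have [q _ qP] := @arg_maxP _ _ _ i0 xpredT nv isT.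
  by exists q => p; change ((nv p)%:C%C <= (nv q)%:C%C); rewrite lecR; exact: qP.
have vq : 0 < `|v 0 q|.
  rewrite lt_def normr_ge0 andbT; apply/negP => vq0.
  have v0 : v = 0.
    apply/rowP => p; rewrite [RHS]mxE.
    by have := qmax p; rewrite (eqP vq0) normr_le0 => /eqP.
  have := row_norm j; rewrite -/v v0 mul0mx => /matrixP/(_ 0 0).
  by rewrite !mxE eqxx => /esym/eqP; rewrite oner_eq0.
have : `|sp 0 j * v 0 q| <= K%:R * `|v 0 q|.
  have := eigen j => /matrixP/(_ 0 q); rewrite !mxE => <-.
  apply: le_trans (ler_norm_sum _ _ _) _.
  have -> : (K%:R : C) = (K%:Z)%:~R by [].
  apply: (@le_trans _ _ (\sum_p `|(D p q)%:~R : C| * `|v 0 q|)).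
    apply: ler_sum => p _; rewrite normrM mulrC [Dc p q]mxE.
    by rewrite ler_wpM2l// qmax.
  rewrite (_ : P j q = v 0 q); last by rewrite [RHS]mxE.
  rewrite -mulr_suml ler_wpM2r//.
  under eq_bigr do rewrite -intr_norm.
  by rewrite -rmorph_sum ler_int D_norm.
rewrite normrM ler_pM2r// ger0_norm// lamE.
by rewrite -(rmorph_nat (real_complex R)) lecR.
Qed.

Let trace_eq k : ((\tr ((K%:R%:M - D) ^+ k))%:~R : R) = \sum_j (K%:R - lam j) ^+ k.
Proof.
apply: (@complexI R); rewrite rmorph_int [RHS]rmorph_sum /=.
transitivity (\tr ((K%:R%:M - Dc) ^+ k)).
  rewrite -[LHS](trace_map_mx intr); congr (\tr _).
  elim: k => [|k IH]; first by rewrite !expr0 map_mx1.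
  rewrite !exprS -[_ * _]/(_ *m _) map_mxM IH; congr (_ *m _).
  by rewrite raddfB /= map_scalar_mx rmorph_nat.
have -> : K%:R%:M - Dc = invmx P *m diag_mx (const_mx K%:R - sp) *m P.
  rewrite raddfB /= diag_const_mx mulmxBr mulmxBl -DcE; congr (_ - _).
  by rewrite scalar_mxC -mulmxA mulVmx// mulmx1.
have -> : (invmx P *m diag_mx (const_mx K%:R - sp) *m P) ^+ k =
   invmx P *m diag_mx (\row_j (K%:R - sp 0 j) ^+ k) *m P.
  elim: k => [|k IH].
    rewrite expr0 (_ : \row_j _ = const_mx 1); last by apply/rowP => j; rewrite !mxE.
    by rewrite diag_const_mx mulmx1 mulVmx.
  rewrite exprS IH -[_ * _]/(_ *m _) -!mulmxA (mulKVmx Pu) !mulmxA; congr (_ *m _).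
  rewrite -mulmxA; congr (_ *m _); rewrite mulmx_diag; congr diag_mx.
  by apply/rowP => j; rewrite !mxE exprS.
rewrite -mulmxA mxtrace_mulC -mulmxA mulmxV// mulmx1 mxtrace_diag.
by apply: eq_bigr => j _; rewrite mxE lamE rmorphXn rmorphB rmorph_nat.
Qed.

Let zeros : #|[pred j : 'I_b | lam j == 0]| = (b - #|[pred j : 'I_b | (lam j != 0)%R]|)%N.
Proof.
have := cardC [pred j : 'I_b | lam j != 0]; rewrite card_ord => e.
rewrite -[X in (X - _)%N]e addKn.
by apply: eq_card => j; rewrite !inE negbK.
Qed.

(* Up to sign, the product is a coefficient of the characteristic polynomial,
   hence a nonzero integer. *)
Let prod_ge1 : 1 <= \prod_(j | lam j != 0) lam j.
Proof.
pose q : {poly C} := \prod_(j | lam j != 0) ('X - (sp 0 j)%:P).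
pose z := #|[pred j : 'I_b | lam j == 0]|.
have cp : char_poly Dc = 'X^z * q.
  rewrite DcE char_poly_conj// char_poly_trig ?diag_mx_is_trig//.
  rewrite (bigID (fun j => lam j == 0)) /=; congr (_ * _); last first.
    by apply: eq_bigr => j _; rewrite mxE eqxx mulr1n.
  rewrite (eq_bigr (fun=> 'X)) ?prodr_const//.
  by move=> j /eqP lj; rewrite mxE eqxx mulr1n lamE lj subr0.
have coef : (char_poly Dc)`_z = \prod_(j | lam j != 0) - sp 0 j.
  rewrite cp mulrC coefMXn ltnn subnn -horner_coef0 /q horner_prod.
  by apply: eq_bigr => j _; rewrite !hornerE.
have : `|(char_poly Dc)`_z| = (\prod_(j | lam j != 0) lam j)%:C%C.
  rewrite coef normr_prod rmorph_prod; apply: eq_bigr => j _.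
  by rewrite normrN ger0_norm// lamE.
have nz : (char_poly Dc)`_z != 0.
  rewrite coef; apply/prodf_neq0 => j lj; rewrite oppr_eq0 lamE.
  by rewrite -[0]/(0%:C%C) (inj_eq (@complexI R)).
have -> : (char_poly Dc)`_z = ((char_poly D)`_z)%:~R.
  by rewrite /Dc -map_char_poly coef_map.
rewrite -intr_norm => e; rewrite -lecR -e rmorph1 (_ : 1 = 1%:~R :> C)// ler_int.
rewrite -gtz0_ge1 normr_gt0.
by move: nz; rewrite /Dc -map_char_poly coef_map intr_eq0.
Qed.

(** All eigenvalues of [D] lie in [[0, K]] and the product of the nonzero ones is
    at least one, so that at most [b / s] of them lie in [(0, K^-s]]. These and
    the zero eigenvalues contribute at most one each to the trace of
    [(1 - D / K)^2k], the others at most [(1 - K^-(s+1))^2k]. *)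
Lemma spectral_estimate (r s k : nat) : (0 < s)%N ->
  (r <= \rank (map_mx intr D : 'M[C]_b))%N ->
  ((\tr ((K%:R%:M - D) ^+ (2 * k)))%:~R : R) / K%:R ^+ (2 * k) <=
  (b - r)%:R + b%:R / s%:R + b%:R * (1 - K%:R ^- s.+1) ^+ (2 * k).
Proof.
move=> s0 rD.
have K0 : 0 < (K%:R : R) by rewrite ltr0n ltnW.
have K1 : 1 <= (K%:R : R) by rewrite ler1n ltnW.
pose small := [pred j : 'I_b | (lam j != 0) && (lam j <= K%:R ^- s)].
have small_le : (#|small| * s <= b)%N.
  have : 1 <= K%:R ^- (#|small| * s) * (K%:R : R) ^+ b.
    apply: (le_trans prod_ge1).
    apply: (@le_trans _ _ (\prod_(j | lam j != 0)
        ((if j \in small then (K%:R : R) ^- s else 1) * K%:R))).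
      apply: ler_prod => j lj; rewrite lam_ge0 /=.
      case: ifP; last by rewrite mul1r.
      rewrite inE lj /= => h; apply: le_trans h _.
      by rewrite ler_peMr// invr_ge0 exprn_ge0// ltW.
    rewrite big_split /=; apply: ler_pM.
    - by apply: prodr_ge0 => j _; case: ifP; rewrite ?ler01// invr_ge0 exprn_ge0// ltW.
    - by apply: prodr_ge0 => j _; exact: ltW.
    - rewrite -big_mkcondr /= prodr_const -exprVn -exprVn mulnC -exprM.
      rewrite (_ : #|_| = #|small|)//; apply: eq_card => j; rewrite !inE.
      by rewrite unfold_in inE; case: (lam j != 0).
    - rewrite prodr_const ler_weXn2l//.
      by rewrite (leq_trans (max_card _))// card_ord.
  rewrite mulrC ler_pdivlMr ?exprn_gt0// mul1r.
  by rewrite -!natrX ler_nat leq_exp2l.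
rewrite trace_eq mulr_suml.
have term_le j : (K%:R - lam j) ^+ (2 * k) / K%:R ^+ (2 * k) <=
   (lam j == 0)%:R + (j \in small)%:R + (1 - K%:R ^- s.+1) ^+ (2 * k).
  have -> : (K%:R - lam j) ^+ (2 * k) / K%:R ^+ (2 * k) = (1 - lam j / K%:R) ^+ (2 * k).
    by rewrite -expr_div_n mulrBl divff// lt0r_neq0.
  have l1 : lam j / K%:R <= 1 by rewrite ler_pdivrMr// mul1r.
  have l0 : 0 <= lam j / K%:R by rewrite divr_ge0// ltW.
  have t0 : 0 <= (1 - (K%:R : R) ^- s.+1) ^+ (2 * k).
    by rewrite exprn_ge0// subr_ge0 invf_le1 ?exprn_gt0// exprn_ege1.
  have t1 : (1 - lam j / K%:R) ^+ (2 * k) <= 1.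
    by rewrite exprn_ile1// ?subr_ge0// gerBl.
  have [lj|lj] := eqVneq (lam j) 0.
    by apply: le_trans t1 _; rewrite -addrA lerDl addr_ge0.
  rewrite add0r inE lj andTb; case: (leP (lam j) (K%:R ^- s)) => h.
    by apply: le_trans t1 _; rewrite lerDl.
  rewrite add0r lerXn2r ?nnegrE ?subr_ge0//.
    by rewrite invf_le1 ?exprn_gt0// exprn_ege1.
  rewrite lerD2l lerN2 exprSr invfM ler_wpM2r ?invr_ge0 ?ltW//.
apply: le_trans (ler_sum _ (fun j _ => term_le j)) _.
rewrite !big_split /= sumr_const card_ord -[X in _ + _ + X <= _]mulr_natl.
have cardE (Q : pred 'I_b) : (\sum_i Q i)%N = #|Q|.
  by rewrite -sum1_card [RHS]big_mkcond; apply: eq_bigr => i _; rewrite unfold_in; case: (Q i).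
rewrite lerD2r lerD//.
  rewrite -natr_sum ler_nat (cardE (fun j => lam j == 0)) zeros leq_sub2l//.
  apply: leq_trans rD _; rewrite -/Dc DcE.
  apply: leq_trans (mxrankM_maxl _ _) _; apply: leq_trans (mxrankM_maxr _ _) _.
  apply: leq_trans (mxrank_diag_le _) _; apply: subset_leq_card.
  apply/fintype.subsetP => j; rewrite !inE lamE -[0]/(0%:C%C) (inj_eq (@complexI R)) //.
by rewrite ler_pdivlMr ?ltr0n// -natr_sum -natrM ler_nat (cardE (mem small)).
Qed.

End Eigenvalues.
End SpectralEstimate.

(** * Chains of normal subgroups *)

Section Chain.
Variables (R : realType) (p : nat) (p_prime : prime p) (G : groupType).
Variables (d : nat) (s : 'I_d -> G).
Hypothesis gens : forall x, exists w, wprod s w = x.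
Variable Gs : nat -> groupClosed G.
Hypothesis Gs_desc : forall i, {subset Gs i.+1 <= Gs i}.
Hypothesis Gs_normal : forall i, normal_subgroup (Gs i).
Hypothesis Gs_index : forall i, p_power_index p (Gs i).

Let idx i := subgroup_index (Gs i).

Let idx_gt0 i : (0 < idx i)%N.
Proof. by have [k] := Gs_index i; rewrite /idx => ->; rewrite expn_gt0 prime_gt0. Qed.

Let cl i : G -> 'I_(idx i) := projT1 (cid (coset_map_exists (idx_gt0 i))).
Let rep i : 'I_(idx i) -> G := projT1 (cid (projT2 (cid (coset_map_exists (idx_gt0 i))))).
Let clP i : coset_map (Gs i) (@cl i) (@rep i) :=
  projT2 (cid (projT2 (cid (coset_map_exists (idx_gt0 i))))).

Let act i : 'I_(idx i) -> G -> 'I_(idx i) := coset_act (@cl i) (@rep i).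
Let act1 i := coset_act1 (clP i) : forall j, act j 1%g = j.
Let actM i := coset_actM (@Gs_normal i) (clP i) :
  forall j g h, act j (g * h)%g = act (act j g) h.

Let Gs_sub i j : (i <= j)%N -> {subset Gs j <= Gs i}.
Proof.
move=> /subnKC <-; elim: (j - i)%N => [|k IH]; first by rewrite addn0.
by move=> x; rewrite addnS => /Gs_desc; exact: IH.
Qed.

Let idx_le i j : (i <= j)%N -> (idx i <= idx j)%N.
Proof. by move=> ij; exact: (coset_index_le (Gs_sub ij) (clP i) (clP j)). Qed.

(* The dimension over the prime field of the space of solutions of the Fox
   equations with values in the functions on [G / Gs i]. *)
Let vdim rel i := (d * idx i - \rank (rmx (@act i) 'F_p (fox_matrix s rel)))%N.

Let vdim_decr rel i j : (i <= j)%N ->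
  (vdim rel j)%:R / (idx j)%:R <= (vdim rel i)%:R / (idx i)%:R :> R.
Proof.
move=> ij; have [a ja] := Gs_index j.
have := fox_solution_monotone (Gs_sub ij) (@Gs_normal i) (@Gs_normal j) (clP i) (clP j)
  s rel p_prime ja.
rewrite -/(vdim rel i) -/(vdim rel j) => h.
rewrite ler_pdivrMr ?ltr0n// mulrAC ler_pdivlMr ?ltr0n//.
by rewrite -!natrM ler_nat mulnC [X in (_ <= X)%N]mulnC.
Qed.

Let betti_rel i : exists R0 : seq (relation d),
  (forall w, w \in R0 -> valid s w) /\
  forall rel, {subset R0 <= rel} -> (forall w, w \in rel -> valid s w) ->
    betti_ratio R p (Gs i) = (vdim rel i)%:R / (idx i)%:R - 1 + (idx i)%:R^-1.
Proof.
have [R0 [R0v R0P]] := betti_formula p_prime (@Gs_normal i) (clP i) gens (idx_gt0 i).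
exists R0; split=> // rel sub relv.
have e := R0P rel sub relv; rewrite -/(vdim rel i) in e.
have i0 : (idx i)%:R != 0 :> R by rewrite pnatr_eq0 -lt0n.
have {}e : (vdim rel i)%:R = (b1 (subgroup_type (Gs i)) 'F_p)%:R + (idx i)%:R - 1 :> R.
  by rewrite e natrB ?natrD// addn_gt0 idx_gt0 orbT.
by rewrite e /betti_ratio -/(idx i); field.
Qed.

(** By the formula for the Betti number, the ratio is [v / n - 1 + 1 / n], with
    both [v / n] and [1 / n] decreasing. *)
Lemma betti_ratio_nonincreasing : nonincreasing_seq (fun i => betti_ratio R p (Gs i)).
Proof.
apply/nonincreasing_seqP => i.
have [R0 [R0v R0P]] := betti_rel i; have [R1 [R1v R1P]] := betti_rel i.+1.
have relv w : w \in R0 ++ R1 -> valid s w.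
  by rewrite mem_cat => /orP[/R0v|/R1v].
rewrite (R0P (R0 ++ R1))//; last by move=> w wR; rewrite mem_cat wR.
rewrite (R1P (R0 ++ R1))//; last by move=> w wR; rewrite mem_cat wR orbT.
apply: lerD; first by rewrite lerD2r vdim_decr.
by rewrite lef_pV2 ?posrE ?ltr0n// ler_nat idx_le.
Qed.

Hypothesis Gs_cap : forall x, (forall i, x \in Gs i) -> x = 1%g.

Let separate (l : seq G) : exists j, forall i, (j <= i)%N ->
  forall g, g \in l -> g \in Gs i -> g = 1%g.
Proof.
elim: l => [|g l [j jP]]; first by exists 0%N.
have [->|g1] := eqVneq g 1%g.
  by exists j => i ji x; rewrite inE => /orP[/eqP ->//|]; exact: jP.
have [k gk] : exists k, g \notin Gs k.
  apply: contrapT => h; move/eqP: g1; apply; apply: Gs_cap => i.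
  by apply: contrapT => /negP gi; apply: h; exists i.
exists (maxn j k) => i; rewrite geq_max => /andP[ji ki] x; rewrite inE => /orP[/eqP ->|].
  by move=> /(Gs_sub ki) gk'; rewrite gk' in gk.
exact: jP.
Qed.

(* Deep enough in the chain, no nontrivial group element that occurs in [L] lies in
   the subgroup, so that only the terms at [1] contribute to the trace. *)
Let trace_limit (L : fmatrix G d d) : exists j, forall i, (j <= i)%N ->
  (\tr (rmx (@act i) int L))%:~R = (idx i)%:R * mtr (mev (@vN_of_group R G) L) :> R.
Proof.
have [j jP] := separate (flatten [seq [seq a.2 | a <- L t t] | t <- enum 'I_d]).
exists j => i ji; rewrite mxtrace_rmx mtr_mev rmorph_sum mulr_sumr.
apply: eq_bigr => t _; rewrite exchange_big rmorph_sum [in RHS]big_mkcond mulr_sumr.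
rewrite big_seq [RHS]big_seq.
apply: eq_bigr => a aL.
rewrite (eq_bigr (fun=> (a.2 == 1%g)%:R *~ a.1)); last first.
  move=> k _; congr ((nat_of_bool _)%:R *~ _).
  rewrite (coset_act_fix (clP i)); apply/idP/eqP => [ag|->]; last exact: gpred1.
  apply: (jP i ji) => //; apply/flattenP; exists [seq b.2 | b <- L t t].
    by apply/mapP; exists t; rewrite ?mem_enum.
  by apply/mapP; exists a.
rewrite sumr_const card_ord; case: eqP => _; last by rewrite mul0rz mul0rn mulr0.
by rewrite raddfMn /= intz mulr_natl.
Qed.

Let trans i (j : 'I_(idx i)) : exists w, act (@cl i 1%g) (wprod s w) = j.
Proof.
have [w wj] := gens (@rep i j); exists w.
by rewrite wj /act (coset_act_cl (@Gs_normal i) (clP i)) mul1g (cl_rep (clP i)).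
Qed.

Let rank_bound rel i : (forall w, w \in rel -> valid s w) ->
  (\rank (rmx (@act i) 'F_p (fox_matrix s rel)) + (idx i - 1) <=
   \rank (map_mx intr (rmx (@act i) int (laplacian s rel)) : 'M[R[i]]_(d * idx i)))%N.
Proof.
move=> relv.
have -> : map_mx intr (rmx (@act i) int (laplacian s rel)) =
    map_mx (real_complex R) (map_mx intr (rmx (@act i) int (laplacian s rel))).
  by rewrite -map_mx_comp; apply: eq_map_mx => k /=; rewrite rmorph_int.
rewrite mxrank_map.
exact: (rank_laplacian_ge (@act1 i) (@actM i) R p_prime relv (@trans i)).
Qed.

Let finite_estimate rel i (K m k : nat) : (forall w, w \in rel -> valid s w) ->
  (1 < K)%N -> (mnorm (laplacian s rel) <= K)%N -> (0 < m)%N ->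
  (\tr (rmx (@act i) int (mpow (madd (mconst G d K) (mopp (laplacian s rel))) (2 * k))))%:~R
    / K%:R ^+ (2 * k) / (idx i)%:R <=
  (vdim rel i)%:R / (idx i)%:R - 1 + (idx i)%:R^-1 +
    (d%:R / m%:R + d%:R * (1 - K%:R ^- m.+1) ^+ (2 * k)) :> R.
Proof.
move=> relv K1 LK m0; set D := rmx (@act i) int (laplacian s rel).
have -> : rmx (@act i) int (mpow (madd (mconst G d K) (mopp (laplacian s rel))) (2 * k)) =
    (K%:R%:M - D) ^+ (2 * k).
  by rewrite (rmx_pow (@act1 i) (@actM i)) rmx_add rmx_opp (rmx_const (@act1 i)).
have := laplacian_gram (@act1 i) (@actM i) s rel; rewrite -/D /=.
set W := row_mx _ _ => DW.
have Dn q : \sum_u `|(W *m W^T) u q| <= K%:Z.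
  by rewrite -DW; apply: le_trans (rmx_col_norm _ _ _) _; rewrite lez_nat.
have rk := rank_bound i relv; rewrite -/D DW in rk.
have est := spectral_estimate K1 Dn k m0 rk.
rewrite -DW in est rk.
rewrite ler_pdivrMr ?ltr0n//; apply: le_trans est _.
set q := (1 - _) ^+ _; set rr := \rank (rmx (@act i) 'F_p (fox_matrix s rel)) in rk *.
have i0 : 0 < (idx i)%:R :> R by rewrite ltr0n.
have rr_le : (rr + (idx i - 1) <= d * idx i)%N by apply: leq_trans rk (rank_leq_row _).
have -> : (d * idx i - (rr + (idx i - 1)))%:R = (vdim rel i)%:R - (idx i)%:R + 1 :> R.
  have e : (d * idx i - (rr + (idx i - 1)) + idx i = vdim rel i + 1)%N.
    by rewrite /vdim -/rr; have := idx_gt0 i; move: rr_le; lia.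
  have := congr1 (fun x => x%:R : R) e; rewrite !natrD => ?; lra.
rewrite natrM le_eqVlt; apply/orP; left; apply/eqP; field.
by rewrite !lt0r_neq0// ltr0n.
Qed.

(** The relations are those that compute the Betti number at level [i], and the
    estimate is made at a level [i' >= i] that depends on [k]. The ratios
    [vdim rel] decrease from [i] to [i'], so that the bound at [i'] is one in
    terms of level [i], up to the two error terms of the spectral estimate. *)
Lemma projective_dim_le (P : set (H1 (@vN_of_group R G))) (r : R) i :
  fg_projective_dim P r -> r <= betti_ratio R p (Gs i).
Proof.
move=> Pr; have [rel [relv relP]] := betti_rel i.
rewrite (relP rel)//; apply/ler_addgt0Pl => e e0.
pose K := (mnorm (laplacian s rel)).+2.
have K1 : (1 < K)%N by [].
have LK : (mnorm (laplacian s rel) <= K)%N by rewrite /K; lia.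
have Kr : 1 < K%:R :> R by rewrite ltr1n.
(* First [m], then [k] makes the corresponding error term at most [e / 2]. *)
pose m := (Num.bound (2 * d%:R / e)).+1.
have dm : d%:R / m%:R <= e / 2.
  have h : 2 * d%:R / e < m%:R.
    apply: lt_trans (archi_boundP _) _; first by rewrite divr_ge0 ?mulr_ge0 ?ler0n// ltW.
    by rewrite ltr_nat.
  rewrite ler_pdivrMr ?ltr0n//; move: h; rewrite ltr_pdivrMr// => ?; lra.
pose q : R := 1 - K%:R ^- m.+1.
have q0 : 0 <= q by rewrite subr_ge0 invf_le1 ?exprn_gt0 ?exprn_ege1// ?ltr0n// ltW.
have q1 : q < 1 by rewrite ltrBlDr ltrDl invr_gt0 exprn_gt0// ltr0n.
have [k dq] : exists k, d%:R * q ^+ (2 * k) <= e / 2.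
  have : (fun k => d%:R * q ^+ k) @ \oo --> d%:R * (0 : R).
    by apply: cvgMr; apply: cvg_expr; rewrite ger0_norm.
  rewrite mulr0 => /cvgr0_norm_le/(_ (e / 2)); rewrite divr_gt0// => /(_ isT).
  move=> [k _ kP]; exists k.
  apply: le_trans (ler_norm _) _; apply: (kP (2 * k)%N); rewrite /=; lia.
have bnd := fg_projective_bound gens relv k Pr (ltnW K1) LK.
set L := mpow _ _ in bnd.
have [j jP] := trace_limit L.
pose i' := maxn i j.
have ii' : (i <= i')%N := leq_maxl _ _.
have tr := jP i' (leq_maxr _ _).
have fin := finite_estimate i' k relv K1 LK (ltn0Sn (Num.bound (2 * d%:R / e))).
rewrite -/L -/m -/q tr in fin.
have Kp : 0 < K%:R ^+ (2 * k) :> R by rewrite exprn_gt0// ltr0n.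
have i0 : 0 < (idx i')%:R :> R by rewrite ltr0n.
have rle : r <= (idx i')%:R * mtr (mev (@vN_of_group R G) L) / K%:R ^+ (2 * k) / (idx i')%:R.
  rewrite mulrC !mulrA mulVf ?lt0r_neq0// mul1r ler_pdivlMr//.
  by rewrite mulrC.
apply: le_trans rle _; apply: le_trans fin _.
have dec := vdim_decr rel ii'.
have inv : (idx i')%:R^-1 <= (idx i)%:R^-1 :> R.
  by rewrite lef_pV2 ?posrE ?ltr0n// ler_nat idx_le.
lra.
Qed.

End Chain.

Theorem theorem1p6 (R : realType) (p : nat) (p_prime : prime p)
    (G : groupType) (G_fg : finitely_generated G)
    (Gs : nat -> groupClosed G)
    (Gs0 : forall x : G, x \in Gs 0%N)
    (Gs_desc : forall i : nat, {subset Gs i.+1 <= Gs i})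
    (Gs_normal : forall i : nat, normal_subgroup (Gs i))
    (Gs_index : forall i : nat, p_power_index p (Gs i)) :
  (nonincreasing_seq (fun i => betti_ratio R p (Gs i)) /\
   cvgn (fun i => betti_ratio R p (Gs i))) /\
  ((forall x : G, (forall i : nat, x \in Gs i) -> x = 1%g) ->
   (l2_b1 R G <= (limn (fun i => betti_ratio R p (Gs i)))%:E)%E).
Proof.
have [d [s gens]] := word_generators G_fg.
have mono := betti_ratio_nonincreasing R p_prime gens Gs_desc Gs_normal Gs_index.
have cvg : cvgn (fun i => betti_ratio R p (Gs i)).
  apply: nonincreasing_is_cvgn => //; exists 0 => _ [i _ <-].
  by rewrite divr_ge0// ler0n.
split=> // Gs_cap; apply: ge_ereal_sup => _ [r [P Pr] <-]; rewrite lee_fin.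
apply: limr_ge => //; apply: nearW => i.
exact: (projective_dim_le p_prime gens Gs_desc Gs_normal Gs_index Gs_cap i Pr).
Qed.
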